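(* The only bounded smooth immersed minimal hypersurface with free boundary on a catenoid is the flat disk supported at the origin.
   Context: Points of $\mathbb{R}^{n+1}$, $n\ge2$, are written $(x,z)$, $x\in\mathbb{R}^n$, $z\in\mathbb{R}$; $Oz$ is the $z$-axis. The catenoid is the support hypersurface $F_\Sigma(\Sigma)=\{(x,z):|x|=\omega_\Sigma(z)\}$, the minimal hypersurface of revolution with axis $Oz$, placed so that its neck (the unique minimum of the profile function $\omega_\Sigma$) is at $z=0$; for $n=2$, $\omega_\Sigma(z)=c\cosh(z/c)$ with $c>0$. Its unit normal $\nu_\Sigma$ points away from the interior of the hypersurfaces supported on it. Minimal hypersurface with free boundary on $F_\Sigma$: a smooth immersion $F:M^n\to\mathbb{R}^{n+1}$ of a compact connected manifold with nonempty boundary, with mean curvature $H\equiv0$, $F(\partial M)\subset F_\Sigma(\Sigma)$ and $\langle\nu,\nu_\Sigma\rangle=0$ along $\partial M$, where $\nu$ is the unit normal of $F$. No assumption on topology, symmetry or graphicality is made. Bounded means that $F(M)$ is a bounded set. The flat disk supported at the origin is $\{(x,0):|x|\le\omega_\Sigma(0)\}$. *)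

(* Defs.v *)
From mathcomp Require Import all_boot all_order all_algebra.
From mathcomp Require Import all_classical all_reals all_analysis.
Set Implicit Arguments.
Unset Strict Implicit.
Unset Printing Implicit Defensive.
Import Order.TTheory GRing.Theory Num.Theory.
Import numFieldNormedType.Exports.
Local Open Scope classical_set_scope.
Local Open Scope ring_scope.

(* A point (x, z) of R^{n+1} is a pair in 'rV[R]_n * R.  The library norms on
   'rV[R]_n and on products are sup norms (they are only used for the topology
   and for boundedness); lengths and angles are computed with the Euclidean
   inner products defined here. *)
Notation ambient R n := ('rV[R]_n * R)%type.

Section Euclidean.
Context {R : realType} {n : nat}.

Definition dot (x y : 'rV[R]_n) : R := \sum_(i < n) x 0 i * y 0 i.
Definition enorm (x : 'rV[R]_n) : R := Num.sqrt (dot x x).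
Definition adot (p q : ambient R n) : R := dot p.1 q.1 + p.2 * q.2.

(* i-th vector of the standard basis *)
Definition evec (i : 'I_n) : 'rV[R]_n := delta_mx 0 i.

End Euclidean.

Section Smooth.
Context {R : realType} {U W : normedModType R}.

(* For open V, this is the class C^k(V, W) when U is finite-dimensional. *)
Fixpoint Ck_on (k : nat) (V : set U) (g : U -> W) : Prop :=
  (forall y, V y -> {for y, continuous g}) /\
  if k is k'.+1 then
    (forall v y, V y -> derivable g y v) /\
    (forall v, Ck_on k' V (fun y => 'D_v g y))
  else True.

Definition smooth_on (V : set U) (g : U -> W) : Prop :=
  forall k, Ck_on k V g.

(* Smoothness on sets that are not open (here, relatively open subsets of a
   half-space) is the local existence of smooth extensions. *)
Definition local_extension (A : set U) (f : U -> W) (y : U) (g : U -> W) :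
    Prop :=
  exists V : set U, [/\ open V, V y, smooth_on V g &
    forall w, V w -> A w -> g w = f w].

Definition smooth_within (A : set U) (f : U -> W) : Prop :=
  forall y, A y -> exists g, local_extension A f y g.

End Smooth.

Section Parametrized.
Context {R : realType} {n : nat}.
Implicit Types (g : 'rV[R]_n -> ambient R n) (y : 'rV[R]_n) (nu : ambient R n).

Definition immersive_at g y : Prop :=
  forall v : 'rV[R]_n, 'D_v g y = 0 -> v = 0.

Definition unit_normal_at g y nu : Prop :=
  adot nu nu = 1 /\ forall v : 'rV[R]_n, adot ('D_v g y) nu = 0.

Definition first_form g y : 'M[R]_n :=
  \matrix_(i, j) adot ('D_(evec i) g y) ('D_(evec j) g y).

Definition second_form g y nu : 'M[R]_n :=
  \matrix_(i, j) adot ('D_(evec i) (fun w => 'D_(evec j) g w) y) nu.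

(* H = g^{ij} h_{ij}, with respect to the unit normal nu *)
Definition mean_curvature g y nu : R :=
  \tr (invmx (first_form g y) *m second_form g y nu).

(* Since mean_curvature is odd in nu, this does not depend on the choice of
   the unit normal, and no orientation is needed. *)
Definition minimal_at g y : Prop :=
  forall nu, unit_normal_at g y nu -> mean_curvature g y nu = 0.

End Parametrized.

Section Manifold.
Context {R : realType} {n : nat}.

(* first coordinate of R^n, written so as to make sense for every n *)
Definition inward : 'rV[R]_n := \row_i (val i == 0%N)%:R.
Definition halfspace : set 'rV[R]_n := [set y | 0 <= dot y inward].

Record chart (M : topologicalType) := Chart {
  cdom : set M;
  crange : set 'rV[R]_n;
  cmap : M -> 'rV[R]_n;
  cinv : 'rV[R]_n -> M }.

(* a homeomorphism of an open subset of M onto a relatively open subset of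
   the half-space *)
Definition is_chart (M : topologicalType) (c : chart M) : Prop :=
  [/\ open (cdom c),
      exists2 O : set 'rV[R]_n, open O & crange c = O `&` halfspace,
      (forall p, cdom c p -> crange c (cmap c p) /\ cinv c (cmap c p) = p),
      (forall y, crange c y -> cdom c (cinv c y) /\ cmap c (cinv c y) = y) &
      {within cdom c, continuous (cmap c)} /\
      {within crange c, continuous (cinv c)}].

(* Smooth manifolds with boundary.  Second countability is not listed: only
   compact manifolds are considered, for which it is automatic. *)
Definition smooth_atlas (M : topologicalType) (A : set (chart M)) : Prop :=
  [/\ hausdorff_space M,
      (forall c, A c -> is_chart c),
      (forall p, exists2 c, A c & cdom c p) &
      (forall c d, A c -> A d ->
        smooth_within (crange c `&` cinv c @^-1` cdom d) (cmap d \o cinv c))].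

Definition boundary (M : topologicalType) (A : set (chart M)) : set M :=
  [set p | exists c, [/\ A c, cdom c p & dot (cmap c p) inward = 0]].

End Manifold.
Arguments chart R n M : clear implicits.

Section Hypersurface.
Context {R : realType} {n : nat} {M : topologicalType}.
Implicit Types (A : set (chart R n M)) (F : M -> ambient R n).

(* g is a smooth map near y that agrees with F read in the chart c.  All the
   derivatives of g at y are determined by F, even when y is on the boundary
   of the half-space. *)
Definition local_rep F (c : chart R n M) y g : Prop :=
  local_extension (crange c) (F \o cinv c) y g.

Definition smooth_immersion A F : Prop :=
  (forall c, A c -> smooth_within (crange c) (F \o cinv c)) /\
  (forall c y g, A c -> crange c y -> local_rep F c y g -> immersive_at g y).

Definition minimal_immersion A F : Prop :=
  smooth_immersion A F /\
  (forall c y g, A c -> crange c y -> local_rep F c y g -> minimal_at g y).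

End Hypersurface.

Section Catenoid.
Context {R : realType} {n : nat}.

Definition revolution (I : set R) (omega : R -> R) : set (ambient R n) :=
  [set p | I p.2 /\ enorm p.1 = omega p.2].

(* normalized gradient of |x| - omega z *)
Definition revolution_normal (omega : R -> R) (p : ambient R n) : ambient R n :=
  (Num.sqrt (1 + derive1 omega p.2 ^+ 2))^-1 *:
    (((enorm p.1)^-1 *: p.1, - derive1 omega p.2) : ambient R n).

(* every smooth immersed local parametrization with values in S has zero mean
   curvature *)
Definition minimal_set (S : set (ambient R n)) : Prop :=
  forall (V : set 'rV[R]_n) (g : 'rV[R]_n -> ambient R n),
    open V -> smooth_on V g -> (forall y, V y -> immersive_at g y) ->
    g @` V `<=` S -> forall y, V y -> minimal_at g y.

End Catenoid.

(* The profile lives on an open interval I, which is the whole line for n = 2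
   but is bounded for n >= 3; closedness of the hypersurface of revolution says
   that the catenoid is complete, i.e. that I is maximal. *)
Definition catenoid_profile (R : realType) (n : nat) (I : set R)
    (omega : R -> R) : Prop :=
  [/\ [/\ open I, is_interval I & I 0],
      smooth_on I omega /\ (forall z, I z -> 0 < omega z),
      closed (revolution (n := n) I omega),
      minimal_set (revolution (n := n) I omega) &
      (forall z, I z -> z != 0 -> omega 0 < omega z)].

(* The sign s selects the unit normal nu_Sigma of the catenoid among the two
   continuous ones; the last condition says that it points away from the
   hypersurface, 'D_inward g y being a tangent vector that points into it. *)
Definition free_boundary (R : realType) (n : nat) (I : set R) (omega : R -> R)
    (M : topologicalType) (A : set (chart R n M)) (F : M -> ambient R n) :
    Prop :=
  F @` boundary A `<=` revolution I omega /\
  exists s : bool,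
    let nuS p := (-1) ^+ s *: revolution_normal omega p in
    forall c y g, A c -> crange c y -> dot y inward = 0 -> local_rep F c y g ->
      (forall nu, unit_normal_at g y nu -> adot nu (nuS (F (cinv c y))) = 0) /\
      adot ('D_inward g y) (nuS (F (cinv c y))) < 0.

Definition free_boundary_minimal_hypersurface (R : realType) (n : nat)
    (I : set R) (omega : R -> R) (M : topologicalType)
    (A : set (chart R n M)) (F : M -> ambient R n) : Prop :=
  [/\ smooth_atlas A,
      compact [set: M] /\ connected [set: M],
      boundary A !=set0,
      minimal_immersion A F &
      free_boundary I omega A F].

Definition flat_disk (R : realType) (n : nat) (omega : R -> R) :
    set (ambient R n) :=
  [set p | p.2 = 0 /\ enorm p.1 <= omega 0].

(* Main.v *)
Require Import Defs.
From mathcomp Require Import all_boot all_order all_algebra.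
From mathcomp Require Import all_classical all_reals all_analysis.
From mathcomp Require Import ring lra.
Import Order.TTheory GRing.Theory Num.Theory.
Import numFieldNormedType.Exports.
Local Open Scope classical_set_scope.
Local Open Scope ring_scope.
Set Implicit Arguments.
Unset Strict Implicit.
Unset Printing Implicit Defensive.

(** Uniqueness rests on the maximum principle for the test functions
    [phi k e (x, z) = k z + e |x|^2], with [k] in {0, 1, -1} and [e > 0].  Along
    a minimal hypersurface the Laplacian of [phi] is
    [2 e (n - |grad z|^2) >= 2 e (n - 1) > 0], whatever [k] is; so [phi] has no
    interior maximum ([interior_no_max]) and, the hypersurface being compact,
    it is maximal at a boundary point, where its derivative along the outer
    conormal is nonnegative ([conormal_phi_ge0]).  By the free boundary
    condition this conormal is, up to a sign, the normal of the catenoid.  The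
    case [k = 0] shows that the sign is [+]; so a maximum point of [phi] lies
    on the catenoid, at a height [z] with
    [k * omega' z <= 2 * e * omega z] ([phi_max_spec]).

    The vanishing mean curvature of the catenoid means that
    [omega * omega'' = (n - 1) (1 + omega'^2)], hence that [omega'] is strictly
    increasing ([catenoid_omega2_gt0]), and it vanishes at the neck.  If [k z],
    for [k = 1] or [k = -1], took a positive value [m] on the hypersurface,
    then for small [e] the maximum of [phi] would be at a point with
    [k z >= m / 2], where [k * omega' z] is bounded below by a positive
    constant, while [2 * e * omega z] tends to 0 with [e]; this is absurd
    ([height_le0]).  Thus [z = 0] on the hypersurface, its boundary lies on the
    sphere [|x| = omega 0], and the case [k = 0] bounds [|x|] by [omega 0]
    everywhere ([free_boundary_flat]).

    The horizontal part of the immersion is then an immersion of the compact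
    manifold into the closed disk of the same dimension.  It is locally
    injective, and open as a map into the disk, also at boundary points because
    they are sent to the boundary sphere ([open_in_disk]).  A map of this kind
    is a covering of the disk, and a covering of a convex set by a connected
    space is bijective: a section is constructed by extending it step by step
    over larger and larger homothetic copies of the disk
    ([covering_convex_bijective]).

    For existence, the closed disk gets an atlas of two charts with values in
    the whole half-space, inverse to the Cayley transform of the half-space
    onto the ball without a pole, followed by a homothety of ratio [r] or [-r].
    The inclusion of the disk in the hyperplane [z = 0] has vanishing second
    form, and at the neck the normal of the catenoid is horizontal and radial
    ([disk_free_boundary_minimal]). *)

(** * Local homeomorphisms onto convex sets *)

(** Two lifts through a locally injective map that agree at one point of a
    connected set agree on the whole set. *)
Lemma eq_lifts (X M : topologicalType) (Y : Type) (f : M -> Y)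
    (A : set X) (h1 h2 : X -> M) :
  hausdorff_space M ->
  (forall p : M, exists2 W, nbhs p W & {in W &, injective f}) ->
  connected A -> {within A, continuous h1} -> {within A, continuous h2} ->
  (forall x, A x -> f (h1 x) = f (h2 x)) ->
  forall x0, A x0 -> h1 x0 = h2 x0 -> forall x, A x -> h1 x = h2 x.
Proof.
move=> hM finj cA /subspace_continuousP c1 /subspace_continuousP c2 fh x0 Ax0 h0.
pose P x := A x -> h1 x = h2 x.
pose Q x := A x -> h1 x <> h2 x.
have Popen x : A x -> h1 x = h2 x -> nbhs x P.
  move=> Ax hx; have [W Wp Winj] := finj (h1 x).
  have n1 : \forall y \near x, A y -> W (h1 y) by apply: c1.
  have n2 : \forall y \near x, A y -> W (h2 y) by move: Wp; rewrite hx; exact: c2.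
  apply: filterS2 n1 n2 => y W1 W2 Ay; apply: Winj; rewrite ?inE; [exact: W1|exact: W2|exact: fh].
have Qopen x : A x -> h1 x <> h2 x -> nbhs x Q.
  move=> Ax /eqP hx; move: (hM); rewrite open_hausdorff => /(_ _ _ hx)[[U V] /= [/set_mem Ux /set_mem Vx] [oU oV /eqP UV]].
  have n1 : \forall y \near x, A y -> U (h1 y) by apply: c1 => //; exact: open_nbhs_nbhs.
  have n2 : \forall y \near x, A y -> V (h2 y) by apply: c2 => //; exact: open_nbhs_nbhs.
  apply: filterS2 n1 n2 => y U1 V2 Ay hy; have : (U `&` V) (h1 y) by split; [exact: U1| rewrite hy; exact: V2].
  by rewrite UV.
have [x1|eqA] := pselect (A `&` [set x | h1 x = h2 x] = A).
  by move=> x; rewrite -x1 => -[].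
case: eqA; apply: cA.
- by exists x0.
- exists (interior P); first exact: open_interior.
  apply/seteqP; split=> x -[Ax hx]; split=> //; first exact: Popen.
  by have := interior_subset hx; exact.
- exists (~` interior Q); first exact/open_closedC/open_interior.
  apply/seteqP; split=> x -[Ax hx]; split=> //.
    by move=> /interior_subset Qx; exact: Qx.
  by apply: contrapT => hx'; apply: hx; exact: Qopen.
Qed.

(** A set that contains the segments between its points is connected. *)
Lemma segment_convex_connected (R : realType) (E : normedModType R) (C : set E) :
  (forall a b t, C a -> C b -> 0 <= t <= 1 -> C (a + t *: (b - a))) -> connected C.
Proof.
move=> cC; have [[a Ca]|C0] := pselect (C !=set0); last first.
  suff -> : C = set0 by exact: connected0.
  by apply/seteqP; split=> // x Cx; apply: C0; exists x.
pose S b : set E := (fun t : R => a + t *: (b - a)) @` `[0, 1].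
have -> : C = \bigcup_(b in C) S b.
  apply/seteqP; split=> x.
    move=> Cx; exists x => //; exists 1; first by rewrite /= in_itv /= lexx ler01.
    by rewrite scale1r addrC subrK.
  by move=> [b Cb [t]] /=; rewrite in_itv /= => ht <-; exact: cC.
apply: bigcup_connected.
  exists a => b Cb; exists 0; first by rewrite /= in_itv /= lexx ler01.
  by rewrite scale0r addr0.
move=> b _; apply: connected_continuous_connected; first exact: segment_connected.
apply: continuous_subspaceT => t; apply: cvgD; first exact: cvg_cst.
by apply: cvgZr_tmp; exact: cvg_id.
Qed.

(** A locally injective map from a compact connected space to a bounded convex
    set, open as a map to this set, is a bijection. *)
Section Covering.
Context {R : realType} {E : normedModType R} {M : topologicalType}.
Variables (f : M -> E) (D : set E).
Hypothesis hM : hausdorff_space M.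
Hypothesis cM : compact [set: M].
Hypothesis coM : connected [set: M].
Hypothesis cf : continuous f.
Hypothesis fD : forall p, D (f p).
Hypothesis convD : forall a b t, D a -> D b -> 0 <= t <= 1 -> D (a + t *: (b - a)).
Hypothesis finj : forall p : M, exists2 W, nbhs p W & {in W &, injective f}.
Hypothesis fopen : forall (p : M) W, nbhs p W -> exists2 d : R, 0 < d &
  forall q, D q -> `|q - f p| < d -> exists2 p', W p' & f p' = q.

(** A continuous section of f over C. *)
Definition section_on (C : set E) (s : E -> M) :=
  {within C, continuous s} /\ forall q, C q -> f (s q) = q.

(* The trace on D of the ball of centre a and radius d. *)
Let nball (a : E) (d : R) : set E := [set q | D q /\ `|q - a| < d].

(** Near [p], the sections through the points [p'] have a common radius of
    definition. *)
Lemma local_section (p : M) : exists2 d : R, 0 < d & \forall p' \near p,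
  exists s, section_on (nball (f p') d) s /\ s (f p') = p'.
Proof.
have [W0 W0p Winj] := finj p.
have Wi : nbhs p (interior W0) by exact: nbhs_interior.
have oW : open (interior W0) by exact: open_interior.
have [d d0 dW] := fopen Wi.
exists (d / 2); first by rewrite divr_gt0.
have n1 : \forall p' \near p, `|f p' - f p| < d / 2.
  have /cvgrPdistC_lt := @cf p; apply; by rewrite divr_gt0.
have n2 : \forall p' \near p, interior W0 p' by [].
apply: filterS2 n1 n2 => p' hp' Wp'.
have /choice[s hs] : forall q, exists p1, nball (f p) d q -> interior W0 p1 /\ f p1 = q.
  move=> q; have [[Dq hq]|] := pselect (nball (f p) d q); last by exists p.
  by have [p1 W1 fp1] := dW q Dq hq; exists p1.
have sub q : nball (f p') (d / 2) q -> nball (f p) d q.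
  move=> [Dq hq]; split=> //; rewrite (splitr d) -(subrK (f p') q) -addrA.
  by rewrite (le_lt_trans (ler_normD _ _))// ltrD.
exists s; split; last first.
  have hp2 : nball (f p) d (f p').
    by split=> //; rewrite (lt_trans hp')// ltr_pdivrMr// ltr_pMr// ltr1n.
  have [Wsp fsp] := hs _ hp2.
  by apply: Winj; rewrite ?inE//; exact: interior_subset.
split=> [|q /sub /hs []//].
apply/subspace_continuousP => q hq O Oq.
have [Wq fq] := hs _ (sub _ hq).
have OW : nbhs (s q) (O `&` interior W0) by apply: filterI => //; exact: open_nbhs_nbhs.
have [e e0 he] := fopen OW.
have : \forall q' \near q, `|q' - q| < e by move: e e0 {he}; apply/cvgrPdistC_lt; exact: cvg_id.
apply: filterS => q' hq' hq'2.
have [Wq' fq'] := hs _ (sub _ hq'2).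
have [|p2 [Op2 Wp2] fp2] := he q' hq'2.1; first by rewrite fq.
suff e1 : s q' = p2 by have : O (s q') by rewrite e1.
by apply: Winj; rewrite ?inE ?fq' ?fp2//; exact: interior_subset.
Qed.

(** By compactness, one radius suits all the points of the source. *)
Lemma uniform_local_section : exists2 d : R, 0 < d & forall p : M,
  exists s, section_on (nball (f p) d) s /\ s (f p) = p.
Proof.
pose P (d : R) p := exists s, section_on (nball (f p) d) s /\ s (f p) = p.
have : \forall d \near 0^'+, [set: M] `<=` P d.
  apply: (compact_near_coveringP _).1 => // p _.
  have [d d0 hd] := local_section p.
  exists ([set p' | P d p'], [set e | e < d]) => /=.
    by split=> //; exact: nbhs_right_lt.
  move=> [p' e] [/= [s [[cs fs] sp']] ed]; exists s; split=> //.
  have sub : nball (f p') e `<=` nball (f p') d by move=> q [Dq hq]; split=> //; exact: lt_trans ed.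
  split=> [|q /sub]; last exact: fs.
  exact: continuous_subspaceW cs.
move=> hP; have : \forall d \near 0^'+, 0 < d /\ [set: M] `<=` P d.
  by apply: filterS2 (nbhs_right_gt 0) hP => d d0 hd; split.
by move=> /filter_ex[d [d0 hd]]; exists d => // p; exact: hd.
Qed.

(* The homothetic copy of D of ratio t and centre a. *)
Let shrink (a : E) (t : R) : set E := [set q | exists2 b, D b & q = a + t *: (b - a)].

Lemma shrink_segment a t : D a -> 0 <= t <= 1 -> forall x y u, shrink a t x -> shrink a t y ->
  0 <= u <= 1 -> shrink a t (x + u *: (y - x)).
Proof.
move=> Da ht x y u [b Db ->] [c Dc ->] hu; exists (b + u *: (c - b)); first exact: convD.
have e1 : a + t *: (c - a) - (a + t *: (b - a)) = t *: (c - b).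
  by rewrite opprD addrACA subrr add0r -scalerBr opprB addrA subrK.
by rewrite e1 scalerA (mulrC u) -scalerA -addrA -scalerDr addrAC.
Qed.

(** A section over [shrink a t] extends to the slightly larger [shrink a t']:
    a point [q] of the latter is close to its image [b q] in the former, and the
    extension sends [q] to its image under the local section through [s (b q)]. *)
Lemma section_extension d a p0 t t' K s : 0 < d ->
  (forall p, exists s, section_on (nball (f p) d) s /\ s (f p) = p) ->
  D a -> f p0 = a -> (forall b, D b -> `|b - a| <= K) ->
  0 <= t -> t < t' -> t' <= 1 -> (t' - t) * K < d ->
  section_on (shrink a t) s -> s a = p0 ->
  exists s', section_on (shrink a t') s' /\ s' a = p0.
Proof.
move=> d0 hd Da fp0 hK t0 tt' t'1 tK [cs fs] sa.
have [sg hsg] := choice hd.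
have t'0 : 0 < t' by exact: le_lt_trans tt'.
pose b q := a + (t / t') *: (q - a).
have bD q : shrink a t' q -> [/\ D q, shrink a t (b q), D (b q) & `|q - b q| < d].
  move=> [c Dc ->].
  have bE : b (a + t' *: (c - a)) = a + t *: (c - a).
    by rewrite /b (addrC a (t' *: _)) addrK scalerA divfK ?gt_eqF// addrC.
  have t'01 : 0 <= t' <= 1 by rewrite ltW.
  have t01 : 0 <= t <= 1 by rewrite t0 (le_trans (ltW tt')).
  rewrite bE; split; [exact: convD|by exists c|exact: convD|].
  rewrite opprD addrACA subrr add0r -scalerBl normrZ ger0_norm ?subr_ge0 ?ltW//.
  by rewrite (le_lt_trans _ tK)// ler_wpM2l ?subr_ge0 ?(ltW tt')// hK.
have cb : continuous b.
  move=> q; apply: cvgD; first exact: cvg_cst.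
  by apply: cvgZl_tmp; apply: cvgB; [exact: cvg_id|exact: cvg_cst].
pose s' q := sg (s (b q)) q.
have ba : b a = a by rewrite /b subrr scaler0 addr0.
exists s'; split; last by rewrite /s' ba sa; have [_] := hsg p0; rewrite fp0.
split; last first.
  move=> q /bD[Dq Sb Db qb]; rewrite /s'; have [[_ h] _] := hsg (s (b q)); apply: h.
  by split=> //; rewrite fs.
apply/subspace_continuousP => q0 Sq0.
have [Dq0 Sb0 Db0 qb0] := bD _ Sq0.
set b0 := b q0 in Sb0 Db0 qb0; pose p1 := s b0.
have [[csg fsg] sgp1] := hsg p1.
have fp1 : f p1 = b0 by exact: fs.
have cnt O : nbhs (sg p1 q0) O -> \forall q \near q0, nball b0 d q -> O (sg p1 q).
  move=> hO; move: csg; rewrite fp1 => /subspace_continuousP/(_ q0) /=; apply=> //.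
suff loc : \forall q \near q0, shrink a t' q -> s' q = sg p1 q /\ nball b0 d q.
  move=> O; have [e1 _] := nbhs_singleton loc Sq0; rewrite /from_subspace e1 => /cnt.
  by apply: filterS2 loc => q h1 h2 Sq; have [e2 hb] := h1 Sq; rewrite /= e2; exact: h2.
have n1 : \forall q \near q0, `|b q - b0| < d by move: d d0 {hd tK hsg csg fsg sgp1 bD qb0 cnt}; apply/cvgrPdistC_lt; exact: cb.
have n2 : \forall q \near q0, `|q - b0| < d.
  have : (fun q : E => `|q - b0|) @ q0 --> `|q0 - b0|.
    by apply: cvg_norm; apply: cvgB; [exact: cvg_id|exact: cvg_cst].
  by move=> /cvgr_lt; apply.
apply: filterS2 n1 n2 => q bq qb0' Sq.
have [Dq Sb Db qb] := bD _ Sq.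
have [[csg2 fsg2] sgp2] := hsg (s (b q)).
have fsb : f (s (b q)) = b q by exact: fs.
(* On the convex set C of points of D close to both b0 and b q, the two local
   sections agree at b q, hence at q. *)
pose C := nball b0 d `&` nball (b q) d.
have convball c : forall x y u, nball c d x -> nball c d y -> 0 <= u <= 1 -> nball c d (x + u *: (y - x)).
  move=> x y u [Dx xc] [Dy yc] u01; split; first exact: convD.
  have -> : x + u *: (y - x) - c = (1 - u) *: (x - c) + u *: (y - c).
    rewrite scalerBl scale1r addrAC -[RHS]addrA; congr (_ + _).
    by rewrite addrC -scalerBr opprB addrA subrK.
  have m1 : `|x - c| <= Num.max `|x - c| `|y - c| by rewrite le_max lexx.
  have m2 : `|y - c| <= Num.max `|x - c| `|y - c| by rewrite le_max lexx orbT.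
  have m3 : Num.max `|x - c| `|y - c| < d by rewrite gt_max xc yc.
  apply: le_lt_trans m3; apply: (le_trans (ler_normD _ _)).
  case/andP: u01 => u0 u1; rewrite !normrZ !ger0_norm ?subr_ge0//.
  have h1 := ler_wpM2l u0 m2.
  have u1' : 0 <= 1 - u by rewrite subr_ge0.
  have h2 := ler_wpM2l u1' m1.
  by rewrite (le_trans (lerD h2 h1))// -mulrDl subrK mul1r.
have agree : s (b q) = sg p1 (b q).
  apply: (@eq_lifts _ _ _ f (shrink a t `&` nball b0 d) s (sg p1) hM finj) => //.
  - apply: segment_convex_connected => x y u [Sx Cx] [Sy Cy] u01; split; last exact: convball.
    by apply: shrink_segment => //; rewrite t0 (le_trans (ltW tt')).
  - by apply: continuous_subspaceW cs => x [].
  - by apply: continuous_subspaceW csg => x [_]; rewrite fp1.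
  - by move=> x [Sx Cx]; rewrite fs// fsg// fp1.
  - by split; [exact: Sb0|split=> //; rewrite subrr normr0].
  - by rewrite -/p1 -{1}sgp1 fp1.
have Cb : nball (b q) d (b q) by split=> //; rewrite subrr normr0.
split=> //; rewrite /s'.
apply: (@eq_lifts _ _ _ f C _ _ hM finj _ _ _ _ (b q)) => //.
- by apply: segment_convex_connected => x y u [X1 X2] [Y1 Y2] u01; split; exact: convball.
- by apply: continuous_subspaceW csg2 => x [_]; rewrite fsb.
- by apply: continuous_subspaceW csg => x []; rewrite fp1.
- by move=> x [C1 C2]; rewrite fsg2 ?fsg ?fp1 ?fsb.
- by rewrite -agree -[X in sg _ X]fsb.
Qed.

Lemma covering_convex_bijective (p0 : M) K : (forall b, D b -> `|b - f p0| <= K) ->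
  injective f /\ range f = D.
Proof.
move=> hK; have [d d0 hd] := uniform_local_section.
have K0 : 0 <= K by rewrite (le_trans _ (hK (f p0) (fD p0))).
pose N := (Num.truncn (K / d)).+1.
have N0 : 0 < N%:R :> R by rewrite ltr0n.
have KN : K / N%:R < d.
  by rewrite ltr_pdivrMr// mulrC -ltr_pdivrMr// truncnS_gt.
have [s [[cs fs] sp0]] : exists s, section_on (shrink (f p0) 1) s /\ s (f p0) = p0.
  suff : forall k, (k <= N)%N ->
      exists s, section_on (shrink (f p0) (k%:R / N%:R)) s /\ s (f p0) = p0.
    by move=> /(_ N (leqnn N)); rewrite divff ?gt_eqF.
  elim=> [_|k IH kN].
    exists (cst p0); split=> //; split=> [|_ [b Db ->]]; first exact/continuous_subspaceT/cst_continuous.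
    by rewrite mul0r scale0r addr0.
  have [s [ss sp]] := IH (ltnW kN).
  apply: (section_extension d0 hd (fD p0) erefl hK _ _ _ _ ss sp).
  - by rewrite divr_ge0.
  - by rewrite ltr_pM2r ?invr_gt0// ltr_nat.
  - by rewrite ler_pdivrMr// mul1r ler_nat.
  - by rewrite -mulrBl -natrB// subSnn mul1r mulrC.
have sD q : D q -> shrink (f p0) 1 q.
  by move=> Dq; exists q => //; rewrite scale1r addrC subrK.
have sf p : p = s (f p).
  have csf : continuous (s \o f).
    move=> x O hO; move/subspace_continuousP : cs => /(_ (f x) (sD _ (fD x)) O hO).
    move=> h; have : nbhs x (f @^-1` _) := @cf x _ h; apply: (@filterS _ (nbhs x)) => y hy; apply: hy; exact: sD.
  apply: (@eq_lifts _ _ _ f setT id (s \o f) hM finj coM _ _ _ p0) => //.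
  - by apply: continuous_subspaceT => x; exact: cvg_id.
  - exact: continuous_subspaceT.
  - by move=> x _ /=; rewrite fs//; exact: sD.
split; first by move=> p p' e; rewrite (sf p) (sf p') e.
apply/seteqP; split=> [_ [p _ <-]//|q Dq].
by exists (s q) => //; apply: fs; exact: sD.
Qed.

End Covering.

(** * Directional derivatives *)

Lemma is_derive_cvg (R : realType) (U W : normedModType R) (f : U -> W) y v l :
  h^-1 *: (f (h *: v + y) - f y) @[h --> 0^'] --> l -> is_derive y v f l.
Proof.
by move=> fl; split; [apply/cvg_ex; exists l|apply/cvg_lim].
Qed.

Lemma derive_cvg (R : realType) (U W : normedModType R) (f : U -> W) y v :
  derivable f y v ->
  h^-1 *: (f (h *: v + y) - f y) @[h --> 0^'] --> 'D_v f y.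
Proof. by []. Qed.

Section DirectionalDerivatives.
Context {R : realType} {U : normedModType R}.

Lemma line_cvg (v y : U) : (fun t : R => t *: v + y) @ (0 : R) --> y.
Proof.
rewrite -[X in _ --> X]add0r -(scale0r v).
by apply: cvgD; [apply: cvgZr_tmp; exact: cvg_id|exact: cvg_cst].
Qed.

Lemma is_derive_line (W : normedModType R) (f : U -> W) y v t l :
  is_derive (t *: v + y) v f l -> is_derive t 1 (fun s : R => f (s *: v + y)) l.
Proof.
move=> [df <-]; apply: is_derive_cvg; have := derive_cvg df.
apply: cvg_trans; apply: near_eq_cvg; near=> h.
by rewrite addrA -scalerDl /= [h *: 1]mulr1.
Unshelve. all: by end_near. Qed.

(** Postcomposition with a continuous linear map commutes with derivation. *)
Lemma is_derive_linear (W W' : normedModType R) (l : W -> W') f y v d :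
  linear l -> continuous l -> is_derive y v f d -> is_derive y v (l \o f : U -> W') (l d).
Proof.
move=> ll cl [df <-]; apply: is_derive_cvg.
have lB a b : l (a - b) = l a - l b.
  by have := ll (-1) b a; rewrite !scaleN1r ![- _ + _]addrC.
have l0 : l 0 = 0 by have := lB 0 0; rewrite !subrr.
have lZ a b : l (a *: b) = a *: l b by have := ll a b 0; rewrite l0 !addr0.
have /cvg_comp := derive_cvg df; move=> /(_ _ _ _ (cl _)).
by apply: cvg_trans; apply: near_eq_cvg; near=> h; rewrite /= lZ lB.
Unshelve. all: by end_near. Qed.

Lemma is_derive_pair (W W' : normedModType R) (f : U -> W) (g : U -> W') y v d e :
  is_derive y v f d -> is_derive y v g e -> is_derive y v (fun x => (f x, g x)) (d, e).
Proof.
move=> [df <-] [dg <-]; apply: is_derive_cvg.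
exact: (cvg_pair (derive_cvg df) (derive_cvg dg)).
Qed.

Lemma is_derive_chain (w : R -> R) (f : U -> R) y v d e :
  is_derive (f y) 1 w e -> is_derive y v f d -> is_derive y v (w \o f) (e * d).
Proof.
move=> we [df fd]; rewrite -fd.
have d0 : is_derive (0 : R) 1 (fun s : R => f (s *: v + y)) ('D_v f y).
  by apply: is_derive_line; rewrite scale0r add0r; exact: DeriveDef.
have we' : is_derive (f (0 *: v + y)) 1 w e by rewrite scale0r add0r.
have [dc ec] := is_derive1_comp we' d0.
have h : derivable (w \o f) y v by apply/derivable1P.
split=> //; rewrite -ec /derive; set g1 := fun h => h^-1 *: _; set g2 := fun h => h^-1 *: _.
suff -> : g1 = g2 by [].
by rewrite funeqE /g1 /g2 => h' /=; rewrite addr0 scale0r add0r [_%:A]mulr1.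
Qed.

Lemma is_derive_scale (W : normedModType R) (f : U -> W) y v a d :
  is_derive y v f d -> is_derive y (a *: v) f (a *: d).
Proof.
have [->|a0] := eqVneq a 0; first by rewrite !scale0r => _; exact: is_derive0.
move=> [df <-]; apply: is_derive_cvg.
have h1 : a * h @[h --> (0 : R)^'] --> (0 : R)^'.
  have h2 : a * h @[h --> (0 : R)] --> (0 : R).
    by rewrite -[X in _ --> X](mulr0 a); apply: cvgMl_tmp; exact: cvg_id.
  move=> A [e /= e0 eA]; have : \forall h \near (0 : R), `|0 - a * h| < e.
    by have /cvgrPdist_lt/(_ e e0) := h2.
  by apply: filterS => h he h0; apply: eA => //; rewrite mulf_neq0.
have h2 : (a * h)^-1 *: (f ((a * h) *: v + y) - f y) @[h --> 0^'] --> 'D_v f y.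
  exact: cvg_comp _ _ h1 (derive_cvg df).
have h3 : a *: ((a * h)^-1 *: (f ((a * h) *: v + y) - f y)) @[h --> 0^'] --> a *: 'D_v f y.
  exact: cvgZl_tmp.
apply: cvg_trans h3; apply: near_eq_cvg; near=> h.
by rewrite /= scalerA invfM mulrA mulfV// mul1r scalerA (mulrC a).
Unshelve. all: by end_near. Qed.

(** The mean value theorem along a segment. *)
Lemma mean_value_line (f : U -> R) y v :
  (forall t : R, 0 <= t <= 1 -> derivable f (t *: v + y) v) ->
  (forall t : R, 0 <= t <= 1 -> {for t *: v + y, continuous f}) ->
  exists2 t, 0 < t < 1 & f (v + y) - f y = 'D_v f (t *: v + y).
Proof.
move=> df cf.
have [||t] := @MVT R (fun s : R => f (s *: v + y)) (fun t => 'D_v f (t *: v + y)) 0 1 ltr01.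
- move=> t; rewrite in_itv /= => /andP[t0 t1].
  by apply: is_derive_line; apply: DeriveDef => //; apply: df; rewrite !ltW.
- apply/subspace_continuousP => t; rewrite /= in_itv /= => ht.
  apply: cvg_within_filter.
  apply: (@continuous_comp _ _ _ (fun s : R => s *: v + y) f); last exact: cf.
  by apply: cvgD; [apply: cvgZr_tmp; exact: cvg_id|exact: cvg_cst].
- by rewrite in_itv /= scale1r scale0r add0r subr0 mulr1 => t01 e; exists t.
Qed.

(** Fermat's rule for a one-sided maximum. *)
Lemma derive_le0_right (f : U -> R) y v : derivable f y v ->
  (\forall t \near (0:R)^'+, f (t *: v + y) <= f y) -> 'D_v f y <= 0.
Proof.
move=> df hf.
have : h^-1 *: (f (h *: v + y) - f y) @[h --> 0^'+] --> 'D_v f y.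
  exact: cvg_dnbhs_at_right (derive_cvg df).
move=> /cvgr_to_le; apply; apply: filterS2 (nbhs_right_gt 0) hf => h h0 hle.
by rewrite /= mulr_ge0_le0 ?invr_ge0 ?(ltW h0)// subr_le0.
Qed.

Lemma derive_eq0_max (f : U -> R) y v : derivable f y v ->
  (\forall t \near (0:R), f (t *: v + y) <= f y) -> 'D_v f y = 0.
Proof.
move=> df hf.
have h1 : 'D_v f y <= 0 by apply: derive_le0_right => //; exact: cvg_within.
have dN : is_derive y (- v) f (- 'D_v f y).
  have := is_derive_scale (-1) (derivableP df).
  by rewrite !scaleN1r.
have h2 : 'D_(- v) f y <= 0.
  apply: derive_le0_right; first by case: dN.
  have h3 : \forall t \near (0 : R), f (- t *: v + y) <= f y.
    have : - t @[t --> (0 : R)] --> (0 : R).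
      by rewrite -[X in _ --> X]oppr0; apply: cvgN; exact: cvg_id.
    by move=> /(_ _ hf).
  by apply: cvg_within; apply: filterS h3 => t; rewrite scaleNr scalerN.
by apply/eqP; rewrite eq_le h1 -oppr_le0 -(@derive_val _ _ _ _ _ _ _ dN).
Qed.

(** A second derivative at an interior maximum is nonpositive. *)
Lemma derive2_le0_max (f : U -> R) y v :
  (\forall x \near y, derivable f x v) -> derivable ('D_v f) y v ->
  (\forall t \near (0:R), f (t *: v + y) <= f y) -> 'D_v ('D_v f) y <= 0.
Proof.
move=> df ddf hf; have d0 : 'D_v f y = 0.
  by apply: derive_eq0_max hf; exact: nbhs_singleton df.
rewrite leNgt; apply/negP => D2.
have df' : \forall t \near (0 : R), derivable f (t *: v + y) v := @line_cvg v y _ df.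
have pos : \forall t \near (0:R)^'+, 0 < 'D_v f (t *: v + y).
  have := cvg_dnbhs_at_right (derive_cvg ddf); rewrite d0 => h.
  have h2 : \forall t \near (0:R)^'+, 0 < t^-1 *: ('D_v f (t *: v + y) - 0) := cvgr_gt _ h _ D2.
  near=> t; have t0 : 0 < t by [].
  have : 0 < t^-1 *: ('D_v f (t *: v + y) - 0) by near: t; exact: h2.
  by rewrite subr0 pmulr_rgt0// invr_gt0.
have [e /= e0 he] : \forall t \near (0:R)^'+, 0 < 'D_v f (t *: v + y) by [].
have [e1 /= e10 he1] := df'.
have [e2 /= e20 he2] := hf.
pose s := Num.min e (Num.min e1 e2) / 2.
have m0 : 0 < Num.min e (Num.min e1 e2) by rewrite !lt_min e0 e10 e20.
have s0 : 0 < s by rewrite divr_gt0.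
have : s < Num.min e (Num.min e1 e2) by rewrite ltr_pdivrMr// ltr_pMr// ltr1n.
rewrite !lt_min => /and3P[se se1 se2].
have fs : f (s *: v + y) <= f y by apply: he2; rewrite /= sub0r normrN gtr0_norm.
have ab t : 0 <= t <= s -> `|0 - t| < e1.
  by move=> /andP[t0 ts]; rewrite sub0r normrN ger0_norm// (le_lt_trans ts).
have dl t : 0 <= t <= s -> is_derive t 1 (fun s : R => f (s *: v + y)) ('D_v f (t *: v + y)).
  by move=> ts; apply: is_derive_line; apply: derivableP; apply: he1; exact: ab.
have [||t] := @MVT R (fun s : R => f (s *: v + y)) (fun t => 'D_v f (t *: v + y)) 0 s s0.
- by move=> t; rewrite in_itv /= => /andP[t0 t1]; apply: dl; rewrite !ltW.
- apply/subspace_continuousP => t; rewrite /= in_itv /= => ht.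
  apply: cvg_within_filter; apply: differentiable_continuous.
  by apply/derivable1_diffP; have [] := dl t ht.
rewrite in_itv /= scale0r add0r subr0 => /andP[t0 ts] e3.
have : 0 < 'D_v f (t *: v + y).
  by apply: he => //=; rewrite sub0r normrN gtr0_norm// (lt_trans ts).
by rewrite -(pmulr_lgt0 _ s0) -e3 subr_gt0 ltNge fs.
Unshelve. all: by end_near. Qed.

End DirectionalDerivatives.

(* From here on, derivatives are only handled through their rules. *)
#[local] Opaque derive.

(** * Maps of class C^k *)

Section CkClosure.
Context {R : realType} {U : normedModType R}.
Implicit Types (V : set U).

Lemma Ck_on_cont (W : normedModType R) k V (f : U -> W) y :
  Ck_on k V f -> V y -> {for y, continuous f}.
Proof. by case: k => [|k] [+ _]; exact. Qed.

Lemma Ck_on_ext (W : normedModType R) k V (f g : U -> W) :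
  open V -> (forall y, V y -> f y = g y) -> Ck_on k V f -> Ck_on k V g.
Proof.
move=> oV; elim: k f g => [|k IH] f g fg Cf.
  split=> // y Vy; rewrite /prop_for /continuous_at -fg//.
  apply: cvg_trans (Ck_on_cont Cf Vy); apply: near_eq_cvg.
  by have := open_nbhs_nbhs (conj oV Vy); apply: filterS => z /fg.
have nfg y : V y -> {near y, f =1 g}.
  by move=> Vy; have := open_nbhs_nbhs (conj oV Vy); apply: filterS => z /fg.
case: Cf => [cf [df Cf]]; split.
  move=> y Vy; rewrite /prop_for /continuous_at -fg//.
  by apply: cvg_trans (cf _ Vy); apply: near_eq_cvg; exact: nfg.
split=> [v y Vy|v]; first by apply: near_eq_derivable (df v y Vy); exact: nfg.
by apply: IH (Cf v) => y Vy; apply: near_eq_derive; exact: nfg.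
Qed.

(** The class C^(k+1) from explicit directional derivatives of class C^k. *)
Lemma Ck_on_intro (W : normedModType R) k V (f : U -> W) (d : U -> U -> W) :
  open V -> (forall y, V y -> {for y, continuous f}) ->
  (forall v y, V y -> is_derive y v f (d v y)) ->
  (forall v, Ck_on k V (d v)) -> Ck_on k.+1 V f.
Proof.
move=> oV cf df Cd; split=> //; split=> [v y Vy|v]; first by case: (df v y Vy).
by apply: Ck_on_ext oV _ (Cd v) => y Vy; have [_ ->] := df v y Vy.
Qed.

Lemma Ck_on_is_derive (W : normedModType R) k V (f : U -> W) v y :
  Ck_on k.+1 V f -> V y -> is_derive y v f ('D_v f y).
Proof. by move=> [_ [df _]] Vy; apply: DeriveDef => //; exact: df. Qed.

Lemma Ck_on_derive (W : normedModType R) k V (f : U -> W) v :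
  Ck_on k.+1 V f -> Ck_on k V ('D_v f).
Proof. by move=> [_ [_ h]]; exact: h. Qed.

Lemma Ck_onW (W : normedModType R) k V (f : U -> W) : Ck_on k.+1 V f -> Ck_on k V f.
Proof.
elim: k f => [|k IH] f [cf [df Cf]]; first by split.
by split=> //; split=> // v; apply: IH; exact: Cf.
Qed.

Lemma Ck_onS (W : normedModType R) k V V' (f : U -> W) :
  V' `<=` V -> Ck_on k V f -> Ck_on k V' f.
Proof.
move=> VV; elim: k f => [|k IH] f.
  by move=> [cf _]; split=> // y /VV; exact: cf.
move=> [cf [df Cf]]; split=> [y /VV|]; first exact: cf.
by split=> [v y /VV|v]; [exact: df|apply: IH; exact: Cf].
Qed.

Lemma Ck_on_cst (W : normedModType R) k V (c : W) : Ck_on k V (fun=> c).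
Proof.
elim: k c => [|k IH] c; first by split=> // y _; exact: cst_continuous.
split=> [y _|]; first exact: cst_continuous.
split=> [v y _|v]; first exact: derivable_cst.
suff -> : (fun y => 'D_v (fun=> c) y) = (fun=> 0) by exact: IH.
by apply/funext => y; exact: derive_cst.
Qed.

(** Postcomposition with a continuous linear map. *)
Lemma Ck_on_linear (W W' : normedModType R) k V (l : W -> W') (f : U -> W) :
  open V -> linear l -> continuous l -> Ck_on k V f -> Ck_on k V (l \o f).
Proof.
move=> oV ll cl; elim: k f => [|k IH] f Cf.
  by split=> // y Vy; apply: continuous_comp; [exact: Ck_on_cont Cf Vy|exact: cl].
apply: (Ck_on_intro (d := fun v => l \o ('D_v f))) => //.
- by move=> y Vy; apply: continuous_comp; [exact: Ck_on_cont Cf Vy|exact: cl].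
- by move=> v y Vy; apply: is_derive_linear => //; exact: Ck_on_is_derive Cf Vy.
- by move=> v; apply: IH; exact: Ck_on_derive.
Qed.

Lemma Ck_on_pair (W W' : normedModType R) k V (f : U -> W) (g : U -> W') :
  open V -> Ck_on k V f -> Ck_on k V g -> Ck_on k V (fun y => (f y, g y)).
Proof.
move=> oV; elim: k f g => [|k IH] f g Cf Cg.
  by split=> // y Vy; apply: cvg_pair; [exact: Ck_on_cont Cf Vy|exact: Ck_on_cont Cg Vy].
apply: (Ck_on_intro (d := fun v y => ('D_v f y, 'D_v g y))) => //.
- by move=> y Vy; apply: cvg_pair; [exact: Ck_on_cont Cf Vy|exact: Ck_on_cont Cg Vy].
- move=> v y Vy; apply: is_derive_pair; [exact: Ck_on_is_derive Cf Vy|exact: Ck_on_is_derive Cg Vy].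
- by move=> v; apply: IH; exact: Ck_on_derive.
Qed.

Lemma is_derive_rV n (f : U -> 'rV[R]_n) y v (d : 'rV[R]_n) :
  (forall i, is_derive y v (fun x => f x 0 i) (d 0 i)) -> is_derive y v f d.
Proof.
move=> df; have hd : derivable f y v.
  by apply/derivable_mxP => i j; rewrite ord1; case: (df j).
split=> //; rewrite derive_mx//; apply/rowP => j; rewrite mxE.
by case: (df j).
Qed.

Lemma rV_cvg (T : Type) (F : set_system T) (FF : Filter F) n (f : T -> 'rV[R]_n) (l : 'rV[R]_n) :
  (forall i, f x 0 i @[x --> F] --> l 0 i) -> f x @[x --> F] --> l.
Proof.
move=> fl; apply/cvgrPdist_le => e e0.
have : forall i, \forall x \near F, `|l 0 i - f x 0 i| <= e.
  by move=> i; have /cvgrPdist_le/(_ e e0) := fl i.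
move=> /filter_forall; apply: filterS => x hx.
rewrite /Num.Def.normr /= mx_normrE (bigmax_le _ (ltW e0))//= => -[i j] _ /=.
by rewrite !mxE ord1.
Qed.

Lemma Ck_on_rV n k V (f : U -> 'rV[R]_n) :
  open V -> (forall i, Ck_on k V (fun y => f y 0 i)) -> Ck_on k V f.
Proof.
move=> oV; elim: k f => [|k IH] f Cf.
  by split=> // y Vy; apply: rV_cvg => i; exact: Ck_on_cont (Cf i) Vy.
apply: (Ck_on_intro (d := fun v y => \row_i 'D_v (fun x => f x 0 i) y)) => //.
- by move=> y Vy; apply: rV_cvg => i; exact: Ck_on_cont (Cf i) Vy.
- by move=> v y Vy; apply: is_derive_rV => i; rewrite mxE; exact: Ck_on_is_derive (Cf i) Vy.
- move=> v; apply: IH => i.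
  by have := Ck_on_derive v (Cf i); apply: Ck_on_ext => // y Vy; rewrite mxE.
Qed.

Lemma Ck_onD k V (f g : U -> R) :
  open V -> Ck_on k V f -> Ck_on k V g -> Ck_on k V (fun y => f y + g y).
Proof.
move=> oV; elim: k f g => [|k IH] f g Cf Cg.
  by split=> // y Vy; apply: cvgD; [exact: Ck_on_cont Cf Vy|exact: Ck_on_cont Cg Vy].
apply: (Ck_on_intro (d := fun v y => 'D_v f y + 'D_v g y)) => //.
- by move=> y Vy; apply: cvgD; [exact: Ck_on_cont Cf Vy|exact: Ck_on_cont Cg Vy].
- move=> v y Vy; apply: is_deriveD; [exact: Ck_on_is_derive Cf Vy|exact: Ck_on_is_derive Cg Vy].
- by move=> v; apply: IH; exact: Ck_on_derive.
Qed.

Lemma Ck_onM k V (f g : U -> R) :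
  open V -> Ck_on k V f -> Ck_on k V g -> Ck_on k V (fun y => f y * g y).
Proof.
move=> oV; elim: k f g => [|k IH] f g Cf Cg.
  by split=> // y Vy; apply: cvgM; [exact: Ck_on_cont Cf Vy|exact: Ck_on_cont Cg Vy].
apply: (Ck_on_intro (d := fun v y => f y * 'D_v g y + g y * 'D_v f y)) => //.
- by move=> y Vy; apply: cvgM; [exact: Ck_on_cont Cf Vy|exact: Ck_on_cont Cg Vy].
- move=> v y Vy; apply: is_deriveM; [exact: Ck_on_is_derive Cf Vy|exact: Ck_on_is_derive Cg Vy].
- by move=> v; apply: Ck_onD => //; apply: IH; (exact: Ck_on_derive || exact: Ck_onW).
Qed.

Lemma Ck_on_sum k V n (f : 'I_n -> U -> R) :
  open V -> (forall i, Ck_on k V (f i)) -> Ck_on k V (fun y => \sum_i f i y).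
Proof.
move=> oV; elim: n f => [|n IH] f Cf.
  by under eq_fun do rewrite big_ord0; exact: Ck_on_cst.
by under eq_fun do rewrite big_ord_recl; apply: Ck_onD => //; apply: IH.
Qed.

End CkClosure.

Section CkComposition.
Context {R : realType} {U : normedModType R}.
Implicit Types (V : set U).

(** Postcomposition with a real function. *)
Lemma Ck_on_chain k V (I : set R) (w : R -> R) (f : U -> R) :
  open V -> (forall y, V y -> I (f y)) -> Ck_on k I w -> Ck_on k V f ->
  Ck_on k V (w \o f).
Proof.
move=> oV VI; elim: k w => [|k IH] w Cw Cf.
  by split=> // y Vy; apply: continuous_comp; [exact: Ck_on_cont Cf Vy|apply: Ck_on_cont Cw _; exact: VI].
apply: (Ck_on_intro (d := fun v y => ('D_1 w \o f) y * 'D_v f y)) => //.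
- by move=> y Vy; apply: continuous_comp; [exact: Ck_on_cont Cf Vy|apply: Ck_on_cont Cw _; exact: VI].
- move=> v y Vy; apply: is_derive_chain; last exact: Ck_on_is_derive Cf Vy.
  by apply: Ck_on_is_derive Cw _; exact: VI.
- move=> v; apply: Ck_onM => //; last exact: Ck_on_derive.
  by apply: IH; [exact: Ck_on_derive|exact: Ck_onW].
Qed.

End CkComposition.

Section CkReal.
Context {R : realType}.

Lemma open_neq0 : open [set x : R | x != 0].
Proof.
have -> : [set x : R | x != 0] = ~` [set 0].
  by apply/seteqP; split=> x /=; move/eqP.
by apply: closed_openC; exact: closed_eq.
Qed.

Lemma Ck_on_inv k : Ck_on k [set x : R | x != 0] (GRing.inv : R -> R).
Proof.
elim: k => [|k IH]; first by split=> // y y0; exact: inv_continuous.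
apply: (@Ck_on_intro R R R k _ _ (fun v y => - v * (y^-1 * y^-1))).
- exact: open_neq0.
- by move=> y y0; exact: inv_continuous.
- move=> v y y0; have dv : is_derive y v (id : R -> R) v by exact: is_derive_id.
  apply: is_derive_eq (is_deriveV _ dv) _ => //=.
  by rewrite -invfM -expr2 [LHS]mulrC mulrN mulNr.
- by move=> v; apply: Ck_onM; [exact: open_neq0|exact: Ck_on_cst|apply: Ck_onM => //; exact: open_neq0].
Qed.

Lemma open_gt0 : open [set x : R | 0 < x].
Proof. by have := @open_gt R 0. Qed.

Lemma Ck_on_sqrt k : Ck_on k [set x : R | 0 < x] (Num.sqrt : R -> R).
Proof.
elim: k => [|k IH]; first by split=> // y y0; exact: sqrt_continuous.
apply: (@Ck_on_intro R R R k _ _ (fun v y => (v / 2) * (GRing.inv \o Num.sqrt) y)).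
- exact: open_gt0.
- by move=> y y0; exact: sqrt_continuous.
- move=> v y y0; have := is_derive_scale v (is_derive1_sqrt y0).
  by rewrite [_ *: 1]mulr1 => h; apply: is_derive_eq h _; rewrite /= invfM [LHS]mulrA.
- move=> v; apply: Ck_onM; [exact: open_gt0|exact: Ck_on_cst|].
  apply: Ck_on_chain IH; [exact: open_gt0| |exact: Ck_on_inv].
  by move=> y /= y0; rewrite gt_eqF// sqrtr_gt0.
Qed.

End CkReal.

(** * Linearity of the derivative in the direction *)

Section LinearDerivative.
Context {R : realType} {U : normedModType R}.

(** For a map of class C^1, the directional derivative is additive in the
    direction: by the mean value theorem, the increment along [h *: v] from the
    moving point [h *: w + y] is [h] times a nearby value of the derivative along [v]. *)
Lemma derive_addr (f : U -> R) V y v w : open V -> V y -> Ck_on 1 V f ->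
  'D_(v + w) f y = 'D_v f y + 'D_w f y.
Proof.
move=> oV Vy Cf; suff : is_derive y (v + w) f ('D_v f y + 'D_w f y) by case.
apply: is_derive_cvg.
have lim1 : h^-1 *: (f (h *: v + (h *: w + y)) - f (h *: w + y)) @[h --> 0^'] --> 'D_v f y.
  apply/cvgrPdist_le => e e0.
  have cDv : {for y, continuous ('D_v f)} by apply: Ck_on_cont Vy; exact: Ck_on_derive Cf.
  have nV : \forall z \near y, V z by exact: open_nbhs_nbhs.
  have /cvgrPdist_le/(_ e e0) nD := cDv.
  have /nbhs_ballP[d /= d0 hd] : nbhs y (V `&` [set z | `|'D_v f y - 'D_v f z| <= e]) by exact: filterI.
  have s0 : 0 < `|v| + `|w| + 1 by rewrite ltr_wpDl// addr_ge0.
  exists (d / (`|v| + `|w| + 1)) => /=; first by rewrite divr_gt0.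
  move=> h; rewrite /= sub0r normrN ltr_pdivlMr// => hd1 h0.
  have inb t : 0 <= t <= 1 -> ball y d (t *: (h *: v) + (h *: w + y)).
    move=> /andP[t0 t1]; rewrite -ball_normE /= addrA opprD addrCA subrr addr0 normrN.
    apply: le_lt_trans hd1; apply: (le_trans (ler_normD _ _)).
    rewrite !normrZ (ger0_norm t0).
    apply: (@le_trans _ _ (`|h| * `|v| + `|h| * `|w|)).
      by rewrite lerD2r ler_piMl// mulr_ge0.
    by rewrite -mulrDr ler_wpM2l// lerDl.
  have [||t /andP[t0 t1] ->] := @mean_value_line R U f (h *: w + y) (h *: v).
  - move=> t t01; apply: ex_derive; apply: is_derive_scale.
    by apply: Ck_on_is_derive Cf _; have [] := hd _ (inb t t01).
  - by move=> t t01; apply: Ck_on_cont Cf _; have [] := hd _ (inb t t01).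
  have t01 : 0 <= t <= 1 by rewrite !ltW.
  have [Vz Dz] := hd _ (inb t t01).
  have -> : 'D_(h *: v) f (t *: (h *: v) + (h *: w + y)) =
      h *: 'D_v f (t *: (h *: v) + (h *: w + y)).
    by have [] := is_derive_scale h (Ck_on_is_derive v Cf Vz).
  by rewrite scalerA mulVf// scale1r.
have lim2 : h^-1 *: (f (h *: w + y) - f y) @[h --> 0^'] --> 'D_w f y.
  by apply: derive_cvg; have [] := Ck_on_is_derive w Cf Vy.
have lim3 : h^-1 *: (f (h *: v + (h *: w + y)) - f (h *: w + y)) +
    h^-1 *: (f (h *: w + y) - f y) @[h --> 0^'] --> 'D_v f y + 'D_w f y.
  exact: cvgD lim1 lim2.
apply: cvg_trans lim3; apply: near_eq_cvg; near=> h.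
by rewrite /= -scalerDr subrKA [h *: (v + w)]scalerDr addrA.
Unshelve. all: by end_near. Qed.

Lemma derive_scaler (W : normedModType R) (f : U -> W) y v a :
  derivable f y v -> 'D_(a *: v) f y = a *: 'D_v f y.
Proof. by move=> df; have [] := is_derive_scale a (derivableP df). Qed.

Lemma derive_sumr (f : U -> R) V y m (a : 'I_m -> R) (v : 'I_m -> U) :
  open V -> V y -> Ck_on 1 V f ->
  'D_(\sum_i a i *: v i) f y = \sum_i a i * 'D_(v i) f y.
Proof.
move=> oV Vy Cf; elim: m a v => [|m IH] a v; first by rewrite !big_ord0 derive0.
rewrite !big_ord_recl (derive_addr _ _ oV Vy Cf) IH derive_scaler//.
by have [] := Ck_on_is_derive (v ord0) Cf Vy.
Qed.

End LinearDerivative.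

Section RowVectors.
Context {R : realType} {n : nat}.
Implicit Types (f : 'rV[R]_n -> R) (V : set 'rV[R]_n).

Lemma evec_sum (v : 'rV[R]_n) : v = \sum_i v 0 i *: evec i.
Proof. exact: row_sum_delta. Qed.

Lemma derive_coords f V y v : open V -> V y -> Ck_on 1 V f ->
  'D_v f y = \sum_i v 0 i * 'D_(evec i) f y.
Proof. by move=> oV Vy Cf; rewrite {1}(evec_sum v) (derive_sumr _ _ oV Vy Cf). Qed.

(** The Hessian as a bilinear form. *)
Lemma derive2_coords f V y v w : open V -> V y -> Ck_on 2 V f ->
  'D_v ('D_w f) y = \sum_i \sum_j v 0 i * w 0 j * 'D_(evec i) ('D_(evec j) f) y.
Proof.
move=> oV Vy Cf; rewrite (derive_coords _ oV Vy (Ck_on_derive w Cf)).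
apply: eq_bigr => i _; rewrite -[in LHS](@near_eq_derive _ _ _ (fun z => \sum_j w 0 j *: 'D_(evec j) f z)); last first.
  have : \forall z \near y, V z by exact: open_nbhs_nbhs.
  by apply: filterS => z Vz; rewrite (derive_coords _ oV Vz (Ck_onW Cf)).
have dd j : derivable ('D_(evec j) f) y (evec i).
  by have [] := Ck_on_is_derive (evec i) (Ck_on_derive (evec j) Cf) Vy.
rewrite (_ : (fun z => _) = \sum_j (fun z => w 0 j *: 'D_(evec j) f z)); last first.
  by apply/funext => z; rewrite fct_sumE.
rewrite derive_sum => [|j]; last exact: derivableZ.
rewrite mulr_sumr; apply: eq_bigr => j _; rewrite deriveZ// /GRing.scale /=.
by rewrite mulrA.
Qed.

End RowVectors.

(** * Traces and positive definite matrices *)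

Section Quadratic.
Context {R : realType}.

(** A bilinear form in coordinates. *)
Lemma mx11_sum m (v w : 'rV[R]_m) (A : 'M[R]_m) :
  (v *m A *m w^T) 0 0 = \sum_i \sum_j v 0 i * w 0 j * A i j.
Proof.
rewrite mxE exchange_big; apply: eq_bigr => j _.
by rewrite mxE mulr_suml; apply: eq_bigr => i _; rewrite mxE mulrAC.
Qed.

(** The trace of the product of a positive definite symmetric matrix and a
    negative semidefinite one is nonpositive.  The induction on the size splits
    [Q] into a rank-one matrix and the Schur complement [C] of its first
    diagonal entry. *)
Lemma trace_posdef_nsd m (Q S : 'M[R]_m) : Q^T = Q ->
  (forall v : 'rV_m, v != 0 -> 0 < (v *m Q *m v^T) 0 0) ->
  (forall v : 'rV_m, (v *m S *m v^T) 0 0 <= 0) ->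
  \tr (Q *m S) <= 0.
Proof.
elim: m Q S => [|m IH] Q S Qs Qp Sn; first by rewrite /mxtrace big_ord0.
change 'M[R]_(1 + m) in Q, S.
pose a := Q 0 0.
have a0 : 0 < a.
  have := Qp (delta_mx 0 0); rewrite -rowE trmx_delta -colE !mxE; apply.
  by apply/eqP => /matrixP/(_ 0 0); rewrite !mxE eqxx => /eqP; rewrite oner_eq0.
pose b : 'rV[R]_m := ursubmx Q.
pose r : 'rV[R]_(1 + m) := row_mx a%:M b.
pose C := drsubmx Q - a^-1 *: (b^T *m b).
have QE : Q = a^-1 *: (r^T *m r) + block_mx 0 0 0 C.
  have ulE : ulsubmx Q = a%:M.
    rewrite [LHS]mx11_scalar !mxE; congr ((Q _ _)%:M); exact/val_inj.
  have dlE : dlsubmx Q = b^T by rewrite /b trmx_ursub Qs.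
  rewrite tr_row_mx mul_col_row scale_block_mx add_block_mx !addr0 -{1}(submxK Q).
  rewrite ulE dlE -/b tr_scalar_mx -scalar_mxM scale_scalar_mx mulrA mulVf ?gt_eqF// mul1r.
  rewrite mul_scalar_mx mul_mx_scalar !scalerA mulVf ?gt_eqF// !scale1r /C.
  by rewrite addrC subrK.
have quadE (u : 'rV_(1 + m)) : (u *m Q *m u^T) 0 0 =
    a^-1 * ((r *m u^T) 0 0) ^+ 2 + (rsubmx u *m C *m (rsubmx u)^T) 0 0.
  rewrite {1}QE mulmxDr mulmxDl mxE; congr (_ + _).
    rewrite -scalemxAr -scalemxAl mxE; congr (_ * _).
    rewrite mulmxA -(mulmxA _ r) mxE big_ord1 expr2; congr (_ * _).
    by rewrite -[in RHS](trmxK r) -trmx_mul [RHS]mxE.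
  rewrite -{1 2}(hsubmxK u) tr_row_mx mul_row_block !mulmx0 add0r mul_row_col.
  by rewrite !mul0mx !add0r.
have Cs : C^T = C.
  rewrite /C linearB /= linearZ /= trmx_mul trmxK; congr (_ - _).
  by rewrite trmx_drsub Qs.
rewrite QE mulmxDl mxtraceD -scalemxAl mxtraceZ -mulmxA mxtrace_mulC.
have -> : \tr (block_mx 0 0 0 C *m S) = \tr (C *m drsubmx S).
  rewrite -{1}(submxK S) mulmx_block mxtrace_block !mul0mx !add0r mxtrace0 add0r.
  by [].
rewrite -[X in _ <= X]addr0 lerD//.
  by rewrite trace_mx11 pmulr_rle0 ?invr_gt0.
apply: IH => // v.
  move=> v0; pose u : 'rV_(1 + m) := row_mx (- (a^-1 *: (b *m v^T)))^T v.
  have u0 : u != 0 by apply: contraNneq v0 => /eqP; rewrite row_mx_eq0 => /andP[].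
  have := Qp _ u0; rewrite quadE row_mxKr.
  suff -> : r *m u^T = 0 by rewrite mxE expr0n mulr0 add0r.
  rewrite tr_row_mx mul_row_col trmxK mul_scalar_mx scalerN scalerA mulfV ?gt_eqF//.
  by rewrite scale1r addNr.
have : ((row_mx 0 v : 'rV_(1 + m)) *m S *m (row_mx 0 v)^T) 0 0 <= 0 by exact: Sn.
 rewrite -{1}(submxK S) mul_row_block tr_row_mx mul_row_col.
by rewrite !mul0mx !add0r trmx0 mulmx0 add0r.
Qed.

Lemma dot_rowE m (x y : 'rV[R]_m) : dot x y = (x *m y^T) 0 0.
Proof. by rewrite mxE; apply: eq_bigr => i _; rewrite mxE. Qed.

End Quadratic.

(** * The ambient space *)

Section Ambient.
Context {R : realType} {n : nat}.
Implicit Types (p q : ambient R n) (g : 'rV[R]_n -> ambient R n) (V : set 'rV[R]_n).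

(** Horizontal and vertical coordinates of a point [(x, z)]; derivatives of maps
    into the ambient space are computed coordinatewise through these linear
    forms. *)
Definition hcoord (i : 'I_n) p : R := p.1 0 i.

Lemma linear_hcoord i : linear (hcoord i).
Proof. by move=> a p q; rewrite /hcoord /= !mxE. Qed.

Lemma continuous_hcoord i : continuous (hcoord i).
Proof.
move=> p; apply: (@continuous_comp _ _ _ fst (fun x : 'rV[R]_n => x 0 i)).
  exact: cvg_fst.
exact: coord_continuous.
Qed.

Definition vcoord p : R := p.2.

Lemma linear_vcoord : linear vcoord.
Proof. by []. Qed.

Lemma continuous_vcoord : continuous vcoord.
Proof. by move=> p; exact: cvg_snd. Qed.

Lemma ambientP p q : (forall i, hcoord i p = hcoord i q) -> vcoord p = vcoord q -> p = q.
Proof.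
case: p => p1 p2; case: q => q1 q2 /= h1 <-; congr (_, _).
by apply/rowP => i; exact: h1.
Qed.

Lemma adot_coords p q : adot p q = \sum_i hcoord i p * hcoord i q + vcoord p * vcoord q.
Proof. by []. Qed.

Lemma adotC p q : adot p q = adot q p.
Proof.
by rewrite !adot_coords mulrC; congr (_ + _); apply: eq_bigr => i _; rewrite mulrC.
Qed.

Lemma adot_linear q : linear (fun p => adot p q : R).
Proof.
move=> a p p'; rewrite !adot_coords linear_vcoord mulrDl scalerDr addrACA; congr (_ + _).
  rewrite scaler_sumr -big_split; apply: eq_bigr => i _.
  by rewrite linear_hcoord mulrDl -scalerAl.
by rewrite -scalerAl.
Qed.

Lemma adotZl a p q : adot (a *: p) q = a * adot p q.
Proof.
have := adot_linear q a p 0; rewrite addr0 => ->.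
suff -> : adot 0 q = 0 by rewrite addr0.
by rewrite adot_coords big1 => [|i _]; rewrite ?mul0r ?addr0// /hcoord mxE mul0r.
Qed.

Lemma adotDl p p' q : adot (p + p') q = adot p q + adot p' q.
Proof. by have := adot_linear q 1 p p'; rewrite !scale1r. Qed.

Lemma adot0l q : adot 0 q = 0.
Proof. by rewrite -(scale0r 0) adotZl mul0r. Qed.

Lemma adot_suml m (a : 'I_m -> R) (p : 'I_m -> ambient R n) q :
  adot (\sum_i a i *: p i) q = \sum_i a i * adot (p i) q.
Proof.
elim: m a p => [|m IH] a p; first by rewrite !big_ord0 adot0l.
by rewrite !big_ord_recl adotDl adotZl IH.
Qed.

Lemma linear_sum_ambient (l : ambient R n -> R) m (a : 'I_m -> R) (p : 'I_m -> ambient R n) :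
  linear l -> l (\sum_i a i *: p i) = \sum_i a i * l (p i).
Proof.
move=> ll; have l0 : l 0 = 0.
  by have := ll (-1) 0 0; rewrite scaler0 add0r scaleN1r addNr.
elim: m a p => [|m IH] a p; first by rewrite !big_ord0.
by rewrite !big_ord_recl ll IH.
Qed.

Lemma adot_ge0 p : 0 <= adot p p.
Proof.
by rewrite adot_coords addr_ge0// ?sumr_ge0// => [i _|]; rewrite -expr2 sqr_ge0.
Qed.

Lemma adot_eq0 p : adot p p = 0 -> p = 0.
Proof.
move=> /eqP; rewrite adot_coords paddr_eq0 -?expr2 ?sqr_ge0//; last first.
  by apply: sumr_ge0 => i _; rewrite -expr2 sqr_ge0.
rewrite psumr_eq0 => [|i _]; last by rewrite -expr2 sqr_ge0.
move=> /andP[/allP h /eqP v0]; apply: ambientP => [i|].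
  have /= := h i (mem_index_enum _); rewrite -expr2 sqrf_eq0 => /eqP ->.
  by rewrite /hcoord mxE.
by move: v0 => /eqP; rewrite sqrf_eq0 => /eqP.
Qed.

(** A point of the ambient space as a row vector of size [n + 1], so that ranks
    and kernels of matrices apply. *)
Definition rowvec p : 'rV[R]_(n + 1) := row_mx p.1 p.2%:M.

Lemma adot_rowvec p q : adot p q = (rowvec p *m (rowvec q)^T) 0 0.
Proof.
rewrite tr_row_mx mul_row_col mxE /adot dot_rowE; congr (_ + _).
by rewrite tr_scalar_mx -scalar_mxM mxE eqxx.
Qed.

Lemma rowvec_inj : injective rowvec.
Proof.
move=> [p1 p2] [q1 q2] /eq_row_mx[/= -> /matrixP/(_ 0 0)].
by rewrite !mxE eqxx /= !mulr1n => ->.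
Qed.

Lemma rowvec_surj (u : 'rV[R]_(n + 1)) : exists p, u = rowvec p.
Proof.
exists (lsubmx u, rsubmx u 0 0); rewrite /rowvec /=.
by rewrite -mx11_scalar hsubmxK.
Qed.

Lemma rowvec_sum (w : 'rV[R]_n) (d : 'I_n -> ambient R n) :
  rowvec (\sum_i w 0 i *: d i) = w *m \matrix_i rowvec (d i).
Proof.
apply/rowP => j; rewrite [RHS]mxE; case: (splitP j) => k jk.
  have -> : j = lshift 1 k by apply: val_inj.
  rewrite row_mxEl [LHS](linear_sum_ambient _ _ (linear_hcoord k)).
  by apply: eq_bigr => i _; rewrite mxE row_mxEl.
have -> : j = rshift n k by apply: val_inj.
rewrite row_mxEr mxE (ord1 k) eqxx mulr1n [LHS](linear_sum_ambient _ _ linear_vcoord).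
by apply: eq_bigr => i _; rewrite mxE row_mxEr mxE eqxx mulr1n.
Qed.

(** A vector orthogonal to every unit normal of a family lies in its span. *)
Lemma span_of_normals (d : 'I_n -> ambient R n) t :
  (forall nu, adot nu nu = 1 -> (forall i, adot (d i) nu = 0) -> adot t nu = 0) ->
  exists w : 'rV[R]_n, t = \sum_i w 0 i *: d i.
Proof.
move=> ht; pose B := \matrix_i rowvec (d i).
suff /submxP[w tw] : (rowvec t <= B)%MS.
  by exists w; apply: rowvec_inj; rewrite rowvec_sum.
rewrite submxE; apply/eqP/rowP => j; rewrite !mxE.
have [c cE] := rowvec_surj (col j (cokermx B))^T.
have dc i : adot (d i) c = 0.
  rewrite adot_rowvec -cE trmxK (_ : rowvec (d i) = row i B); last by rewrite rowK.
  by rewrite colE mulmxA -row_mul mulmx_coker linear0 mul0mx mxE.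
have : adot t c = 0.
  have [c0|c0] := eqVneq (adot c c) 0; first by rewrite (adot_eq0 c0) adotC adot0l.
  have cp : 0 < adot c c by rewrite lt_def c0 adot_ge0.
  pose s := (Num.sqrt (adot c c))^-1.
  have s0 : s != 0 by rewrite invr_eq0 gt_eqF// sqrtr_gt0.
  have := ht (s *: c); rewrite adotZl adotC adotZl mulrA -expr2 exprVn sqr_sqrtr ?(ltW cp)//.
  rewrite mulVf// => /(_ erefl); rewrite adotC adotZl => h.
  have /eqP : s * adot c t = 0 by apply: h => i; rewrite adotC adotZl adotC dc mulr0.
  by rewrite mulf_eq0 (negbTE s0) /= adotC => /eqP.
by rewrite adot_rowvec -cE trmxK mxE => h; rewrite -[RHS]h; apply: eq_bigr => i _; rewrite !mxE.
Qed.

(** Continuous linear forms on the ambient space commute with derivation. *)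
Lemma derive_linear (l : ambient R n -> R) g y v : linear l -> continuous l ->
  derivable g y v -> 'D_v (l \o g) y = l ('D_v g y).
Proof. by move=> ll cl dg; have [] := is_derive_linear ll cl (derivableP dg). Qed.

Lemma derive2_linear (l : ambient R n -> R) g V y v w : linear l -> continuous l ->
  open V -> V y -> Ck_on 2 V g ->
  'D_v ('D_w (l \o g)) y = l ('D_v ('D_w g) y).
Proof.
move=> ll cl oV Vy Cg; rewrite -derive_linear//; last first.
  by have [] := Ck_on_is_derive v (Ck_on_derive w Cg) Vy.
apply: near_eq_derive; have : \forall z \near y, V z by exact: open_nbhs_nbhs.
apply: filterS => z Vz; rewrite derive_linear//.
by have [] := Ck_on_is_derive w (Ck_onW Cg) Vz.
Qed.

Lemma derive_ambient_coords g V y v : open V -> V y -> Ck_on 1 V g ->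
  'D_v g y = \sum_i v 0 i *: 'D_(evec i) g y.
Proof.
move=> oV Vy Cg.
have dg u : derivable g y u by have [] := Ck_on_is_derive u Cg Vy.
have eq (l : ambient R n -> R) : linear l -> continuous l -> l ('D_v g y) = l (\sum_i v 0 i *: 'D_(evec i) g y).
  move=> ll cl; rewrite -(derive_linear ll cl (dg v)) linear_sum_ambient//.
  rewrite (derive_coords _ oV Vy) => [|]; last exact: Ck_on_linear.
  by apply: eq_bigr => i _; rewrite derive_linear.
apply: ambientP => [i|]; apply: eq.
- exact: linear_hcoord.
- exact: continuous_hcoord.
- exact: linear_vcoord.
- exact: continuous_vcoord.
Qed.

(** A vector orthogonal to every unit normal is tangent. *)
Lemma tangentP g V y t : open V -> V y -> Ck_on 1 V g ->
  (forall nu, unit_normal_at g y nu -> adot t nu = 0) ->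
  exists w, t = 'D_w g y.
Proof.
move=> oV Vy Cg ht; have [|w ->] := @span_of_normals (fun i => 'D_(evec i) g y) t.
  move=> nu n1 nd; apply: ht; split=> // v.
  by rewrite (derive_ambient_coords _ oV Vy Cg) adot_suml big1// => i _; rewrite nd mulr0.
by exists w; rewrite (derive_ambient_coords _ oV Vy Cg).
Qed.

End Ambient.

(** * The test function *)

Section TestFunction.
Context {R : realType} {n : nat}.
Variables (k e : R).
Implicit Types (p q : ambient R n) (g : 'rV[R]_n -> ambient R n) (V : set 'rV[R]_n).

(** The test function [k z + e |x|^2]. *)
Definition phi p : R := k * p.2 + e * dot p.1 p.1.

(** The differential of [phi] at [p]. *)
Definition dphi p q : R := k * q.2 + 2 * e * dot p.1 q.1.

Lemma linear_dphi p : linear (dphi p).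
Proof.
move=> a q q'; rewrite /dphi.
have -> : dot p.1 (a *: q + q').1 = a * dot p.1 q.1 + dot p.1 q'.1.
  rewrite /dot mulr_sumr -big_split; apply: eq_bigr => i _.
  by rewrite /= !mxE mulrDr mulrCA.
have -> : (a *: q + q').2 = a * q.2 + q'.2 by [].
by rewrite -[a *: _]/(a * _); ring.
Qed.

Lemma Ck_on_hcoord m V g i : open V -> Ck_on m V g -> Ck_on m V (hcoord i \o g).
Proof.
by move=> oV; apply: Ck_on_linear => //; [exact: linear_hcoord|exact: continuous_hcoord].
Qed.

Lemma Ck_on_vcoord m V g : open V -> Ck_on m V g -> Ck_on m V (vcoord \o g).
Proof.
by move=> oV; apply: Ck_on_linear => //; exact: continuous_vcoord.
Qed.

Lemma Ck_on_phi m V g : open V -> Ck_on m V g -> Ck_on m V (phi \o g).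
Proof.
move=> oV Cg; apply: Ck_onD => //; apply: Ck_onM => //; try exact: Ck_on_cst.
  exact: Ck_on_vcoord.
by apply: Ck_on_sum => // i; apply: Ck_onM => //; exact: Ck_on_hcoord.
Qed.

Lemma is_derive_sum_fun (U : normedModType R) m (f : 'I_m -> U -> R) y v (d : 'I_m -> R) :
  (forall i, is_derive y v (f i) (d i)) ->
  is_derive y v (fun z => \sum_i f i z) (\sum_i d i).
Proof.
elim: m f d => [|m IH] f d fd.
  rewrite big_ord0; under eq_fun do rewrite big_ord0; exact: is_derive_cst.
rewrite big_ord_recl; under eq_fun do rewrite big_ord_recl.
by apply: is_deriveD; exact: IH.
Qed.

Lemma is_derive_phi V g y v : open V -> V y -> Ck_on 1 V g ->
  is_derive y v (phi \o g) (dphi (g y) ('D_v g y)).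
Proof.
move=> oV Vy Cg.
have dg : derivable g y v by have [] := Ck_on_is_derive v Cg Vy.
have dz : is_derive y v (vcoord \o g) (vcoord ('D_v g y)).
  exact: (is_derive_linear linear_vcoord continuous_vcoord (derivableP dg)).
have dx i : is_derive y v (hcoord i \o g) (hcoord i ('D_v g y)).
  exact: (is_derive_linear (linear_hcoord i) (@continuous_hcoord _ _ i) (derivableP dg)).
have d1 := is_deriveM (is_derive_cst k y v) dz.
have d2 := is_derive_sum_fun (fun i => is_deriveM (dx i) (dx i)).
have d3 := is_deriveM (is_derive_cst e y v) d2.
have d4 := is_deriveD d1 d3.
apply: is_derive_eq d4 _.
rewrite /dphi !scaler0 !addr0 /GRing.scale /=; congr (_ + _).
rewrite -mulrA mulrCA; congr (_ * _); rewrite /dot mulr_sumr.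
by apply: eq_bigr => i _; rewrite mulrC mulr_natl mulr2n.
Qed.

(** The second derivative of the composition with a quadratic function. *)
Lemma derive2_phi V g y v w : open V -> V y -> Ck_on 2 V g ->
  'D_v ('D_w (phi \o g)) y =
  dphi (g y) ('D_v ('D_w g) y) + 2 * e * dot ('D_v g y).1 ('D_w g y).1.
Proof.
move=> oV Vy Cg.
have C1 := Ck_onW Cg; have CD := Ck_on_derive w Cg.
have -> : 'D_v ('D_w (phi \o g)) y =
    'D_v (fun z => k * vcoord ('D_w g z) +
      2 * e * \sum_i hcoord i (g z) * hcoord i ('D_w g z)) y.
  apply: near_eq_derive; have : \forall z \near y, V z by exact: open_nbhs_nbhs.
  by apply: filterS => z Vz; have [_ ->] := is_derive_phi w oV Vz C1.
have dg : derivable g y v by have [] := Ck_on_is_derive v C1 Vy.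
have ddg : derivable ('D_w g) y v by have [] := Ck_on_is_derive v CD Vy.
have dz : is_derive y v (vcoord \o ('D_w g)) (vcoord ('D_v ('D_w g) y)).
  exact: (is_derive_linear linear_vcoord continuous_vcoord (derivableP ddg)).
have dx i : is_derive y v (hcoord i \o g) (hcoord i ('D_v g y)).
  exact: (is_derive_linear (linear_hcoord i) (@continuous_hcoord _ _ i) (derivableP dg)).
have ddx i : is_derive y v (hcoord i \o ('D_w g)) (hcoord i ('D_v ('D_w g) y)).
  exact: (is_derive_linear (linear_hcoord i) (@continuous_hcoord _ _ i) (derivableP ddg)).
have d1 := is_deriveM (is_derive_cst k y v) dz.
have d2 := is_derive_sum_fun (fun i => is_deriveM (dx i) (ddx i)).
have d3 := is_deriveM (is_derive_cst (2 * e) y v) d2.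
have [_ ->] := is_deriveD d1 d3.
rewrite /dphi !scaler0 !addr0 /GRing.scale /= -addrA; congr (_ + _).
rewrite -mulrDr; congr (_ * _); rewrite /dot -big_split.
by apply: eq_bigr => i _; exact: (congr1 (+%R _) (mulrC _ _)).
Qed.

End TestFunction.

(** * No interior maximum on a minimal hypersurface *)

Section InteriorMaximum.
Context {R : realType} {n : nat}.
Implicit Types (p q : ambient R n) (g : 'rV[R]_n -> ambient R n) (V : set 'rV[R]_n).

Lemma linear_sum2 (l : ambient R n -> R) (a : 'I_n -> 'I_n -> R)
    (p : 'I_n -> 'I_n -> ambient R n) : linear l ->
  l (\sum_i \sum_j a i j *: p i j) = \sum_i \sum_j a i j * l (p i j).
Proof.
move=> ll; rewrite -(eq_bigr _ (fun i _ => linear_sum_ambient (a i) (p i) ll)).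
rewrite -[RHS](eq_bigr _ (fun i _ => mul1r _)) -(linear_sum_ambient _ _ ll).
by under [in RHS]eq_bigr do rewrite scale1r.
Qed.

Lemma trace_mulmx m (A B : 'M[R]_m) : \tr (A *m B) = \sum_i \sum_j A i j * B j i.
Proof. by apply: eq_bigr => i _; rewrite mxE. Qed.

Lemma first_form_sym g y : (first_form g y)^T = first_form g y.
Proof.
apply/matrixP => i j; rewrite [LHS]mxE /first_form [LHS]mxE [RHS]mxE.
exact: adotC.
Qed.

(** The first fundamental form as a quadratic form. *)
Lemma first_form_quad g V y (v : 'rV[R]_n) : open V -> V y -> Ck_on 1 V g ->
  (v *m first_form g y *m v^T) 0 0 = adot ('D_v g y) ('D_v g y).
Proof.
move=> oV Vy Cg; rewrite mx11_sum (derive_ambient_coords v oV Vy Cg).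
rewrite adot_suml; apply: eq_bigr => i _; rewrite adotC adot_suml mulr_sumr.
apply: eq_bigr => j _; rewrite [first_form g y i j]mxE.
exact: etrans (congr1 ( *%R _) (adotC _ _)) (esym (mulrA _ _ _)).
Qed.

Lemma injective_unit m (B : 'M[R]_m) : (forall v : 'rV_m, v *m B = 0 -> v = 0) -> B \in unitmx.
Proof.
move=> Binj; rewrite -row_free_unit -kermx_eq0; apply/eqP/eqP.
have [//|/rowV0Pn[v /sub_kermxP vB v0]] := eqVneq (kermx B) 0.
by rewrite (Binj v vB) eqxx in v0.
Qed.

Lemma posdef_unit m (P : 'M[R]_m) :
  (forall v : 'rV_m, v != 0 -> 0 < (v *m P *m v^T) 0 0) -> P \in unitmx.
Proof.
move=> Pp; apply: injective_unit => v vP; apply/eqP; apply: contraPT vP => v0 vP.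
by have := Pp v v0; rewrite vP mul0mx mxE ltxx.
Qed.

Lemma posdef_inv m (P : 'M[R]_m) : P^T = P ->
  (forall v : 'rV_m, v != 0 -> 0 < (v *m P *m v^T) 0 0) ->
  forall v : 'rV_m, v != 0 -> 0 < (v *m invmx P *m v^T) 0 0.
Proof.
move=> Ps Pp v v0; have uP := posdef_unit Pp.
have vE : v = v *m invmx P *m P by rewrite mulmxKV.
have u0 : v *m invmx P != 0 by apply: contraNneq v0 => u0; rewrite vE u0 mul0mx.
by have := Pp _ u0; rewrite trmx_mul trmx_inv Ps -!mulmxA mulKVmx.
Qed.

(** The maximum principle.  At an interior maximum of [phi] the trace of the
    Hessian with respect to the first form is nonpositive; minimality makes
    this trace equal to [2 e (n - |grad z|^2)], and [|grad z|^2 <= 1 < n]. *)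
Lemma interior_no_max (k e : R) g V y : (2 <= n)%N -> 0 < e ->
  open V -> V y -> Ck_on 2 V g -> immersive_at g y -> minimal_at g y ->
  ~ (\forall x \near y, phi k e (g x) <= phi k e (g y)).
Proof.
move=> n2 e0 oV Vy Cg im mi hmax.
have C1 := Ck_onW Cg.
pose d i := 'D_(evec i) g y.
pose dd i j := 'D_(evec i) (fun w => 'D_(evec j) g w) y.
set P := first_form g y.
have Ps : P^T = P := first_form_sym g y.
have Pp (v : 'rV_n) : v != 0 -> 0 < (v *m P *m v^T) 0 0.
  move=> v0; rewrite (first_form_quad _ oV Vy C1) lt_def adot_ge0 andbT.
  by apply: contra v0 => /eqP /adot_eq0 /im ->.
have uP := posdef_unit Pp.
pose Pi := invmx P.
have Pip := posdef_inv Ps Pp.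
pose tau := \sum_i \sum_j Pi i j *: dd j i.
(* by minimality, tau is orthogonal to the unit normals *)
have [w tauE] : exists w, tau = 'D_w g y.
  apply: (tangentP oV Vy C1) => nu hnu.
  have := mi nu hnu; rewrite /mean_curvature trace_mulmx => <-.
  rewrite /tau (linear_sum2 _ _ (adot_linear nu)).
  by apply: eq_bigr => i _; apply: eq_bigr => j _; rewrite [in RHS]mxE.
(* psi = phi o g is critical at y, with nonpositive Hessian *)
pose psi := phi k e \o g.
have Cpsi : Ck_on 2 V psi by exact: Ck_on_phi.
have linemax v : \forall t \near (0 : R), psi (t *: v + y) <= psi y.
  exact: line_cvg _ hmax.
have nV : \forall z \near y, V z by exact: open_nbhs_nbhs.
have crit v : dphi k e (g y) ('D_v g y) = 0.
  have [_ <-] := is_derive_phi k e v oV Vy C1.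
  apply: derive_eq0_max; last exact: linemax.
  by have [] := Ck_on_is_derive v (Ck_onW Cpsi) Vy.
pose H := \matrix_(i, j) 'D_(evec i) ('D_(evec j) psi) y.
have Hn (v : 'rV_n) : (v *m H *m v^T) 0 0 <= 0.
  rewrite mx11_sum; under eq_bigr do under eq_bigr do rewrite mxE.
  rewrite -(derive2_coords _ _ oV Vy Cpsi).
  apply: derive2_le0_max; last exact: linemax.
    by apply: filterS nV => z Vz; have [] := Ck_on_is_derive v (Ck_onW Cpsi) Vz.
  by have [] := Ck_on_is_derive v (Ck_on_derive v Cpsi) Vy.
pose Q := \matrix_(i, j) dot (d i).1 (d j).1.
have dQ i j : Q i j = dot (d i).1 (d j).1 by exact: mxE.
have HE i j : H i j = dphi k e (g y) (dd i j) + 2 * e * dot (d i).1 (d j).1.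
  exact: etrans (mxE _ _ _ _) (derive2_phi k e _ _ oV Vy Cg).
have trH : \tr (Pi *m H) = 2 * e * \tr (Pi *m Q).
  have -> : \tr (Pi *m H) = dphi k e (g y) tau + 2 * e * \tr (Pi *m Q).
    rewrite (linear_sum2 _ _ (linear_dphi k e (g y))) !trace_mulmx mulr_sumr -big_split.
    apply: eq_bigr => i _; rewrite mulr_sumr -big_split; apply: eq_bigr => j _ /=.
    apply: etrans (congr1 ( *%R (Pi i j)) (HE j i)) _; apply: etrans (mulrDr _ _ _) _.
    exact: (congr1 (+%R _) (etrans (mulrCA _ _ _) (congr1 (fun t => 2 * e * (Pi i j * t)) (esym (dQ j i))))).
  by rewrite tauE crit add0r.
pose a : 'rV[R]_n := \row_i (d i).2.
have QE : Q = P - a^T *m a.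
  by apply/matrixP => i j; rewrite !mxE big_ord1 !mxE /adot addrK.
have := trace_posdef_nsd _ Pip Hn; rewrite trmx_inv Ps => /(_ erefl).
rewrite -/Pi trH pmulr_rle0 ?mulr_gt0// QE mulmxBr mulVmx// linearB /= mxtrace1.
rewrite mulmxA mxtrace_mulC mulmxA trace_mx11.
(* x is |grad z|^2, and x - x^2 is the squared length of the horizontal part of
   grad z *)
set x := (_ *m _ *m _) 0 0.
have : x ^+ 2 <= x.
  pose b := a *m Pi.
  have bP : (b *m P *m b^T) 0 0 = x.
    by rewrite /b -(mulmxA a) mulVmx// mulmx1 trmx_mul trmx_inv Ps mulmxA.
  have xE : x = (b *m a^T) 0 0 by [].
  have PE : P = Q + a^T *m a by rewrite QE subrK.
  rewrite -{2}bP PE mulmxDr mulmxDl mxE.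
  have -> : (b *m (a^T *m a) *m b^T) 0 0 = x ^+ 2.
    rewrite mulmxA -(mulmxA _ a) mxE big_ord1 -xE expr2; congr (_ * _).
    by rewrite xE -[in RHS](trmxK b) -trmx_mul [RHS]mxE.
  rewrite lerDr mx11_sum.
  have -> : \sum_i \sum_j b 0 i * b 0 j * Q i j =
      \sum_l (\sum_i b 0 i * hcoord l (d i)) ^+ 2.
    transitivity (\sum_i \sum_l \sum_j (b 0 i * hcoord l (d i)) * (b 0 j * hcoord l (d j))).
      apply: eq_bigr => i _; rewrite exchange_big; apply: eq_bigr => j _.
      rewrite [Q i j]mxE /dot mulr_sumr; apply: eq_bigr => l _ /=.
      by rewrite mulrACA.
    rewrite exchange_big; apply: eq_bigr => l _; rewrite expr2 mulr_suml.
    by apply: eq_bigr => i _; rewrite mulr_sumr.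
  by apply: sumr_ge0 => l _; exact: sqr_ge0.
rewrite subr_le0 => x2 xn.
have n2' : (2 : R) <= x by apply: le_trans xn; rewrite ler_nat.
by have : x * x <= x by []; nra.
Qed.

End InteriorMaximum.

(** * Half-spaces and maxima on the boundary *)

Section HalfSpace.
Context {R : realType} {n : nat}.
Implicit Types (v w y : 'rV[R]_n).

Lemma dotDl v w y : dot (v + w) y = dot v y + dot w y.
Proof. by rewrite -big_split; apply: eq_bigr => i _ /=; rewrite mxE mulrDl. Qed.

Lemma dotZl (a : R) v y : dot (a *: v) y = a * dot v y.
Proof. by rewrite /dot mulr_sumr; apply: eq_bigr => i _ /=; rewrite mxE mulrA. Qed.

Lemma dotC v w : dot v w = dot w v.
Proof. by apply: eq_bigr => i _; rewrite mulrC. Qed.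

Lemma dotNl v y : dot (- v) y = - dot v y.
Proof. by rewrite -scaleN1r dotZl mulN1r. Qed.

Lemma dotDr (u v w : 'rV[R]_n) : dot u (v + w) = dot u v + dot u w.
Proof. by rewrite dotC dotDl !(dotC u). Qed.

Lemma dotZr (c : R) (u v : 'rV[R]_n) : dot u (c *: v) = c * dot u v.
Proof. by rewrite dotC dotZl (dotC u). Qed.

Lemma dotNr (u v : 'rV[R]_n) : dot u (- v) = - dot u v.
Proof. by rewrite dotC dotNl (dotC u). Qed.

Definition dotE := (@dotDl, @dotDr, @dotZl, @dotZr, @dotNl, @dotNr).

Lemma dotBl v w y : dot (v - w) y = dot v y - dot w y.
Proof. by rewrite dotDl dotNl. Qed.

Lemma dot_ge0 v : 0 <= dot v v.
Proof. by apply: sumr_ge0 => i _; rewrite -expr2 sqr_ge0. Qed.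

Lemma dot_eq0 v : dot v v = 0 -> v = 0.
Proof.
move=> /eqP; rewrite psumr_eq0 => [|i _]; last by rewrite -expr2 sqr_ge0.
move=> /allP h; apply/rowP => i; have := h i (mem_index_enum _).
by rewrite /= -expr2 sqrf_eq0 mxE => /eqP.
Qed.

Lemma linear_coord i : linear (fun v : 'rV[R]_n => v 0 i : R).
Proof. by move=> a v w; rewrite !mxE. Qed.

Lemma is_derive_coord i y v : is_derive y v (fun x : 'rV[R]_n => x 0 i) (v 0 i).
Proof.
exact: (is_derive_linear (linear_coord i) (@coord_continuous _ _ _ 0 i) (is_derive_id y v)).
Qed.

Lemma Ck_on_coord k V i : open V -> Ck_on k V (fun v : 'rV[R]_n => v 0 i).
Proof.
move=> oV; case: k => [|k]; first by split=> // v _; exact: coord_continuous.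
apply: (Ck_on_intro (d := fun v _ => v 0 i)) => //.
- by move=> v _; exact: coord_continuous.
- by move=> v y _; exact: is_derive_coord.
- by move=> v; exact: Ck_on_cst.
Qed.

Lemma dot_continuous w : continuous (fun v => dot v w).
Proof.
move=> v; have : Ck_on 0 setT (fun v => dot v w).
  apply: Ck_on_sum => [|i]; first exact: openT.
  apply: Ck_onM; [exact: openT|apply: Ck_on_coord; exact: openT|exact: Ck_on_cst].
by move=> /Ck_on_cont; apply.
Qed.

Lemma dot_inward_inward : (0 < n)%N -> dot (@inward R n) inward = 1.
Proof.
case: n => // m _; rewrite /dot (bigD1 ord0)//= !mxE mulr1 big1 ?addr0// => i i0.
by rewrite !mxE -[0%N]/(val (@ord0 m)) (inj_eq val_inj) (negbTE i0) mulr0.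
Qed.

(** First-order conditions at a maximum over the half-space. *)
Lemma boundary_max (psi : 'rV[R]_n -> R) V y : open V -> V y -> Ck_on 1 V psi ->
  dot y inward = 0 -> (\forall x \near y, halfspace x -> psi x <= psi y) ->
  (forall v, dot v inward = 0 -> 'D_v psi y = 0) /\
  (forall v, 0 <= dot v inward -> 'D_v psi y <= 0).
Proof.
move=> oV Vy Cp y0 hmax.
have dp v : derivable psi y v by have [] := Ck_on_is_derive v Cp Vy.
have hl v : \forall t \near (0 : R), halfspace (t *: v + y) -> psi (t *: v + y) <= psi y.
  exact: line_cvg _ hmax.
split=> v v0.
  apply: derive_eq0_max => //; apply: filterS (hl v) => t; apply.
  by rewrite /halfspace /= dotDl dotZl v0 y0 mulr0 addr0.
apply: derive_le0_right => //.
have h : \forall t \near (0:R)^'+, halfspace (t *: v + y) -> psi (t *: v + y) <= psi y.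
  by apply: cvg_within; exact: hl.
near=> t; have t0 : 0 < t by [].
have : halfspace (t *: v + y) -> psi (t *: v + y) <= psi y by near: t; exact: h.
by apply; rewrite /halfspace /= dotDl dotZl y0 addr0 mulr_ge0// ltW.
Unshelve. all: by end_near. Qed.

(** Every direction is a multiple of [inward] plus a direction tangent to the
    boundary hyperplane. *)
Lemma derive_inward_split (psi : 'rV[R]_n -> R) V y w : open V -> V y -> Ck_on 1 V psi ->
  (0 < n)%N -> exists t, [/\ dot t inward = 0, w = dot w inward *: inward + t &
    'D_w psi y = dot w inward * 'D_inward psi y + 'D_t psi y].
Proof.
move=> oV Vy Cp n0; exists (w - dot w inward *: inward).
have wE : w = dot w inward *: inward + (w - dot w inward *: inward).
  by rewrite addrC subrK.
split=> //; first by rewrite dotBl dotZl dot_inward_inward// mulr1 subrr.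
rewrite {1}wE (derive_addr _ _ oV Vy Cp) derive_scaler//.
by have [] := Ck_on_is_derive inward Cp Vy.
Qed.

End HalfSpace.

Section Conormal.
Context {R : realType} {n : nat}.
Implicit Types (p q : ambient R n) (g : 'rV[R]_n -> ambient R n) (V : set 'rV[R]_n).

Lemma adot_continuous q : continuous (fun p => adot p q).
Proof.
move=> p; apply: cvgD.
  apply: (@continuous_comp _ _ _ fst (fun v : 'rV[R]_n => dot v q.1)).
    exact: cvg_fst.
  exact: dot_continuous.
by apply: cvgM; [exact: cvg_snd|exact: cvg_cst].
Qed.

(** At a boundary maximum of [phi], the differential of [phi] is nonnegative on
    the outer conormal [nu]: [nu] is tangent to the hypersurface, orthogonal to
    its boundary, and forms an obtuse angle with the image of [inward]. *)
Lemma conormal_phi_ge0 (k e : R) g V y nu : (0 < n)%N -> open V -> V y -> Ck_on 1 V g ->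
  dot y inward = 0 ->
  (\forall x \near y, halfspace x -> phi k e (g x) <= phi k e (g y)) ->
  (forall mu, unit_normal_at g y mu -> adot mu nu = 0) ->
  (forall v, dot v inward = 0 -> adot ('D_v g y) nu = 0) ->
  adot ('D_inward g y) nu < 0 -> nu != 0 ->
  0 <= dphi k e (g y) nu.
Proof.
move=> n0 oV Vy Cg y0 hmax hmu htan hin nu0.
have [w nuE] : exists w, nu = 'D_w g y.
  by apply: (tangentP oV Vy Cg) => mu /hmu; rewrite adotC.
have Cpsi : Ck_on 1 V (phi k e \o g) by exact: Ck_on_phi.
have [tan inw] := boundary_max oV Vy Cpsi y0 hmax.
have Ca : Ck_on 1 V ((fun p => adot p nu : R) \o g).
  by apply: Ck_on_linear => //; [exact: adot_linear|exact: adot_continuous].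
have dg v : derivable g y v by have [] := Ck_on_is_derive v Cg Vy.
have Da v : 'D_v ((fun p => adot p nu : R) \o g) y = adot ('D_v g y) nu.
  exact: (derive_linear (adot_linear nu) (@adot_continuous nu) (dg v)).
have [t [t0 wE]] := derive_inward_split w oV Vy Ca n0.
rewrite (Da w) (etrans (Da t) (htan t t0)) (Da inward) addr0 -nuE => e1.
have a0 : dot w inward < 0.
  have : 0 < adot nu nu by rewrite lt_def adot_ge0 andbT; apply: contra nu0 => /eqP /adot_eq0 ->.
  by rewrite e1 nmulr_lgt0.
have [_ e2] := is_derive_phi k e w oV Vy Cg.
rewrite nuE -e2; have [t' [t'0 wE' ->]] := derive_inward_split w oV Vy Cpsi n0.
by rewrite (tan _ t'0) addr0 mulr_le0 ?(ltW a0)// inw// dot_inward_inward.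
Qed.

Variables (I : set R) (omega : R -> R).
Hypothesis omega_smooth : smooth_on I omega.
Hypothesis omega_gt0 : forall z, I z -> 0 < omega z.

Lemma omega_is_derive z : I z -> is_derive z 1 omega (derive1 omega z).
Proof. by move=> Iz; rewrite derive1E; apply: Ck_on_is_derive (omega_smooth 1) Iz. Qed.

Lemma adot_revolution_normal p q : I p.2 -> enorm p.1 = omega p.2 ->
  adot q (revolution_normal omega p) = (Num.sqrt (1 + derive1 omega p.2 ^+ 2))^-1 *
    ((omega p.2)^-1 * dot q.1 p.1 - derive1 omega p.2 * q.2).
Proof.
move=> Ip pE; rewrite adotC adotZl; congr (_ * _).
rewrite /adot /= dotZl pE mulNr; congr (_ * _ - _).
exact: dotC.
Qed.

Lemma normal_factor_gt0 (z : R) : 0 < (Num.sqrt (1 + derive1 omega z ^+ 2))^-1.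
Proof. by rewrite invr_gt0 sqrtr_gt0 ltr_wpDr// sqr_ge0. Qed.

Lemma dphi_revolution_normal k e p : I p.2 -> enorm p.1 = omega p.2 ->
  dphi k e p (revolution_normal omega p) = (Num.sqrt (1 + derive1 omega p.2 ^+ 2))^-1 *
    (- k * derive1 omega p.2 + 2 * e * omega p.2).
Proof.
move=> Ip pE; rewrite /dphi /revolution_normal /=.
set c := (Num.sqrt _)^-1.
have -> : dot p.1 (c *: ((enorm p.1)^-1 *: p.1)) = c * omega p.2.
  rewrite dotC dotZl dotZl -(sqr_sqrtr (dot_ge0 p.1)) -/(enorm p.1) pE expr2.
  by rewrite mulKf// gt_eqF// omega_gt0.
by rewrite -[c *: (- _)]/(c * _); ring.
Qed.

(** Tangent vectors of the boundary of a hypersurface supported on a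
    hypersurface of revolution are orthogonal to the normal of the latter. *)
Lemma revolution_tangent g V y v : open V -> V y -> Ck_on 1 V g -> dot y inward = 0 ->
  dot v inward = 0 ->
  (\forall x \near y, dot x inward = 0 -> revolution I omega (g x)) ->
  adot ('D_v g y) (revolution_normal omega (g y)) = 0.
Proof.
move=> oV Vy Cg y0 v0 hS.
have [Iy Ey] : revolution I omega (g y) by exact: nbhs_singleton hS y0.
rewrite adot_revolution_normal//.
have dg : derivable g y v by have [] := Ck_on_is_derive v Cg Vy.
have d1 := is_derive_phi 0 1 v oV Vy Cg.
have dz := is_derive_linear linear_vcoord continuous_vcoord (derivableP dg).
have dw := @is_derive_chain _ _ omega (vcoord \o g) y v _ _ (omega_is_derive (Iy : I ((vcoord \o g) y))) dz.
have d2 := is_deriveB d1 (is_deriveM dw dw).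
set chi := (_ - _) in d2.
have chi0 x : revolution I omega (g x) -> chi x = 0.
  move=> [Ix Ex]; rewrite /chi -[LHS]/(phi 0 1 (g x) - omega (g x).2 * omega (g x).2).
  by rewrite /phi mul0r add0r mul1r -(sqr_sqrtr (dot_ge0 _)) -/(enorm _) Ex subrr.
have chi1 : 'D_v chi y = 0.
  apply: derive_eq0_max; first by case: d2.
  have hl : \forall t \near (0 : R), dot (t *: v + y) inward = 0 ->
      revolution I omega (g (t *: v + y)) by exact: line_cvg _ hS.
  apply: filterS hl => t ht.
  rewrite !chi0//; apply: ht.
  by rewrite dotDl dotZl v0 y0 mulr0 addr0.
have [_ e2] := d2; rewrite chi1 in e2.
pose X := dot (g y).1 ('D_v g y).1; pose Z := ('D_v g y).2.
pose W := omega (g y).2; pose W' := derive1 omega (g y).2.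
have h : 0 = (0 * Z + 2 * 1 * X) - (W * (W' * Z) + W * (W' * Z)) := e2.
have w0 : W != 0 by rewrite gt_eqF// omega_gt0.
rewrite dotC -/X -/Z -/W -/W'; apply/eqP; rewrite mulf_eq0; apply/orP; right.
rewrite subr_eq0; apply/eqP/(mulfI w0); rewrite mulrA mulfV// mul1r; lra.
Qed.

End Conormal.

(** * Hypersurfaces read in charts *)

Section FreeBoundary.
Context {R : realType} {n : nat} {M : topologicalType}.
Variables (I : set R) (omega : R -> R) (A : set (chart R n M)) (F : M -> ambient R n).
Hypothesis n2 : (2 <= n)%N.
Hypothesis omega_smooth : smooth_on I omega.
Hypothesis omega_gt0 : forall z, I z -> 0 < omega z.
Hypothesis atlas : smooth_atlas A.
Hypothesis minF : minimal_immersion A F.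

Let n0 : (0 < n)%N. Proof. exact: leq_trans n2. Qed.

Lemma chart_at p : exists c, [/\ A c, cdom c p, crange c (cmap c p) & cinv c (cmap c p) = p].
Proof.
have [_ ch cov _] := atlas; have [c Ac cp] := cov p.
by exists c; have [_ _ h _ _] := ch c Ac; have [? ?] := h p cp.
Qed.

(** Locally, the range of a chart is the whole half-space. *)
Lemma crange_near c y : A c -> crange c y -> \forall x \near y, halfspace x -> crange c x.
Proof.
move=> Ac cy; have [_ ch _ _] := atlas; have [_ [W oW cW] _ _ _] := ch c Ac.
have [Wy _] : (W `&` halfspace) y by rewrite -cW.
have : \forall x \near y, W x by exact: open_nbhs_nbhs.
by apply: filterS => x Wx Hx; rewrite cW.
Qed.

Lemma crange_halfspace c y : A c -> crange c y -> 0 <= dot y inward.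
Proof.
move=> Ac cy; have [_ ch _ _] := atlas; have [_ [W oW cW] _ _ _] := ch c Ac.
by have [] : (W `&` halfspace) y by rewrite -cW.
Qed.

(** A smooth extension of F read in a chart. *)
Lemma local_repE c y : A c -> crange c y ->
  exists g V, [/\ open V, V y, smooth_on V g,
    forall w, V w -> crange c w -> g w = F (cinv c w) & local_rep F c y g].
Proof.
move=> Ac cy; have [[sF _] _] := minF; have [g lg] := sF c Ac y cy.
by have [V [oV Vy Sg gE]] := lg; exists g, V; split.
Qed.

Lemma hypersurface_continuous : continuous F.
Proof.
move=> p; have [c [Ac cp ry pE]] := chart_at p; set y := cmap c p in ry pE *.
have [g [V [oV Vy Sg gE _]]] := local_repE Ac ry.
have [_ ch _ _] := atlas; have [oc _ cK _ [cc _]] := ch c Ac.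
have ccp : {for p, continuous (cmap c)}.
  by move: cc; rewrite continuous_open_subspace// => h; apply: h; rewrite inE.
have cg : {for y, continuous g} by apply: Ck_on_cont Vy; exact: (Sg 0%N).
have Fp : g y = F p by rewrite gE// pE.
rewrite /continuous_at -Fp.
have h : (g \o cmap c) x @[x --> p] --> g y by exact: (cvg_comp _ _ ccp cg).
apply: cvg_trans h; apply: near_eq_cvg.
have n1 : \forall x \near p, cdom c x by exact: open_nbhs_nbhs.
have n2' : \forall x \near p, V (cmap c x).
  exact: ccp _ (open_nbhs_nbhs (conj oV Vy)).
apply: filterS2 n1 n2' => x cx Vx /=.
by have [rx xE] := cK x cx; rewrite gE// xE.
Qed.

(** A maximum point [p] of [phi] on the hypersurface is a boundary point, and
    the differential of [phi] there is nonnegative on the outer conormal; the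
    conclusion omits a positive factor. *)
Lemma phi_max_boundary (k e : R) (s : bool) p : 0 < e ->
  F @` boundary A `<=` revolution I omega ->
  (forall c y g, A c -> crange c y -> dot y inward = 0 -> local_rep F c y g ->
     (forall nu, unit_normal_at g y nu ->
        adot nu ((-1) ^+ s *: revolution_normal omega (F (cinv c y))) = 0) /\
     adot ('D_inward g y) ((-1) ^+ s *: revolution_normal omega (F (cinv c y))) < 0) ->
  (forall p', phi k e (F p') <= phi k e (F p)) ->
  revolution I omega (F p) /\
  0 <= (-1) ^+ s * (- k * derive1 omega (F p).2 + 2 * e * omega (F p).2).
Proof.
move=> e0 Fb hs hmax.
have [c [Ac cp ry pE]] := chart_at p; set y := cmap c p in ry pE *.
have [g [V [oV Vy Sg gE lg]]] := local_repE Ac ry.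
have Fp : g y = F p by rewrite gE// pE.
have nV : \forall x \near y, V x by exact: open_nbhs_nbhs.
have nr := crange_near Ac ry.
have gmax : \forall x \near y, halfspace x -> phi k e (g x) <= phi k e (g y).
  by apply: filterS2 nV nr => x Vx cx Hx; rewrite Fp gE//; exact: cx.
have [y0|y0] := eqVneq (dot y inward) 0; last first.
  have yp : 0 < dot y inward by rewrite lt_def y0 (crange_halfspace Ac ry).
  have [[_ im] mi] := minF.
  case: (@interior_no_max R n k e g V y n2 e0 oV Vy (Sg 2%N) (im c y g Ac ry lg) (mi c y g Ac ry lg)).
  have nH : \forall x \near y, 0 < dot x inward.
    by apply: (cvgr_gt _ (@dot_continuous R n inward y)).
  by apply: filterS2 gmax nH => x hx x0; apply: hx; exact: ltW.
have Fbp x : V x -> halfspace x -> crange c x -> dot x inward = 0 -> revolution I omega (g x).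
  move=> Vx Hx cx x0; rewrite gE//; apply: Fb; exists (cinv c x) => //.
  have [_ ch _ _] := atlas; have [_ _ _ rK _] := ch c Ac; have [dx xE] := rK x cx.
  by exists c; split => //; rewrite xE.
have Cg := Sg 1%N.
have [h1 h2] := hs c y g Ac ry y0 lg.
rewrite pE -Fp in h1 h2.
have Hy : halfspace y by rewrite /halfspace /= y0.
have Sy := Fbp y Vy Hy ry y0; have [Iy Ey] := Sy.
rewrite -Fp; split=> //.
set nu := (-1) ^+ s *: _ in h1 h2.
have nu0 : nu != 0.
  by apply: contraTneq h2 => ->; rewrite adotC adot0l ltxx.
have tan v : dot v inward = 0 -> adot ('D_v g y) nu = 0.
  move=> v0; rewrite /nu adotC adotZl adotC (@revolution_tangent R n I omega omega_smooth omega_gt0 g V y v)// ?mulr0//.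
  by apply: filterS2 nV nr => x Vx cx x0; apply: Fbp => //; [|apply: cx]; rewrite /halfspace /= x0.
have := conormal_phi_ge0 n0 oV Vy Cg y0 gmax h1 tan h2 nu0.
have -> : dphi k e (g y) nu = (-1) ^+ s * dphi k e (g y) (revolution_normal omega (g y)).
  have := linear_dphi k e (g y) ((-1) ^+ s) (revolution_normal omega (g y)) 0.
  by rewrite addr0 => ->; rewrite {2}/dphi /dot big1 ?mulr0 ?addr0// => i _; rewrite mxE mulr0.
rewrite (dphi_revolution_normal omega_gt0 k e Iy Ey) mulrCA pmulr_rge0//.
exact: normal_factor_gt0.
Qed.

End FreeBoundary.

(** * The profile of a catenoid is strictly convex *)

Section DotDerivatives.
Context {R : realType} {n : nat}.
Implicit Types (v w y : 'rV[R]_n).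

Lemma is_derive_dotr w y v : is_derive y v (fun x => dot x w) (dot v w).
Proof.
have h := is_derive_sum_fun (fun i => is_deriveM (is_derive_coord i y v) (is_derive_cst (w 0 i) y v)).
apply: is_derive_eq h _; apply: eq_bigr => i _.
by rewrite scaler0 add0r mulrC.
Qed.

Lemma is_derive_dot2 y v : is_derive y v (fun x => dot x x) (2 * dot y v).
Proof.
have h := is_derive_sum_fun (fun i => is_deriveM (is_derive_coord i y v) (is_derive_coord i y v)).
apply: is_derive_eq h _; rewrite mulr_sumr; apply: eq_bigr => i _.
by rewrite -[_ *: _]/(_ * _) -mulr2n mulr_natl.
Qed.

Lemma Ck_on_id k (V : set 'rV[R]_n) : open V -> Ck_on k V (id : 'rV[R]_n -> 'rV[R]_n).
Proof. by move=> oV; apply: Ck_on_rV => // i; exact: Ck_on_coord. Qed.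

Lemma Ck_on_row_coord k (V : set 'rV[R]_n) (f : 'rV[R]_n -> 'rV[R]_n) i :
  open V -> Ck_on k V f -> Ck_on k V (fun y => f y 0 i).
Proof.
move=> oV Cf.
exact: (Ck_on_linear oV (linear_coord i) (@coord_continuous _ _ _ 0 i) Cf).
Qed.

Lemma Ck_on_dotself k (V : set 'rV[R]_n) (f : 'rV[R]_n -> 'rV[R]_n) :
  open V -> Ck_on k V f -> Ck_on k V (fun y => dot (f y) (f y)).
Proof.
move=> oV Cf.
have C2 i : Ck_on k V (fun y => f y 0 i * f y 0 i).
  exact: (Ck_onM oV (Ck_on_row_coord i oV Cf) (Ck_on_row_coord i oV Cf)).
exact: (Ck_on_sum oV C2).
Qed.

End DotDerivatives.

Section CatenoidConvexity.
Context {R : realType} {n : nat}.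
Variables (I : set R) (omega : R -> R).
Hypothesis n2 : (2 <= n)%N.
Hypothesis oI : open I.
Hypothesis omega_smooth : smooth_on I omega.
Hypothesis omega_gt0 : forall z, I z -> 0 < omega z.
Hypothesis omega_min : minimal_set (revolution (n := n) I omega).

Let i0 : 'I_n := Ordinal (leq_trans (ltnW (ltnSn 1)) n2).

(* g parametrizes the part x_0 > 0 of the hypersurface of revolution by the
   height z = y_0 and the coordinates x_k = y_k for k != 0; there x_0 = f y and
   h y = x_0 ^ 2. *)
Let h (y : 'rV[R]_n) : R := omega (y 0 i0) * omega (y 0 i0) + y 0 i0 * y 0 i0 - dot y y.
Let V1 : set 'rV[R]_n := [set y : 'rV[R]_n | I (y 0 i0)].
Let V : set 'rV[R]_n := [set y : 'rV[R]_n | I (y 0 i0) /\ 0 < h y].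
Let f (y : 'rV[R]_n) : R := Num.sqrt (h y).
Let g (y : 'rV[R]_n) : ambient R n := (\row_k (if k == i0 then f y else y 0 k), y 0 i0).

Let oV1 : open V1.
Proof.
apply: (@open_comp _ _ (fun y : 'rV[R]_n => y 0 i0) I) => // y _.
exact: coord_continuous.
Qed.

Let Ck_w k : Ck_on k V1 (fun y => omega (y 0 i0)).
Proof.
by apply: (@Ck_on_chain R _ k V1 I omega (fun y => y 0 i0)) => //; exact: Ck_on_coord.
Qed.

Let Ck_h1 k : Ck_on k V1 h.
Proof.
apply: Ck_onD => //.
  apply: Ck_onD => //; apply: Ck_onM => //; exact: Ck_on_coord.
apply: (@Ck_on_ext _ _ _ k V1 (fun y => -1 * dot y y)) => //.
  by move=> y _; rewrite mulN1r.
by apply: Ck_onM => //; [exact: Ck_on_cst|exact/Ck_on_dotself/Ck_on_id].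
Qed.

Let oV : open V.
Proof.
rewrite openE => y [Iy hy]; rewrite /interior.
have n1 : \forall x \near y, V1 x by exact: open_nbhs_nbhs.
have n2' : \forall x \near y, 0 < h x.
  exact: (cvgr_gt _ (Ck_on_cont (Ck_h1 0) Iy) _ hy).
by apply: filterS2 n1 n2' => x Ix hx; split.
Qed.

Let VV1 : V `<=` V1. Proof. by move=> y []. Qed.

Let Ck_f k : Ck_on k V f.
Proof.
apply: (@Ck_on_chain R _ k V [set x | 0 < x] Num.sqrt h) => //.
- by move=> y [].
- exact: Ck_on_sqrt.
- exact: Ck_onS VV1 (Ck_h1 k).
Qed.

Let smooth_g : smooth_on V g.
Proof.
move=> k; apply: Ck_on_pair => //; last exact: Ck_on_coord.
apply: Ck_on_rV => // i; have [ii0|ii0] := eqVneq i i0.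
  by apply: (Ck_on_ext oV _ (Ck_f k)) => y _; rewrite mxE ii0 eqxx.
apply: (Ck_on_ext oV _ (Ck_on_coord k i oV)) => y _.
by rewrite mxE (negbTE ii0).
Qed.

Let g_hcoord0 : hcoord i0 \o g = f.
Proof. by apply/funext => y; rewrite /hcoord /= mxE eqxx. Qed.

Let g_hcoord k : k != i0 -> hcoord k \o g = (fun y => y 0 k).
Proof. by move=> k0; apply/funext => y; rewrite /hcoord /= mxE (negbTE k0). Qed.

Let g_vcoord : vcoord \o g = (fun y => y 0 i0).
Proof. by []. Qed.

Let f2 y : V y -> f y * f y = h y.
Proof. by move=> [_ hy]; rewrite -expr2 sqr_sqrtr// ltW. Qed.

Let g_revolution : g @` V `<=` revolution I omega.
Proof.
move=> _ [y [Iy hy] <-]; split=> //.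
have Vy : V y by split.
suff e : dot (g y).1 (g y).1 = omega (y 0 i0) ^+ 2.
  by rewrite /enorm e sqrtr_sqr gtr0_norm// omega_gt0.
rewrite /dot (bigD1 i0)//= !mxE eqxx f2//.
rewrite (eq_bigr (fun k => y 0 k * y 0 k)) => [|k k0]; last by rewrite !mxE (negbTE k0).
rewrite /h /dot [X in _ - X](bigD1 i0)//=.
by set S := \sum_(_ | _) _; rewrite expr2; ring.
Qed.

Let dgd y v : V y -> derivable g y v.
Proof. by move=> Vy; have [] := Ck_on_is_derive v (smooth_g 1) Vy. Qed.

Let Dg_hcoord y v k : V y -> k != i0 -> hcoord k ('D_v g y) = v 0 k.
Proof.
move=> Vy k0; rewrite -(derive_linear (linear_hcoord k) (@continuous_hcoord _ _ k) (@dgd y v Vy)).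
by rewrite (g_hcoord k0); have [] := is_derive_coord k y v.
Qed.

Let Dg_hcoord0 y v : V y -> hcoord i0 ('D_v g y) = 'D_v f y.
Proof.
move=> Vy; rewrite -(derive_linear (linear_hcoord i0) (@continuous_hcoord _ _ i0) (@dgd y v Vy)).
by rewrite g_hcoord0.
Qed.

Let Dg_vcoord y v : V y -> vcoord ('D_v g y) = v 0 i0.
Proof.
move=> Vy; rewrite -(derive_linear linear_vcoord continuous_vcoord (@dgd y v Vy)).
by rewrite g_vcoord; have [] := is_derive_coord i0 y v.
Qed.

Let immersive_g y : V y -> immersive_at g y.
Proof.
move=> Vy v Dv; apply/rowP => k; rewrite mxE; have [->|k0] := eqVneq k i0.
  by rewrite -(Dg_vcoord v Vy) Dv.
by rewrite -(Dg_hcoord v Vy k0) Dv /hcoord mxE.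
Qed.

Let w1 := 'D_1 omega.
Let w2 := 'D_1 w1.

Let dw (z : R) : I z -> is_derive z 1 omega (w1 z).
Proof. exact: Ck_on_is_derive (omega_smooth 1). Qed.

Let dw1 (z : R) : I z -> is_derive z 1 w1 (w2 z).
Proof.
move=> Iz; have C : Ck_on 1 I w1 := Ck_on_derive (1 : R) (omega_smooth 2).
exact: (Ck_on_is_derive (1 : R) C Iz).
Qed.

Let dh y v : V1 y -> is_derive y v h
  (2 * (omega (y 0 i0) * (w1 (y 0 i0) * v 0 i0)) + 2 * (y 0 i0 * v 0 i0) - 2 * dot y v).
Proof.
move=> Iy; have c := is_derive_coord i0 y v.
have d1 := @is_derive_chain R _ omega (fun y : 'rV[R]_n => y 0 i0) y v _ _ (dw Iy) c.
have d2 := is_deriveB (is_deriveD (is_deriveM d1 d1) (is_deriveM c c)) (is_derive_dot2 y v).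
have [D e] := d2.
split; first exact: D.
apply: etrans e _.
rewrite /GRing.scale /=.
ring.
Qed.

Let ddh y v : V1 y -> 'D_v ('D_v h) y =
  2 * ((w1 (y 0 i0) * v 0 i0) * (w1 (y 0 i0) * v 0 i0) +
       omega (y 0 i0) * (w2 (y 0 i0) * v 0 i0 * v 0 i0)) + 2 * (v 0 i0 * v 0 i0) - 2 * dot v v.
Proof.
move=> Iy; have c := is_derive_coord i0 y v.
have d1 := @is_derive_chain R _ omega (fun y : 'rV[R]_n => y 0 i0) y v _ _ (dw Iy) c.
have d2 := @is_derive_chain R _ w1 (fun y : 'rV[R]_n => y 0 i0) y v _ _ (dw1 Iy) c.
have k a := is_derive_cst (a : R) y v.
have e1 := is_deriveM (k 2) (is_deriveM d1 (is_deriveM d2 (k (v 0 i0)))).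
have e2 := is_deriveM (k 2) (is_deriveM c (k (v 0 i0))).
have e3 := is_deriveM (k 2) (is_derive_dotr v y v).
have [_ e4] := is_deriveB (is_deriveD e1 e2) e3.
transitivity ('D_v (fun y : 'rV[R]_n => 2 * (omega (y 0 i0) * (w1 (y 0 i0) * v 0 i0)) +
    2 * (y 0 i0 * v 0 i0) - 2 * dot y v) y).
  apply: near_eq_derive; have : \forall x \near y, V1 x by exact: open_nbhs_nbhs.
  by apply: filterS => x Ix; have [_ ->] := dh v Ix.
pose W := omega (y 0 i0); pose W1 := w1 (y 0 i0); pose W2 := w2 (y 0 i0).
pose c0 := y 0 i0; pose v0 := v 0 i0.
have e5 : _ = 2 * (W * (W1 * 0 + v0 * (W2 * v0)) + (W1 * v0) * (W1 * v0)) +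
    (W * (W1 * v0)) * 0 + (2 * (c0 * 0 + v0 * v0) + (c0 * v0) * 0) -
    (2 * dot v v + dot y v * 0) := e4.
by apply: etrans e5 _; rewrite -/W -/W1 -/W2 -/v0; ring.
Qed.

(** At the point [(omega z e_0, z)] the vanishing of the mean curvature reads
    [omega z * omega'' z = (n - 1) (1 + omega' z ^ 2)]. *)
Lemma catenoid_omega2_gt0 z : I z -> 0 < w2 z.
Proof.
move=> Iz; pose y : 'rV[R]_n := z *: evec i0.
have ev k : (evec i0 : 'rV[R]_n) 0 k = (k == i0)%:R by rewrite mxE eqxx.
have yz : y 0 i0 = z by rewrite mxE ev eqxx mulr1.
have yv v : dot y v = z * v 0 i0.
  rewrite /dot (bigD1 i0)//= yz big1 ?addr0// => k k0.
  by rewrite mxE ev (negbTE k0) mulr0 mul0r.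
have W0 := omega_gt0 Iz; have Wn0 : omega z != 0 by rewrite gt_eqF.
have hy : h y = omega z * omega z by rewrite /h yv yz addrK.
have Vy : V y by split; rewrite ?yz// hy mulr_gt0.
have V1y := VV1 Vy.
have fy : f y = omega z by rewrite /f hy -expr2 sqrtr_sqr gtr0_norm.
have df v u : V u -> is_derive u v f ('D_v f u) by exact: Ck_on_is_derive (Ck_f 1).
have fh : \forall x \near y, h x = f x * f x.
  have : \forall x \near y, V x by exact: open_nbhs_nbhs.
  by apply: filterS => x Vx; rewrite f2.
have Df v : 'D_v f y = w1 z * v 0 i0.
  have e1 : 'D_v h y = f y * 'D_v f y + f y * 'D_v f y.
    rewrite (near_eq_derive v fh).
    by have [_ ->] := is_deriveM (df v y Vy) (df v y Vy).
  have [_ e2] := dh v V1y; rewrite yv yz in e2; rewrite e2 fy in e1.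
  by apply/(mulfI Wn0); lra.
have DDf v : omega z * 'D_v ('D_v f) y = omega z * (w2 z * v 0 i0 * v 0 i0) + v 0 i0 * v 0 i0 - dot v v.
  have e1 : 'D_v ('D_v h) y = 2 * (f y * 'D_v ('D_v f) y + 'D_v f y * 'D_v f y).
    transitivity ('D_v (fun x => 2 * (f x * 'D_v f x)) y).
      apply: near_eq_derive; have : \forall x \near y, V x by exact: open_nbhs_nbhs.
      apply: filterS => x Vx.
      have fhx : \forall x' \near x, h x' = f x' * f x'.
        have : \forall x' \near x, V x' by exact: open_nbhs_nbhs.
        by apply: filterS => x' Vx'; rewrite f2.
      rewrite (near_eq_derive v fhx).
      have [_ ->] := is_deriveM (df v x Vx) (df v x Vx).
      by rewrite -[_ *: _]/(_ * _) -mulr2n mulr_natl.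
    have ddf : is_derive y v ('D_v f) ('D_v ('D_v f) y).
      exact: Ck_on_is_derive (Ck_on_derive v (Ck_f 2)) Vy.
    have [_ ->] := is_deriveM (is_derive_cst (2 : R) y v) (is_deriveM (df v y Vy) ddf).
    by rewrite scaler0 addr0.
  rewrite (ddh v V1y) fy Df yz in e1; lra.
pose s : R := (Num.sqrt (1 + w1 z ^+ 2))^-1.
have q0 : 0 < 1 + w1 z ^+ 2 by rewrite ltr_wpDr// sqr_ge0.
have s0 : s != 0 by rewrite invr_eq0 gt_eqF// sqrtr_gt0.
have s2 : s * s * (1 + w1 z ^+ 2) = 1.
  by rewrite -expr2 exprVn sqr_sqrtr ?(ltW q0)// mulVf// gt_eqF.
pose nu : ambient R n := s *: (evec i0, - w1 z).
have nuh k : hcoord k nu = s * (k == i0)%:R by rewrite /hcoord /nu /= mxE ev.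
have nuh0 : hcoord i0 nu = s by rewrite nuh eqxx mulr1n mulr1.
have nuv : vcoord nu = - (s * w1 z) by rewrite -mulrN.
have anu q : adot q nu = s * (hcoord i0 q - w1 z * vcoord q).
  have -> : adot q nu = hcoord i0 q * s + vcoord q * vcoord nu.
    rewrite adot_coords; congr (_ + _); rewrite -nuh0 (bigD1 i0)//= big1 ?addr0// => k k0.
    by rewrite nuh (negbTE k0) !mulr0.
  by rewrite nuv; ring.
have unu : unit_normal_at g y nu.
  split=> [|v].
    by rewrite anu nuh0 nuv -s2; ring.
  by rewrite anu (Dg_hcoord0 v Vy) (Dg_vcoord v Vy) Df subrr mulr0.
have := omega_min oV smooth_g immersive_g g_revolution Vy unu.
rewrite /mean_curvature; set P := first_form g y; set S := second_form g y nu.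
pose d : 'rV[R]_n := \row_i (if i == i0 then 1 + w1 z ^+ 2 else 1).
have d0 i : d 0 i != 0 by rewrite mxE; case: ifP => _; rewrite ?oner_eq0// gt_eqF.
have evE i k : (evec i : 'rV[R]_n) 0 k = (k == i)%:R by rewrite mxE eqxx.
(* like p i holds of the i-th tangent vector of g at y; these vectors are
   orthogonal *)
pose like (p : ambient R n) i := [/\ vcoord p = (i0 == i)%:R,
  hcoord i0 p = w1 z * (i0 == i)%:R & forall k, k != i0 -> hcoord k p = (k == i)%:R].
have likeD i : like ('D_(evec i) g y) i.
  split=> [||k k0].
  - exact: etrans (Dg_vcoord (evec i) Vy) (evE i i0).
  - apply: etrans (Dg_hcoord0 (evec i) Vy) _; apply: etrans (Df (evec i)) _.
    by rewrite evE.
  - exact: etrans (Dg_hcoord (evec i) Vy k0) (evE i k).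
have like_adot p q i j : like p i -> like q j -> adot p q = d 0 i *+ (i == j).
  move=> [p1 p2 p3] [q1 q2 q3]; rewrite adot_coords (bigD1 i0)//= p1 p2 q1 q2.
  rewrite (eq_bigr (fun k => (k == i)%:R * (k == j)%:R)) => [|k k0]; last by rewrite p3// q3.
  rewrite mxE (eq_sym i i0); have [<-|ii0] := eqVneq i0 i.
    rewrite big1 => [|k k0]; last by rewrite (negbTE k0) mul0r.
    by case: eqVneq => _; rewrite ?mulr1n ?mulr0n; ring.
  rewrite eq_sym in ii0; rewrite (bigD1 i)//= eqxx big1 => [|k /andP[_ ki]]; last by rewrite (negbTE ki) mul0r.
  by case: eqVneq => _; rewrite ?mulr1n ?mulr0n; ring.
have PE : P = diag_mx d.
  apply/matrixP => i j; rewrite /P /first_form [LHS]mxE [RHS]mxE.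
  exact: like_adot.
have invP : invmx P = diag_mx (\row_i (d 0 i)^-1).
  have PQ : P *m diag_mx (\row_i (d 0 i)^-1) = 1%:M.
    rewrite PE mulmx_diag -diag_const_mx; congr diag_mx; apply/rowP => i.
    by rewrite [LHS]mxE [X in _ * X]mxE [RHS]mxE mulfV.
  have [uP _] := mulmx1_unit PQ.
  by rewrite -[LHS]mulmx1 -PQ mulKmx.
have Sii i : omega z * S i i = s * (omega z * (w2 z * (i == i0)%:R) + (i == i0)%:R - 1).
  rewrite /S /second_form mxE anu.
  rewrite -(derive2_linear _ _ (linear_hcoord i0) (@continuous_hcoord _ _ i0) oV Vy (smooth_g 2)).
  rewrite -(derive2_linear _ _ linear_vcoord continuous_vcoord oV Vy (smooth_g 2)).
  rewrite g_hcoord0 g_vcoord.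
  have -> : 'D_(evec i) ('D_(evec i) (fun x : 'rV[R]_n => x 0 i0)) y = 0.
    rewrite (_ : (fun x => _) = fun=> (evec i : 'rV[R]_n) 0 i0); first exact: derive_cst.
    by apply/funext => x; have [] := is_derive_coord i0 x (evec i).
  rewrite mulr0 subr0 mulrCA DDf evE eq_sym.
  have -> : dot (evec i) (evec i : 'rV[R]_n) = 1.
    rewrite /dot (bigD1 i)//= evE eqxx mulr1 big1 ?addr0// => k ki.
    by rewrite evE (negbTE ki) mulr0.
  by case: (i == i0); rewrite ?mulr1n ?mulr0n; ring.
rewrite invP /mxtrace mul_diag_mx => tr0.
have : \sum_i (d 0 i)^-1 * (omega z * S i i) = 0.
  have tr1 := congr1 (fun t => omega z * t) tr0; rewrite mulr0 mulr_sumr in tr1.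
  rewrite -[RHS]tr1; apply: eq_bigr => i _.
  by rewrite [X in _ = _ * X]mxE [X in _ = _ * (X * _)]mxE mulrCA.
rewrite (bigD1 i0)//= Sii eqxx.
rewrite (eq_bigr (fun=> - s)) => [|k k0]; last first.
  rewrite Sii (negbTE k0) mxE (negbTE k0) invr1 mulr0n; ring.
rewrite sumr_const cardC1 card_ord mxE eqxx mulr1n mulr1 addrK mulNrn => e.
have n1 : (0 : R) < n.-1%:R by rewrite ltr0n; case: (n) n2 => [|[]].
have e2 : (1 + w1 z ^+ 2)^-1 * (omega z * w2 z) = n.-1%:R.
  by apply: (mulfI s0); rewrite mulr_natr; apply/eqP; rewrite -subr_eq0 -e mulrCA.
by move: n1; rewrite -e2 pmulr_rgt0 ?invr_gt0// pmulr_rgt0.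
Qed.

End CatenoidConvexity.

(** * Free boundary minimal hypersurfaces are flat *)

Section Profile.
Context {R : realType} {n : nat}.
Variables (I : set R) (omega : R -> R).
Hypothesis n2 : (2 <= n)%N.
Hypothesis cat : catenoid_profile n I omega.

Lemma profile_smooth : smooth_on I omega. Proof. by have [_ []] := cat. Qed.

Lemma profile_gt0 z : I z -> 0 < omega z.
Proof. by have [_ [_ h] _ _ _] := cat; exact: h. Qed.

Lemma profile_I0 : I 0. Proof. by have [[]] := cat. Qed.

Lemma profile_between a b c : I a -> I b -> a <= c <= b -> I c.
Proof. by have [[_ h _] _ _ _ _] := cat => Ia Ib; apply: (h a b). Qed.

Lemma profile_derive1_incr x y : I x -> I y -> x < y -> derive1 omega x < derive1 omega y.
Proof.
move=> Ix Iy xy; have [[oI _ _] _ _ omin _] := cat.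
have C : Ck_on 1 I ('D_1 omega) := Ck_on_derive (1 : R) (profile_smooth 2).
have Ic c : x <= c <= y -> I c by exact: profile_between.
rewrite !derive1E; have [||c] := @MVT R ('D_1 omega) ('D_1 ('D_1 omega)) x y xy.
- move=> c; rewrite in_itv /= => /andP[xc cy].
  by apply: (Ck_on_is_derive (1 : R) C); apply: Ic; rewrite !ltW.
- apply/subspace_continuousP => c; rewrite /= in_itv /= => xcy.
  by apply: cvg_within_filter; exact: Ck_on_cont C (Ic c xcy).
rewrite in_itv /= => /andP[xc cy] e; rewrite -subr_gt0 e mulr_gt0 ?subr_gt0//.
apply: (catenoid_omega2_gt0 n2 oI profile_smooth profile_gt0 omin).
by apply: Ic; rewrite !ltW.
Qed.

Lemma profile_derive1_0 : derive1 omega 0 = 0.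
Proof.
have [[oI _ _] _ _ _ neck] := cat.
have d := is_deriveN (Ck_on_is_derive (1 : R) (profile_smooth 1) profile_I0).
have e : 'D_1 (- omega) 0 = 0.
  apply: derive_eq0_max; first by case: d.
  have : \forall t \near (0 : R), I t by apply: open_nbhs_nbhs; split => //; exact: profile_I0.
  apply: filterS => t It; rewrite addr0 [_ *: 1]mulr1 -[_ t]/(- omega t) -[(- omega) 0]/(- omega 0) lerN2.
  by have [->//|t0] := eqVneq t 0; rewrite ltW// neck.
by rewrite derive1E; apply/eqP; rewrite -oppr_eq0; have [_ <-] := d; apply/eqP.
Qed.

End Profile.

Section Flatness.
Context {R : realType} {n : nat} {M : topologicalType}.
Variables (I : set R) (omega : R -> R) (A : set (chart R n M)) (F : M -> ambient R n).
Hypothesis n2 : (2 <= n)%N.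
Hypothesis cat : catenoid_profile n I omega.
Hypothesis hF : free_boundary_minimal_hypersurface I omega A F.

Lemma phi_has_max k e : exists p, forall p', phi k e (F p') <= phi k e (F p).
Proof.
have [at_ [cM _] [p0 _] mF _] := hF.
have cphi : continuous (phi k e \o F).
  move=> p; apply: continuous_comp; first exact: (hypersurface_continuous at_ mF).
  have C : Ck_on 0 [set: ambient R n] (phi k e).
    have oT : open [set: ambient R n] by exact: openT.
    have Cv : Ck_on 0 [set: ambient R n] vcoord.
      exact: (conj (fun q _ => @continuous_vcoord R n q) Logic.I).
    have Ch i : Ck_on 0 [set: ambient R n] (hcoord i).
      exact: (conj (fun q _ => @continuous_hcoord R n i q) Logic.I).
    apply: Ck_onD => //; apply: Ck_onM => //; try exact: Ck_on_cst.
    apply: (@Ck_on_sum _ _ 0 _ _ (fun i q => hcoord i q * hcoord i q)) => // i.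
    by apply: Ck_onM.
  exact: Ck_on_cont C _.
have [|||p _ hp] := @compact_EVT_max M R (phi k e \o F) setT.
- by exists p0.
- exact: cM.
- exact: continuous_subspaceT.
by exists p => p'; apply: hp; rewrite inE.
Qed.

(** The first-order condition at a maximum point of [phi].  The maximum of
    [|x|^2], where [omega z > 0], shows that the normal that points away from
    the hypersurface is the gradient of [|x| - omega z] and not its opposite. *)
Lemma phi_max_spec k e p : 0 < e -> (forall p', phi k e (F p') <= phi k e (F p)) ->
  revolution I omega (F p) /\ k * derive1 omega (F p).2 <= 2 * e * omega (F p).2.
Proof.
move=> e0 hp; have [at_ _ _ mF [Fb [s hs]]] := hF.
have max := phi_max_boundary n2 (profile_smooth cat) (profile_gt0 cat) at_ mF _ Fb hs.
have s0 : s = false.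
  have [q hq] := phi_has_max 0 1.
  have [[Iq _]] := max 0 1 q ltr01 hq.
  rewrite oppr0 mul0r add0r mulr1; case: (s) => //.
  by rewrite expr1 mulN1r oppr_ge0 leNgt mulr_gt0// (profile_gt0 cat Iq).
have [Sp] := max k e p e0 hp; rewrite s0 expr0 mul1r => h; split=> //.
by rewrite -subr_ge0 addrC -mulNr.
Qed.

(** The bounds for [k = 1] and for [k = -1] together make the height vanish. *)
Lemma height_le0 (k : R) p : k = 1 \/ k = -1 -> k * (F p).2 <= 0.
Proof.
move=> hk; rewrite leNgt; apply/negP => m0; set m := k * (F p).2 in m0.
have k2 : k * k = 1 by case: hk => ->; rewrite ?mulrNN mulr1.
have [pK hK] := phi_has_max 0 1; set K := phi 0 1 (F pK) in hK.
have phi01 q : phi 0 1 (F q) = dot (F q).1 (F q).1 by rewrite /phi mul0r add0r mul1r.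
have Kb q : dot (F q).1 (F q).1 <= K by rewrite -phi01.
have K0 : 0 <= K by rewrite (le_trans _ (Kb p))// dot_ge0.
have K1 : 0 < K + 1 by rewrite ltr_wpDl.
(* for small e, the test function is maximal at a boundary point with k * z >= m / 2 *)
have main e : 0 < e -> e <= m / (2 * (K + 1)) -> exists z, [/\ I z, m / 2 <= k * z &
    k * derive1 omega z <= 2 * e * (K + 1)].
  move=> e0 em; have [q hq] := phi_has_max k e; have [[Iq Eq] h] := phi_max_spec e0 hq.
  exists (F q).2; split=> //.
    have := hq p; rewrite /phi -/m => h1.
    have h2 : 0 <= e * dot (F p).1 (F p).1 by rewrite mulr_ge0 ?dot_ge0// ltW.
    have h3 : e * dot (F q).1 (F q).1 <= m / 2.
      apply: (@le_trans _ _ (e * (K + 1))).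
        by rewrite ler_pM2l// (le_trans (Kb q))// lerDl.
      by have := ler_wpM2r (ltW K1) em; rewrite invfM mulrA divfK ?gt_eqF.
    by lra.
  apply: le_trans h _; rewrite ler_pM2l ?mulr_gt0//.
  have w0 := profile_gt0 cat Iq.
  have : omega (F q).2 ^+ 2 <= K by rewrite -Eq /enorm sqr_sqrtr ?dot_ge0.
  by move=> h1; nra.
have e10 : 0 < m / (2 * (K + 1)) by rewrite divr_gt0// mulr_gt0.
have [z1 [Iz1 hz1 _]] := main _ e10 (lexx _).
pose ze := k * (m / 2).
have kze : k * ze = m / 2 by rewrite /ze mulrA k2 mul1r.
have m20 : 0 < m / 2 by rewrite divr_gt0.
have I0 := profile_I0 cat.
have Ize : I ze.
  by rewrite /ze; case: hk hz1 => -> h; [apply: (profile_between cat I0 Iz1)|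
    apply: (profile_between cat Iz1 I0)]; lra.
have d0 := profile_derive1_0 cat.
have dl0 : 0 < k * derive1 omega ze.
  rewrite /ze in Ize *; case: hk Ize => -> Ize.
    rewrite !mul1r in Ize *.
    by rewrite -d0; apply: (profile_derive1_incr n2 cat I0 Ize).
  rewrite mulN1r oppr_gt0 -d0; apply: (profile_derive1_incr n2 cat Ize I0).
  by rewrite mulN1r oppr_lt0.
set dl := k * _ in dl0.
(* e2 is so small that 2 * e2 * (K + 1) <= dl / 2, where dl bounds k * omega' z
   below on the heights z with k * z >= m / 2 *)
pose e2 := Num.min (m / (2 * (K + 1))) (dl / (4 * (K + 1))).
have e20 : 0 < e2 by rewrite lt_min e10 divr_gt0// mulr_gt0.
have [z [Iz hz hdz]] : exists z, [/\ I z, m / 2 <= k * z &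
    k * derive1 omega z <= 2 * e2 * (K + 1)].
  by apply: main => //; rewrite ge_min lexx.
have : dl <= k * derive1 omega z.
  have mono x y : I x -> I y -> x <= y -> derive1 omega x <= derive1 omega y.
    move=> Ix Iy; rewrite le_eqVlt => /orP[/eqP->//|xy].
    exact/ltW/(profile_derive1_incr n2 cat Ix Iy).
  rewrite /dl /ze in Ize *; case: hk hz Ize => -> hz' Ize'.
    by rewrite !mul1r in hz' Ize' *; exact: mono.
  rewrite !mulN1r in hz' Ize' *; rewrite lerN2; apply: mono => //.
  by rewrite lerNr.
have : 2 * e2 * (K + 1) <= dl / 2.
  have h : e2 <= dl / (4 * (K + 1)) by rewrite ge_min lexx orbT.
  have := ler_wpM2r (ltW K1) h; rewrite invfM mulrA divfK ?gt_eqF// => h1.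
  by lra.
by lra.
Qed.

Lemma free_boundary_flat p : (F p).2 = 0 /\ dot (F p).1 (F p).1 <= omega 0 ^+ 2.
Proof.
have z0 q : (F q).2 = 0.
  have := @height_le0 1 q (or_introl erefl); have := @height_le0 (-1) q (or_intror erefl).
  by rewrite mul1r mulN1r oppr_le0 => h1 h2; apply/eqP; rewrite eq_le h1 h2.
split=> //; have [q hq] := phi_has_max 0 1.
have [[_ Eq] _] := phi_max_spec ltr01 hq.
have := hq p; rewrite /phi !mul0r !add0r !mul1r => /le_trans; apply.
by rewrite -(sqr_sqrtr (dot_ge0 (F q).1)) -/(enorm _) Eq z0.
Qed.

End Flatness.

(** * Local diffeomorphisms into a disk *)

Lemma dist_continuous (R : realType) (E : normedModType R) (w : E) :
  continuous (fun v : E => `|v - w|).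
Proof. by move=> v; apply: cvg_norm; apply: cvgB; [exact: cvg_id|exact: cvg_cst]. Qed.

Section SupNorm.
Context {R : realType} {n : nat}.
Implicit Types (v w : 'rV[R]_n).

Lemma coord_le_norm v i : `|v 0 i| <= `|v|.
Proof.
rewrite [leRHS]/Num.Def.normr /= mx_normrE.
exact: (le_bigmax _ (fun k : 'I_1 * 'I_n => `|v k.1 k.2|) (0, i)).
Qed.

Lemma norm_le_coord v c : 0 <= c -> (forall i, `|v 0 i| <= c) -> `|v| <= c.
Proof.
move=> c0 vc; rewrite /Num.Def.normr /= mx_normrE bigmax_le// => -[i j] _ /=.
by rewrite ord1.
Qed.

(** Comparison of the sup norm and of the Euclidean norm. *)
Lemma sqr_norm_le_dot v : `|v| ^+ 2 <= dot v v.
Proof.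
rewrite -[leRHS]sqr_sqrtr ?dot_ge0// ler_sqr ?nnegrE ?sqrtr_ge0//.
apply: norm_le_coord => [|i]; first exact: sqrtr_ge0.
rewrite -sqrtr_sqr ler_sqrt ?dot_ge0// /dot (bigD1 i)//= -expr2 lerDl.
by apply: sumr_ge0 => j _; rewrite -expr2 sqr_ge0.
Qed.

Lemma dot_le_sqr_norm v : dot v v <= n%:R * `|v| ^+ 2.
Proof.
rewrite -[n in n%:R]card_ord mulr_natl -sumr_const; apply: ler_sum => i _.
by rewrite -expr2 -real_normK ?num_real// ler_sqr ?nnegrE// coord_le_norm.
Qed.

Lemma norm_mulmx_le v (B : 'M[R]_n) : `|v *m B| <= `|v| * \sum_i \sum_j `|B i j|.
Proof.
apply: norm_le_coord => [|j].
  by rewrite mulr_ge0// sumr_ge0// => i _; rewrite sumr_ge0.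
rewrite mxE (le_trans (ler_norm_sum _ _ _))// mulr_sumr; apply: ler_sum => i _.
rewrite normrM ler_pM ?coord_le_norm// (bigD1 j)//= lerDl.
by rewrite sumr_ge0.
Qed.

End SupNorm.

Section LocalDiffeomorphism.
Context {R : realType} {n : nat}.
Variables (G : 'rV[R]_n -> 'rV[R]_n) (V : set 'rV[R]_n) (y : 'rV[R]_n).
Hypothesis oV : open V.
Hypothesis Vy : V y.
Hypothesis CG : forall i, Ck_on 1 V (fun x => G x 0 i).

(** The differential of [G] at [x] in the direction [v], taken coordinate by
    coordinate. *)
Definition differential (x v : 'rV[R]_n) : 'rV[R]_n := \row_i 'D_v (fun z => G z 0 i) x.

Hypothesis Ginj : forall v, differential y v = 0 -> v = 0.

(** The matrix of the differential, acting on row vectors: its rows are the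
    partial derivatives of [G]. *)
Definition jacobian_rows (x : 'rV[R]_n) : 'M[R]_n := \matrix_(j, i) 'D_(evec j) (fun z => G z 0 i) x.

Lemma differentialE x v : V x -> differential x v = v *m jacobian_rows x.
Proof.
move=> Vx; apply/rowP => i; rewrite [LHS]mxE [RHS]mxE (derive_coords _ oV Vx (CG i)).
by apply: eq_bigr => j _; rewrite [in RHS]mxE.
Qed.

(** Near [y], both [G] and its differentials expand distances at least by the
    factor [1 / L]; in particular [G] is injective there. *)
Lemma local_bound : exists2 r : R, 0 < r & exists2 L : R, 0 < L & [/\
  forall x, `|x - y| < r -> V x,
  forall x w, `|x - y| < r -> `|w - y| < r -> `|x - w| <= L * `|G x - G w| &
  forall x u, `|x - y| < r -> `|u| <= L * `|differential x u| ].
Proof.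
pose B := jacobian_rows y.
have uB : B \in unitmx.
  by apply: injective_unit => v vB; apply: Ginj; rewrite (differentialE _ Vy).
pose K := \sum_i \sum_j `|invmx B i j| + 1.
have K0 : 0 < K by rewrite ltr_wpDl// sumr_ge0// => i _; rewrite sumr_ge0.
have Kle (u : 'rV[R]_n) : `|u| <= K * `|u *m B|.
  have := norm_mulmx_le (u *m B) (invmx B); rewrite mulmxK// => /le_trans; apply.
  rewrite mulrC ler_wpM2r//.
  by rewrite /K lerDl.
(* eta absorbs the oscillation of the partial derivatives: K * n * eta <= 1/2 *)
pose eta : R := (2 * K * n.+1%:R)^-1.
have eta0 : 0 < eta by rewrite invr_gt0 !mulr_gt0.
have nearD : \forall x \near y, V x /\ forall i j,
    `|'D_(evec j) (fun z => G z 0 i) y - 'D_(evec j) (fun z => G z 0 i) x| <= eta.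
  apply: filterI; first exact: open_nbhs_nbhs.
  have nij i j : \forall x \near y,
      `|'D_(evec j) (fun z => G z 0 i) y - 'D_(evec j) (fun z => G z 0 i) x| <= eta.
    have c : {for y, continuous ('D_(evec j) (fun z => G z 0 i))}.
      exact: Ck_on_cont (Ck_on_derive (evec j) (CG i)) Vy.
    by have /cvgrPdist_le/(_ eta eta0) := c.
  have ni i : \forall x \near y, forall j,
      `|'D_(evec j) (fun z => G z 0 i) y - 'D_(evec j) (fun z => G z 0 i) x| <= eta.
    exact: filter_forall (nij i).
  exact: filter_forall ni.
have [r /= r0 hr] : nbhs_ball y (fun x => V x /\ forall i j,
    `|'D_(evec j) (fun z => G z 0 i) y - 'D_(evec j) (fun z => G z 0 i) x| <= eta).
  by apply/nbhs_ballP; exact: nearD.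
have hr' x : `|x - y| < r -> V x /\ forall i j,
    `|'D_(evec j) (fun z => G z 0 i) y - 'D_(evec j) (fun z => G z 0 i) x| <= eta.
  by move=> xy; apply: hr; rewrite -ball_normE /= distrC.
have est i (u xi : 'rV[R]_n) : `|xi - y| < r ->
    `|(u *m B) 0 i - 'D_u (fun z => G z 0 i) xi| <= n%:R * eta * `|u|.
  move=> /hr'[Vxi hxi]; rewrite (derive_coords _ oV Vxi (CG i)) mxE -sumrB.
  rewrite (le_trans (ler_norm_sum _ _ _))//.
  rewrite -mulrA -[n in n%:R]card_ord mulr_natl -sumr_const; apply: ler_sum => j _.
  rewrite [B j i]mxE -mulrBr normrM mulrC ler_pM ?coord_le_norm//.
have small (u : 'rV[R]_n) (t : R) : 0 <= t -> (forall i, `|(u *m B) 0 i| <= t + n%:R * eta * `|u|) -> `|u| <= 2 * K * t.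
  move=> t0 hu; have : `|u *m B| <= t + n%:R * eta * `|u|.
    by apply: norm_le_coord => //; rewrite addr_ge0// mulr_ge0// mulr_ge0// ltW.
  move=> h; have := le_trans (Kle u) (ler_wpM2l (ltW K0) h).
  have h2 : K * (n%:R * eta * `|u|) <= `|u| / 2.
    rewrite mulrA [leRHS]mulrC ler_wpM2r// /eta !invfM.
    have -> : K * (n%:R * (2^-1 / K / n.+1%:R)) = 2^-1 * (n%:R / n.+1%:R).
      by field; rewrite ?gt_eqF// -natr1 ?gt_eqF// ltr_wpDl.
    by rewrite ler_piMr// ler_pdivrMr// mul1r ler_nat.
  by rewrite mulrDr; lra.
exists r => //; exists (2 * K); first by rewrite mulr_gt0.
split=> [x /hr'[]//|x w xr wr|x u xr]; apply: small => //.
  move=> i.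
  have seg t : 0 <= t <= 1 -> `|t *: (x - w) + w - y| < r.
    move=> /andP[t0 t1].
    have -> : t *: (x - w) + w - y = t *: (x - y) + (1 - t) *: (w - y).
      rewrite scalerBl scale1r addrCA -addrA addrC -scalerBr.
      by rewrite opprB addrA subrK addrC.
    rewrite (le_lt_trans (ler_normD _ _))// !normrZ !ger0_norm ?subr_ge0//.
    have m1 : `|x - y| <= Num.max `|x - y| `|w - y| by rewrite le_max lexx.
    have m2 : `|w - y| <= Num.max `|x - y| `|w - y| by rewrite le_max lexx orbT.
    have m3 : Num.max `|x - y| `|w - y| < r by rewrite gt_max xr wr.
    apply: le_lt_trans m3; have t1' : 0 <= 1 - t by rewrite subr_ge0.
    have := lerD (ler_wpM2l t0 m1) (ler_wpM2l t1' m2).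
    by rewrite -mulrDl (addrC t) subrK mul1r.
  have [||t /andP[t0 t1] e] := @mean_value_line R _ (fun z => G z 0 i) w (x - w).
  - by move=> t t01; have [] := Ck_on_is_derive (x - w) (CG i) (hr' _ (seg t t01)).1.
  - by move=> t t01; apply: Ck_on_cont (CG i) (hr' _ (seg t t01)).1.
  have t01 : 0 <= t <= 1 by rewrite !ltW.
  have := est i (x - w) _ (seg t t01); rewrite -e subrK => h.
  have := ler_normD (((x - w) *m B) 0 i - (G x 0 i - G w 0 i)) (G x 0 i - G w 0 i).
  rewrite subrK => /le_trans; apply; rewrite addrC lerD//.
  by have := coord_le_norm (G x - G w) i; rewrite !mxE.
move=> i; have h := est i u x xr.
have := ler_normD ((u *m B) 0 i - 'D_u (fun z => G z 0 i) x) ('D_u (fun z => G z 0 i) x).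
rewrite subrK => /le_trans; apply; rewrite addrC lerD//.
by have := coord_le_norm (differential x u) i; rewrite mxE.
Qed.

Lemma differential_surjective L x : V x -> (forall u, `|u| <= L * `|differential x u|) ->
  forall d, exists w, differential x w = d.
Proof.
move=> Vx hL d; have uB : jacobian_rows x \in unitmx.
  apply: injective_unit => v vB; have := hL v; rewrite (differentialE _ Vx) vB normr0 mulr0.
  by rewrite normr_le0 => /eqP.
by exists (d *m invmx (jacobian_rows x)); rewrite (differentialE _ Vx) mulmxKV.
Qed.

(* squared distance from G x to p *)
Let sqdist (p x : 'rV[R]_n) : R := dot (G x - p) (G x - p).

Let coordB p x i : (G x - p) 0 i = G x 0 i + - p 0 i.
Proof. by rewrite !mxE. Qed.

Lemma Ck_on_sqdist p : Ck_on 1 V (sqdist p).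
Proof.
have C i : Ck_on 1 V (fun x => (G x - p) 0 i).
  apply: (Ck_on_ext oV (fun x _ => esym (coordB p x i))).
  exact: (Ck_onD oV (CG i) (Ck_on_cst 1 V (- p 0 i))).
have C2 i : Ck_on 1 V (fun x => (G x - p) 0 i * (G x - p) 0 i) := Ck_onM oV (C i) (C i).
exact: (Ck_on_sum oV C2).
Qed.

Lemma derive_sqdist p x v : V x -> 'D_v (sqdist p) x = 2 * dot (G x - p) (differential x v).
Proof.
move=> Vx; have d i : is_derive x v (fun z => (G z - p) 0 i) ('D_v (fun z => G z 0 i) x).
  rewrite (_ : (fun z => _) = (fun z => G z 0 i + - p 0 i)); last first.
    by apply/funext => z; exact: coordB.
  have := is_deriveD (Ck_on_is_derive v (CG i) Vx) (is_derive_cst (- p 0 i) x v).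
  by rewrite addr0.
have [_ e] := is_derive_sum_fun (fun i => is_deriveM (d i) (d i)).
apply: etrans e _; rewrite /dot mulr_sumr; apply: eq_bigr => i _.
by rewrite [differential x v 0 i]mxE /GRing.scale /= mulr_natl mulr2n.
Qed.

(** A local diffeomorphism at a point of the half-space that maps the half-space
    into the disk [dot q q <= r2] and the boundary hyperplane into the sphere is
    open as a map to the disk.  A point [q] of the disk near [G y] is attained at
    the minimum of the distance from [G x] to [q] over a small half-ball. *)
Lemma open_in_disk (r2 : R) : (0 < n)%N -> halfspace y ->
  (\forall x \near y, halfspace x -> dot (G x) (G x) <= r2) ->
  (\forall x \near y, dot x inward = 0 -> dot (G x) (G x) = r2) ->
  forall e, 0 < e -> exists2 d, 0 < d & forall q, dot q q <= r2 -> `|q - G y| < d ->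
    exists x, [/\ halfspace x, `|x - y| < e & G x = q].
Proof.
move=> n0 Hy hin hbd e e0; have [r r0 [L L0 [rV rL rD]]] := local_bound.
have [s0 /= s00 hs0] : nbhs_ball y (fun x => (halfspace x -> dot (G x) (G x) <= r2) /\
    (dot x inward = 0 -> dot (G x) (G x) = r2)).
  by apply/nbhs_ballP; exact: filterI.
pose m := Num.min e (Num.min r s0).
have m0 : 0 < m by rewrite !lt_min e0 r0 s00.
pose s := m / 2.
have sp : 0 < s by rewrite divr_gt0.
have : s < m by rewrite ltr_pdivrMr// ltr_pMr// ltr1n.
rewrite !lt_min => /and3P[se sr ss0].
have hs x : `|x - y| <= s -> (halfspace x -> dot (G x) (G x) <= r2) /\
    (dot x inward = 0 -> dot (G x) (G x) = r2).
  by move=> xs; apply: hs0; rewrite -ball_normE /= distrC (le_lt_trans xs).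
pose d := s / (L * n.+2%:R).
have d0 : 0 < d by rewrite divr_gt0// mulr_gt0.
exists d => // q q2 qd.
pose C : set 'rV[R]_n := [set x | `|x - y| <= s] `&` halfspace.
have cC : compact C.
  apply: bounded_closed_compact.
    exists (`|y| + s); split; first exact: num_real.
    move=> t ts x [xs _]; apply: le_trans (ltW ts).
    by rewrite -(subrK y x) addrC (le_trans (ler_normD _ _))// lerD2l.
  apply: closedI.
    apply: (@closed_comp _ _ (fun x : 'rV[R]_n => `|x - y|) [set t | t <= s]); last exact: closed_le.
    by move=> x _; exact: dist_continuous.
  apply: (@closed_comp _ _ (fun x : 'rV[R]_n => dot x inward) [set t | 0 <= t]); last exact: closed_ge.
  by move=> x _; exact: dot_continuous.
have C0 : C !=set0 by exists y; split=> //=; rewrite subrr normr0 ltW.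
have CV x : C x -> V x by move=> [xs _]; apply: rV; exact: le_lt_trans sr.
have cs : {within C, continuous (sqdist q)}.
  apply/subspace_continuousP => x Cx; apply: cvg_within_filter.
  exact: Ck_on_cont (Ck_on_sqdist q) (CV x Cx).
have [x /set_mem Cx xmin] := EVT_min_rV C0 cC cs.
have Vx := CV x Cx; have [xs Hx] := Cx.
(* The minimum is not on the spherical part of the boundary of the half-ball:
   there |G x - q| >= (n + 1) d in the sup norm, whereas its Euclidean length is
   at most that of G y - q, whose square is at most n d^2. *)
have xs' : `|x - y| < s.
  rewrite lt_neqAle xs andbT; apply/eqP => xse.
  have h1 : s <= L * `|G x - G y|.
    by rewrite -xse; apply: rL; rewrite ?subrr ?normr0// (le_lt_trans xs).
  have h2 : `|G x - G y| <= `|G x - q| + d.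
    rewrite -(subrK q (G x)) -addrA (le_trans (ler_normD _ _))//.
    by rewrite subrK lerD2l ltW.
  have h3 : n.+1%:R * d <= `|G x - q|.
    have : s / L <= `|G x - q| + d by apply: le_trans h2; rewrite ler_pdivrMr// mulrC.
    have -> : s / L = n.+2%:R * d.
      by rewrite /d invfM [RHS]mulrC [s * (_ * _)]mulrA divfK// pnatr_eq0.
    by rewrite -[n.+2%:R]natr1 mulrDl mul1r lerD2r.
  have h4 : sqdist q x <= sqdist q y by apply: xmin; rewrite inE; split=> //=; rewrite subrr normr0 ltW.
  have h5 : sqdist q y <= n%:R * d ^+ 2.
    apply: le_trans (dot_le_sqr_norm _) _; rewrite ler_wpM2l// ler_sqr ?nnegrE ?(ltW d0)//.
    by rewrite distrC ltW.
  have h6 : (n.+1%:R * d) ^+ 2 <= n%:R * d ^+ 2.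
    apply: le_trans h5; apply: le_trans h4; apply: le_trans (sqr_norm_le_dot _).
    by rewrite ler_sqr ?nnegrE// mulr_ge0// ltW.
  have d2 : 0 < d ^+ 2 by rewrite exprn_gt0.
  by move: h6; rewrite exprMn ler_pM2r// -natrX ler_nat -mulnn mulSn leqNgt ltnS leq_addr.
exists x; split=> //; first exact: lt_trans se.
have nx : \forall z \near x, `|z - y| < s.
  have c : (fun z : 'rV[R]_n => `|z - y|) @ x --> `|x - y|.
    exact: dist_continuous.
  exact: (cvgr_lt _ c _ xs').
have [w wq] : exists w, q = G x + w by exists (q - G x); rewrite addrC subrK.
pose psi := sqdist q.
have xr : `|x - y| < r by exact: lt_trans sr.
have [v vw] := differential_surjective Vx (fun u => rD x u xr) w.
have wE : G x - q = - w by rewrite wq opprD addrA subrr add0r.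
have Dpsi u : 'D_u psi x = - (2 * dot w (differential x u)).
  by rewrite (derive_sqdist _ _ Vx) wE dotNl mulrN.
pose npsi z := -1 * psi z.
have Cn : Ck_on 1 V npsi := Ck_onM oV (Ck_on_cst 1 V (-1 : R)) (Ck_on_sqdist q).
have Dn u : 'D_u npsi x = 2 * dot w (differential x u).
  have du := Ck_on_is_derive u (Ck_on_sqdist q) Vx.
  have [_ e1] := is_deriveM (is_derive_cst (-1 : R) x u) du.
  by apply: etrans e1 _; rewrite Dpsi scaler0 addr0 /GRing.scale /= mulN1r opprK.
have nmax : \forall z \near x, halfspace z -> npsi z <= npsi x.
  apply: filterS nx => z zs Hz; rewrite /npsi !mulN1r lerN2; apply: xmin.
  by rewrite inE; split=> //; exact: ltW.
suff w0 : dot w w = 0 by rewrite wq (dot_eq0 w0) addr0.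
have [x0|x0] := eqVneq (dot x inward) 0; last first.
  have xp : 0 < dot x inward by rewrite lt_def x0.
  have nH : \forall z \near x, 0 < dot z inward.
    by apply: (cvgr_gt _ (@dot_continuous R n inward x)).
  have : 'D_v npsi x = 0.
    apply: derive_eq0_max; first by have [] := Ck_on_is_derive v Cn Vx.
    have h : \forall z \near x, npsi z <= npsi x.
      by apply: filterS2 nmax nH => z hz z0; apply: hz; exact: ltW.
    exact: line_cvg _ h.
  by rewrite Dn vw => /eqP; rewrite mulf_eq0 pnatr_eq0 /= => /eqP.
(* At a point of the hyperplane, write v = a inward + t with t tangent; then
   2 |w|^2 = a b1 and 2 <G x, w> = a b2 with b1, b2 <= 0, while q in the disk
   gives 2 <G x, w> + |w|^2 <= 0; each sign of a yields w = 0. *)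
have [tan1 in1] := boundary_max oV Vx Cn x0 nmax.
have X2 : dot (G x) (G x) = r2 by have [_] := hs x xs; apply.
have nmax2 : \forall z \near x, halfspace z -> sqdist 0 z <= sqdist 0 x.
  apply: filterS nx => z zs Hz; rewrite /sqdist !subr0 X2.
  by have [h _] := hs z (ltW zs); exact: h.
have [tan2 in2] := boundary_max oV Vx (Ck_on_sqdist 0) x0 nmax2.
have D0 u : 'D_u (sqdist 0) x = 2 * dot (G x) (differential x u).
  by rewrite (derive_sqdist _ _ Vx) subr0.
have [t [t0 vE e1]] := derive_inward_split v oV Vx Cn n0.
have [t' [t'0 vE' e2]] := derive_inward_split v oV Vx (Ck_on_sqdist 0) n0.
have ii : 0 <= dot (@inward R n) inward by rewrite dot_inward_inward.
rewrite (tan1 t t0) addr0 in e1; rewrite (tan2 t' t'0) addr0 in e2.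
have i1 := in1 _ ii; have i2 := in2 _ ii.
rewrite Dn vw in e1; rewrite D0 vw in e2.
set a := dot v inward in e1 e2; set b1 := 'D_inward npsi x in e1 i1.
set b2 := 'D_inward (sqdist 0) x in e2 i2.
have qE : dot q q = r2 + 2 * dot (G x) w + dot w w.
  by rewrite wq dotDl [dot (G x) (_ + _)]dotC [dot w (_ + _)]dotC !dotDl X2 [dot w (G x)]dotC; ring.
have w0 := dot_ge0 w.
have h : 2 * dot (G x) w + dot w w <= 0 by lra.
have [a0|a0] := leP a 0.
  by have : 0 <= a * b2 := mulr_le0 a0 i2; lra.
by have : a * b1 <= 0 := mulr_ge0_le0 (ltW a0) i1; lra.
Qed.

End LocalDiffeomorphism.

(** * A flat hypersurface is the whole disk *)

Section HalfSpaceDerivative.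
Context {R : realType} {n : nat}.

(** Derivatives at a point of the half-space are determined by the values on
   the half-space. *)
Lemma halfspace_derive_eq0 (psi : 'rV[R]_n -> R) y v : (forall u, derivable psi y u) ->
  halfspace y -> (\forall x \near y, halfspace x -> psi x = 0) -> 'D_v psi y = 0.
Proof.
move=> dp Hy hz.
have inw u : 0 <= dot u inward -> 'D_u psi y = 0.
  move=> u0; have nz : \forall t \near (0:R)^'+, psi (t *: u + y) = 0.
    have h : \forall t \near (0:R)^'+, halfspace (t *: u + y) -> psi (t *: u + y) = 0.
      by apply: cvg_within; exact: line_cvg _ hz.
    near=> t; have t0 : 0 < t by [].
    have : halfspace (t *: u + y) -> psi (t *: u + y) = 0 by near: t; exact: h.
    by apply; rewrite /halfspace /= dotDl dotZl addr_ge0// mulr_ge0// ltW.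
  have psi0 : psi y = 0 by exact: nbhs_singleton hz Hy.
  have h1 : 'D_u psi y <= 0.
    by apply: derive_le0_right => //; apply: filterS nz => t ->; rewrite psi0.
  have h2 : 'D_u (- psi) y <= 0.
    apply: derive_le0_right; first exact: derivableN.
    by apply: filterS nz => t e; rewrite -[_ (_ + _)]/(- psi _) -[(- psi) y]/(- psi y) e psi0.
  by apply/eqP; rewrite eq_le h1 -oppr_le0 -deriveN.
have [v0|v0] := leP 0 (dot v inward); first exact: inw.
have : 'D_(-1 *: v) psi y = 0 by apply: inw; rewrite dotZl mulN1r oppr_ge0 ltW.
by rewrite derive_scaler// scaleN1r => /eqP; rewrite oppr_eq0 => /eqP.
Unshelve. all: by end_near. Qed.

End HalfSpaceDerivative.

Section Uniqueness.
Context {R : realType} {n : nat} {M : topologicalType}.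
Variables (I : set R) (omega : R -> R) (A : set (chart R n M)) (F : M -> ambient R n).
Hypothesis n2 : (2 <= n)%N.
Hypothesis cat : catenoid_profile n I omega.
Hypothesis hF : free_boundary_minimal_hypersurface I omega A F.

Let n0 : (0 < n)%N. Proof. exact: leq_trans n2. Qed.
Let at_ : smooth_atlas A. Proof. by have [] := hF. Qed.
Let mF : minimal_immersion A F. Proof. by have [] := hF. Qed.

Let f (p : M) : 'rV[R]_n := (F p).1.
Let D : set 'rV[R]_n := [set q | dot q q <= omega 0 ^+ 2].

Let fD p : D (f p). Proof. by have [] := free_boundary_flat n2 cat hF p. Qed.
Let F2 p : (F p).2 = 0. Proof. by have [] := free_boundary_flat n2 cat hF p. Qed.

(* In a chart, f is a map to which the local theory of diffeomorphisms applies. *)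
Let chart_diffeo c y : A c -> crange c y -> exists (g : 'rV[R]_n -> ambient R n) V,
  [/\ open V, V y, (forall i, Ck_on 1 V (fun x => (g x).1 0 i)),
      (forall v, differential (fun x => (g x).1) y v = 0 -> v = 0) &
      forall x, V x -> crange c x -> g x = F (cinv c x)].
Proof.
move=> Ac cy; have [g [V [oV Vy Sg gE lg]]] := local_repE mF Ac cy.
exists g, V; split=> // [i|v Dv]; first exact: (Ck_on_hcoord i oV (Sg 1%N)).
have [[_ im] _] := mF; apply: (im c y g Ac cy lg).
have dg u : derivable g y u by have [] := Ck_on_is_derive u (Sg 1%N) Vy.
apply: ambientP => [i|].
  rewrite -(derive_linear (linear_hcoord i) (@continuous_hcoord _ _ i) (dg v)).
  have := congr1 (fun w : 'rV[R]_n => w 0 i) Dv; rewrite mxE => e.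
  by apply: etrans e _; rewrite /hcoord !mxE.
rewrite -(derive_linear linear_vcoord continuous_vcoord (dg v)).
apply: halfspace_derive_eq0.
- by move=> u; have [] := Ck_on_is_derive u (Ck_on_vcoord oV (Sg 1%N)) Vy.
- exact: (crange_halfspace at_ Ac cy).
- have nV : \forall x \near y, V x by exact: open_nbhs_nbhs.
  apply: filterS2 nV (crange_near at_ Ac cy) => x Vx cx Hx.
  by rewrite /= /vcoord gE ?F2//; exact: cx.
Qed.

Let f_loc_inj (p : M) : exists2 W, nbhs p W & {in W &, injective f}.
Proof.
have [c [Ac cp ry pE]] := chart_at at_ p; set y := cmap c p in ry pE *.
have [g [V [oV Vy Cg Dinj gE]]] := chart_diffeo Ac ry.
have [r r0 [L L0 [rV rL _]]] := @local_bound _ _ (fun x => (g x).1) V y oV Vy Cg Dinj.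
have [_ ch _ _] := at_; have [oc _ cK _ [cc _]] := ch c Ac.
have ccp : {for p, continuous (cmap c)}.
  by move: cc; rewrite continuous_open_subspace// => h; apply: h; rewrite inE.
exists (cdom c `&` cmap c @^-1` [set x | `|x - y| < r]).
  apply: filterI; first exact: open_nbhs_nbhs.
  apply: ccp; apply: (cvgr_lt _ (@dist_continuous R _ y y)).
  by rewrite subrr normr0.
move=> a b; rewrite !inE => -[ca ra] [cb rb] fab.
have [Ra aE] := cK a ca; have [Rb bE] := cK b cb.
have : `|cmap c a - cmap c b| <= 0.
  apply: le_trans (rL _ _ ra rb) _.
  by rewrite !gE ?aE ?bE -/(f a) -/(f b) ?fab ?subrr ?normr0 ?mulr0//; exact: rV.
by rewrite normr_le0 subr_eq0 => /eqP e; rewrite -aE -bE e.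
Qed.

Let f_open (p : M) W : nbhs p W -> exists2 d : R, 0 < d &
  forall q, D q -> `|q - f p| < d -> exists2 p', W p' & f p' = q.
Proof.
move=> pW; have [c [Ac cp ry pE]] := chart_at at_ p; set y := cmap c p in ry pE *.
have [g [V [oV Vy Cg Dinj gE]]] := chart_diffeo Ac ry.
have [_ ch _ _] := at_; have [oc _ _ rK [_ ci]] := ch c Ac.
have nV : \forall x \near y, V x by exact: open_nbhs_nbhs.
have nr := crange_near at_ Ac ry.
have ni : \forall x \near y, crange c x -> W (cinv c x).
  have Wy : nbhs (cinv c y) W by rewrite pE.
  by move/subspace_continuousP : ci => /(_ y ry W Wy).
have [e /= e0 he] : nbhs_ball y (fun x => [/\ V x, halfspace x -> crange c x &
    crange c x -> W (cinv c x)]).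
  by apply/nbhs_ballP; apply: filterS3 nV nr ni => x Vx h1 h2; split.
have [||d d0 hd] := @open_in_disk _ _ (fun x => (g x).1) V y oV Vy Cg Dinj (omega 0 ^+ 2) n0 (crange_halfspace at_ Ac ry) _ _ e e0.
- apply: filterS2 nV nr => x Vx h1 Hx; rewrite gE//; last exact: h1.
  exact: fD.
- apply: filterS2 nV nr => x Vx h1 x0.
  have cx : crange c x by apply: h1; rewrite /halfspace /= x0.
  have [_ _ _ _ [Fb _]] := hF; have [dx xE] := rK x cx.
  have [_ Ex] : revolution I omega (F (cinv c x)).
    by apply: Fb; exists (cinv c x) => //; exists c; split => //; rewrite xE.
  by rewrite gE// -(sqr_sqrtr (dot_ge0 _)) -/(enorm _) Ex F2.
exists d => // q Dq qd.
have gy : (g y).1 = f p by rewrite gE// pE.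
have [|x [Hx xe xq]] := hd q Dq; first by rewrite gy.
have [Vx h1 h2] : [/\ V x, halfspace x -> crange c x & crange c x -> W (cinv c x)].
  by apply: he; rewrite -ball_normE /= distrC.
by exists (cinv c x); [exact/h2/h1|rewrite -xq gE//; exact: h1].
Qed.

(** Euclidean balls are convex. *)
Lemma dot_convex (a b : 'rV[R]_n) (t r : R) : dot a a <= r -> dot b b <= r -> 0 <= t <= 1 ->
  dot (a + t *: (b - a)) (a + t *: (b - a)) <= r.
Proof.
move=> ha hb /andP[t0 t1].
have hd := dot_ge0 (b - a).
have e : dot (a + t *: (b - a)) (a + t *: (b - a)) =
    (1 - t) * dot a a + t * dot b b - t * (1 - t) * dot (b - a) (b - a).
  by rewrite !dotE [dot b a]dotC; ring.
have t1' : 0 <= 1 - t by rewrite subr_ge0.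
have h1 := ler_wpM2l t1' ha; have h2 := ler_wpM2l t0 hb.
have h3 := mulr_ge0 (mulr_ge0 t0 t1') hd.
by rewrite e; lra.
Qed.

(** A free boundary minimal hypersurface is embedded onto the flat disk. *)
Lemma hypersurface_is_disk : injective F /\ range F = flat_disk omega.
Proof.
have [_ [cM coM] [p0 _] _ _] := hF.
have [hM _ _ _] := at_.
have w0 : 0 < omega 0 := profile_gt0 cat (profile_I0 cat).
have cf : continuous f.
  move=> p; apply: (@continuous_comp _ _ _ F fst); last exact: cvg_fst.
  exact: (hypersurface_continuous at_ mF).
have nD q : D q -> `|q| <= omega 0.
  move=> Dq; rewrite -(ler_sqr (x := `|q|)) ?nnegrE ?(ltW w0)//.
  exact: le_trans (sqr_norm_le_dot q) Dq.
have hK b : D b -> `|b - f p0| <= omega 0 + omega 0.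
  move=> Db; rewrite (le_trans (ler_normB _ _))// lerD//; apply: nD => //.
have convD a b t : D a -> D b -> 0 <= t <= 1 -> D (a + t *: (b - a)).
  by move=> ? ? ?; exact: dot_convex.
have [finj fsurj] := covering_convex_bijective hM cM coM cf fD convD f_loc_inj f_open hK.
split; first by move=> p q e; apply: finj; rewrite /f e.
apply/seteqP; split=> [_ [p _ <-]|q [q2 hq]].
  split; first exact: F2.
  rewrite -(ler_sqr (x := enorm _)) ?nnegrE ?sqrtr_ge0 ?(ltW w0)//.
  by rewrite /enorm sqr_sqrtr ?dot_ge0//; exact: fD.
have : D q.1.
  rewrite /D /= -[leLHS]sqr_sqrtr ?dot_ge0// -/(enorm _).
  by rewrite ler_sqr ?nnegrE ?sqrtr_ge0// ltW.
rewrite -fsurj => -[p _ pq]; exists p => //.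
by case: q pq q2 {hq} => q1 q2 /= <- ->; rewrite [LHS]surjective_pairing F2.
Qed.

End Uniqueness.

(** * The Cayley transform of the half-space *)

Section Inversion.
Context {R : realType} {n : nat}.
Implicit Types (a h v w y : 'rV[R]_n).

(** The inversion in the sphere of radius sqrt 2 centred at the origin. *)
Definition inversion a : 'rV[R]_n := (2 / dot a a) *: a.

Lemma dot_inversion a : dot a a != 0 -> dot (inversion a) (inversion a) = 4 / dot a a.
Proof. by move=> a0; rewrite /inversion !dotE; field. Qed.

Lemma inversionK a : dot a a != 0 -> inversion (inversion a) = a.
Proof.
move=> a0; rewrite {1}/inversion dot_inversion// /inversion scalerA.
by rewrite (_ : _ * _ = 1) ?scale1r//; field.
Qed.

Lemma Ck_on_affine k (V : set 'rV[R]_n) (f : 'rV[R]_n -> 'rV[R]_n) (c : R) b :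
  open V -> Ck_on k V f -> Ck_on k V (fun y => c *: f y + b).
Proof.
move=> oV Cf; apply: Ck_on_rV => // i.
have C : Ck_on k V (fun y => c * f y 0 i + b 0 i).
  exact: (Ck_onD oV (Ck_onM oV (Ck_on_cst k V c) (Ck_on_row_coord i oV Cf)) (Ck_on_cst k V (b 0 i))).
by apply: (Ck_on_ext oV _ C) => y _; rewrite !mxE.
Qed.

Lemma Ck_on_inversion k (V : set 'rV[R]_n) (f : 'rV[R]_n -> 'rV[R]_n) :
  open V -> (forall y, V y -> dot (f y) (f y) != 0) -> Ck_on k V f ->
  Ck_on k V (fun y => inversion (f y)).
Proof.
move=> oV f0 Cf; apply: Ck_on_rV => // i.
have Ci : Ck_on k V (GRing.inv \o (fun y => dot (f y) (f y))).
  exact: (@Ck_on_chain R _ k V [set x | x != 0] GRing.inv (fun y => dot (f y) (f y)) oV f0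
    (Ck_on_inv k) (Ck_on_dotself oV Cf)).
have C : Ck_on k V (fun y => 2 * (GRing.inv \o (fun y => dot (f y) (f y))) y * f y 0 i).
  exact: (Ck_onM oV (Ck_onM oV (Ck_on_cst k V (2 : R)) Ci) (Ck_on_row_coord i oV Cf)).
by apply: (Ck_on_ext oV _ C) => y _; rewrite mxE.
Qed.

Lemma open_neq0_on (V : set 'rV[R]_n) (f : 'rV[R]_n -> R) : open V -> Ck_on 0 V f ->
  open [set y | V y /\ f y != 0].
Proof.
move=> oV Cf; rewrite openE => y [Vy fy]; rewrite /interior.
have n1 : \forall x \near y, V x by exact: open_nbhs_nbhs.
have n2 : \forall x \near y, f x != 0.
  have c : f @ y --> f y := Ck_on_cont Cf Vy.
  have : nbhs (f y) [set x | x != 0] by apply: open_nbhs_nbhs; split=> //; exact: open_neq0.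
  by move/c.
by apply: filterS2 n1 n2 => x; split.
Qed.

End Inversion.

Section Cayley.
Context {R : realType} {n : nat}.
Hypothesis n0 : (0 < n)%N.
Implicit Types (h v y : 'rV[R]_n).

Local Notation e := (@inward R n).

Let ee : dot e e = 1. Proof. exact: dot_inward_inward. Qed.

(** The Cayley transform maps the half-space onto the closed unit ball minus the
    pole [inward], and 0 to the opposite pole.  The scalars 1 and -1 give its
    affine factors the shape [c *: f y + b] of [Ck_on_affine]. *)
Definition cayley y : 'rV[R]_n := -1 *: inversion (1 *: y + e) + e.

(** The inverse of [cayley], defined away from the pole. *)
Definition cayley_inv h : 'rV[R]_n := -1 *: inversion (1 *: h + - e) + - e.

(** The domain of the Cayley transform, all the points but [- inward]. *)
Definition cayley_dom : set 'rV[R]_n := [set y | dot (1 *: y + e) (1 *: y + e) != 0].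

Lemma open_cayley_dom : open cayley_dom.
Proof.
have oT : open [set: 'rV[R]_n] by exact: openT.
have C : Ck_on 0 setT (fun y => dot (1 *: y + e) (1 *: y + e)).
  exact: (Ck_on_dotself oT (Ck_on_affine 1 e oT (Ck_on_id 0 oT))).
have := open_neq0_on oT C; congr open.
by apply/seteqP; split=> y => [[]//|].
Qed.

Lemma Ck_on_cayley k : Ck_on k cayley_dom cayley.
Proof.
have o := open_cayley_dom; apply: Ck_on_affine => //.
apply: Ck_on_inversion => //.
by apply: Ck_on_affine => //; exact: Ck_on_id.
Qed.

Lemma halfspace_cayley_dom y : halfspace y -> cayley_dom y.
Proof.
move=> Hy; rewrite /cayley_dom /= !dotE ee; apply: lt0r_neq0.
by have := dot_ge0 y; move: Hy; rewrite /halfspace /= [dot e y]dotC => h1 h2; lra.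
Qed.

Lemma dot_cayley y : cayley_dom y ->
  dot (cayley y) (cayley y) = 1 - 4 * dot y e / dot (1 *: y + e) (1 *: y + e).
Proof.
move=> y0; rewrite /cayley; set a := 1 *: y + e in y0 *.
have ae : dot a e = dot y e + 1 by rewrite /a dotDl dotZl mul1r ee.
have a0 : dot a a != 0 := y0; clearbody a.
have h1 : dot (inversion a) (inversion a) = 4 / dot a a by rewrite dot_inversion.
have h2 : dot (inversion a) e = 2 / dot a a * (dot y e + 1) by rewrite dotZl ae.
move: (inversion a) h1 h2 => b h1 h2.
by rewrite !dotE ee [dot e b]dotC h1 h2; field.
Qed.

Lemma cayleyK y : cayley_dom y -> cayley_inv (cayley y) = y.
Proof.
move=> y0; rewrite /cayley_inv /cayley !scale1r addrK !scaleN1r.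
have -> : inversion (- inversion (y + e)) = - inversion (inversion (y + e)).
  by rewrite {1}/inversion dotNl dotNr opprK scalerN.
rewrite inversionK; last by move: y0; rewrite /cayley_dom /= scale1r.
by rewrite opprK addrK.
Qed.

Lemma cayley_invK h : dot (1 *: h + - e) (1 *: h + - e) != 0 -> cayley (cayley_inv h) = h.
Proof.
move=> h0; rewrite /cayley /cayley_inv !scale1r subrK !scaleN1r.
have -> : inversion (- inversion (h - e)) = - inversion (inversion (h - e)).
  by rewrite {1}/inversion dotNl dotNr opprK scalerN.
rewrite inversionK; last by move: h0; rewrite scale1r.
by rewrite opprK subrK.
Qed.

Lemma dot_cayley_inv h : dot (1 *: h + - e) (1 *: h + - e) != 0 ->
  dot (cayley_inv h) e = (1 - dot h h) / dot (1 *: h + - e) (1 *: h + - e).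
Proof.
move=> h0; rewrite /cayley_inv /inversion; move: h0; set Q := dot _ _ => h0.
have QE : Q = dot h h - 2 * dot h e + 1.
  by rewrite /Q !dotE ee [dot e h]dotC; ring.
clearbody Q.
rewrite !dotE ee; apply: (mulIf h0); rewrite divfK//.
have -> : dot h h = Q + 2 * dot h e - 1 by rewrite QE; ring.
by field.
Qed.

(** The pole is not attained. *)
Lemma cayley_neq y : cayley_dom y -> dot (1 *: cayley y + - e) (1 *: cayley y + - e) != 0.
Proof.
move=> y0; rewrite scale1r /cayley addrK dotZl dotZr mulrA mulrNN !mul1r dot_inversion//.
by rewrite mulf_neq0// invr_neq0.
Qed.

(** The differential of the Cayley transform: the reflection in the line spanned
    by [a = y + e], composed with the homothety of ratio [2 / |a|^2]. *)
Definition dcayley y v : 'rV[R]_n :=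
  let a := 1 *: y + e in (2 / dot a a) *: ((2 * dot a v / dot a a) *: a - v).

Lemma is_derive_cayley y v i : cayley_dom y ->
  is_derive y v (fun x => cayley x 0 i) (dcayley y v 0 i).
Proof.
move=> y0; have addE (u w : 'rV[R]_n) : (u + w) 0 i = u 0 i + w 0 i by rewrite mxE.
have scaleE (c : R) (u : 'rV[R]_n) : (c *: u) 0 i = c * u 0 i by rewrite mxE.
have oppE (u : 'rV[R]_n) : (- u) 0 i = - u 0 i by rewrite mxE.
pose a x : 'rV[R]_n := 1 *: x + e; pose N x := dot (a x) (a x).
have N0 : N y != 0 := y0.
have oD := open_cayley_dom.
have dc := Ck_on_is_derive v (Ck_on_row_coord i oD (Ck_on_cayley 1)) y0.
suff de : 'D_v (fun x => cayley x 0 i) y = dcayley y v 0 i by rewrite -de.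
set t := 'D_v _ y in dc *.
have da j : is_derive y v (fun x => x 0 j + e 0 j) (v 0 j).
  by have := is_deriveD (is_derive_coord j y v) (is_derive_cst (e 0 j) y v); rewrite addr0.
have dN : is_derive y v N (2 * dot (a y) v).
  have h := is_derive_sum_fun (fun j => is_deriveM (da j) (da j)).
  have -> : N = (fun x => \sum_j (x 0 j + e 0 j) * (x 0 j + e 0 j)).
    by apply/funext => x; apply: eq_bigr => j _; rewrite !mxE mul1r.
  apply: is_derive_eq h _; rewrite /dot mulr_sumr; apply: eq_bigr => j _.
  by rewrite /GRing.scale /= !mxE mul1r mulr_natl mulr2n.
have d1 := is_deriveM dN (is_deriveB (is_derive_cst (e 0 i) y v) dc).
have [_ e1] := d1.
have d2 := is_deriveM (is_derive_cst (2 : R) y v) (da i).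
have [_ e2] := d2.
(* the derivative is obtained from the polynomial relation N (e - cayley) = 2 a *)
have rel x : cayley_dom x -> N x * (e 0 i - cayley x 0 i) = 2 * (x 0 i + e 0 i).
  move=> x0; have cE : cayley x 0 i = - (2 / N x * (x 0 i + e 0 i)) + e 0 i.
    by rewrite /cayley /inversion addE scaleE scaleE addE scaleE mulN1r mul1r.
  have Nx : N x != 0 := x0.
  by rewrite cE; field.
have e3 : N y * (0 - t) + (e 0 i - cayley y 0 i) * (2 * dot (a y) v) =
    2 * v 0 i + (y 0 i + e 0 i) * 0.
  apply: etrans (esym e1) _; apply: etrans _ e2.
  apply: near_eq_derive; have : \forall x \near y, cayley_dom x by exact: open_nbhs_nbhs.
  by apply: filterS => x; exact: rel.
have ai : a y 0 i = y 0 i + e 0 i by rewrite addE scaleE mul1r.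
have dE : dcayley y v 0 i = 2 / N y * (2 * dot (a y) v / N y * (y 0 i + e 0 i) - v 0 i).
  rewrite /dcayley -/(a y) -/(N y) scaleE addE scaleE oppE ai.
  by [].
rewrite dE; have r := rel y y0; apply: (mulfI N0); apply: (mulfI N0).
have -> : N y * (N y * t) = N y * (e 0 i - cayley y 0 i) * (2 * dot (a y) v) - N y * (2 * v 0 i).
  by move: e3; rewrite mulr0 addr0 => e3; rewrite -e3; ring.
by rewrite r; field.
Qed.

Lemma dcayley_inj y v : cayley_dom y -> dcayley y v = 0 -> v = 0.
Proof.
move=> y0; rewrite /dcayley; set a := 1 *: y + e in y0 *.
have N0 : dot a a != 0 := y0.
move=> /eqP; rewrite scaler_eq0 mulf_eq0 invr_eq0 (negbTE N0) pnatr_eq0 /= subr_eq0 => /eqP vE.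
have : dot a v = 2 * dot a v by rewrite -{1}vE dotZr divfK.
move=> h; have av : dot a v = 0 by lra.
by rewrite -vE av mulr0 mul0r scale0r.
Qed.

Lemma dcayley_surj y v : cayley_dom y -> exists w, dcayley y w = v.
Proof.
move=> y0; pose a := 1 *: y + e; have N0 : dot a a != 0 := y0.
exists ((dot a a / 2) *: ((2 * dot a v / dot a a) *: a - v)).
rewrite /dcayley -/a; set w := _ - v.
have aw : dot a w = dot a v by rewrite /w dotDr dotNr dotZr divfK//; ring.
rewrite dotZr aw (_ : 2 * (dot a a / 2 * dot a v) / dot a a = dot a v); last by field.
rewrite scalerBr !scalerA (_ : 2 / dot a a * (dot a a / 2) = 1); last by field.
by rewrite scale1r /w mulrAC opprB addrC subrK.
Qed.

(** The Cayley transform maps the inward normal of the half-space to an inward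
    normal of the ball. *)
Lemma dcayley_inward y : cayley_dom y -> dot y e = 0 ->
  dot (dcayley y e) (cayley y) = - (2 / dot (1 *: y + e) (1 *: y + e)).
Proof.
move=> y0 ye; set a := 1 *: y + e; have N0 : dot a a != 0 := y0.
have ae : dot a e = 1 by rewrite /a dotDl dotZl mul1r ee ye add0r.
have -> : dcayley y e = - (2 / dot a a) *: cayley y.
  rewrite /dcayley -/a ae mulr1 scaleNr -scalerN /cayley -/a scaleN1r /inversion.
  by rewrite opprD opprK.
by rewrite dotZl dot_cayley// ye mulr0 mul0r subr0 mulr1.
Qed.

End Cayley.

(** * The flat disk *)

Section Disk.
Context {R : realType} {n : nat}.
Variable r : R.
Hypothesis n0 : (0 < n)%N.
Hypothesis r0 : 0 < r.

(** The underlying type of the closed disk of radius [r]. *)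
Definition disk_points := {x : 'rV[R]_n | dot x x <= r ^+ 2}.

(** The closed disk with the topology induced by R^n. *)
Definition disk : topologicalType := initial_topology (val : disk_points -> 'rV[R]_n).

(** A point of the disk as a point of R^n. *)
Definition disk_val (p : disk) : 'rV[R]_n := val (p : disk_points).

Lemma disk_val_inj : injective disk_val.
Proof. exact: val_inj. Qed.

Lemma disk_val_continuous : continuous disk_val.
Proof. exact: initial_continuous. Qed.

Lemma disk_valP p : dot (disk_val p) (disk_val p) <= r ^+ 2.
Proof. exact: (valP (p : disk_points)). Qed.

Let zero_disk : dot (0 : 'rV[R]_n) 0 <= r ^+ 2.
Proof. by rewrite /dot big1 ?sqr_ge0// => i _; rewrite mxE mul0r. Qed.

(** The retraction of R^n to the disk with the default value 0 outside. *)
Definition to_disk (x : 'rV[R]_n) : disk := insubd (exist _ 0 zero_disk : disk_points) x.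

Lemma to_diskK x : dot x x <= r ^+ 2 -> disk_val (to_disk x) = x.
Proof. by move=> hx; rewrite /disk_val /to_disk val_insubd hx. Qed.

Lemma disk_valK p : to_disk (disk_val p) = p.
Proof. by apply: disk_val_inj; rewrite to_diskK//; exact: disk_valP. Qed.

Lemma to_disk_continuous (X : topologicalType) (A : set X) (f : X -> 'rV[R]_n) :
  (forall x, A x -> dot (f x) (f x) <= r ^+ 2) -> {within A, continuous f} ->
  {within A, continuous (to_disk \o f)}.
Proof.
move=> fD /subspace_continuousP cf; apply/subspace_continuousP => x Ax W.
move=> [_ [/= [B oB <-] Bx] BW].
have Bf : nbhs (f x) B.
  by apply: open_nbhs_nbhs; split=> //; move: Bx; rewrite /= -/(disk_val _) to_diskK//; exact: fD.
have h : \forall z \near x, A z -> B (f z) := cf x Ax B Bf.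
suff : \forall z \near x, A z -> W (to_disk (f z)) by [].
apply: filterS h => z hz Az.
apply: BW; rewrite /= -/(disk_val _) to_diskK; first exact: hz.
exact: fD.
Qed.

Let D : set 'rV[R]_n := [set x | dot x x <= r ^+ 2].

Let disk_image : [set: disk] = to_disk @` D.
Proof.
apply/seteqP; split=> // p _; exists (disk_val p); first exact: disk_valP.
exact: disk_valK.
Qed.

Let to_disk_within : {within D, continuous to_disk}.
Proof.
apply: (@to_disk_continuous _ D id) => //.
by apply: continuous_subspaceT => x; exact: cvg_id.
Qed.

Lemma disk_norm_le p : `|disk_val p| <= r.
Proof.
rewrite -(ler_sqr (x := `|_|)) ?nnegrE ?(ltW r0)//.
exact: le_trans (sqr_norm_le_dot _) (disk_valP p).
Qed.

Lemma disk_compact : compact [set: disk].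
Proof.
rewrite disk_image; apply: continuous_compact; first exact: to_disk_within.
apply: bounded_closed_compact.
  exists r; split; first exact: num_real.
  move=> t rt x Dx; apply: le_trans (ltW rt).
  by rewrite -(to_diskK Dx); exact: disk_norm_le.
apply: (@closed_comp _ _ (fun x : 'rV[R]_n => dot x x) [set t | t <= r ^+ 2]); last exact: closed_le.
have oT : open [set: 'rV[R]_n] by exact: openT.
by move=> x _; exact: (Ck_on_cont (Ck_on_dotself oT (Ck_on_id 0 oT))).
Qed.

Lemma disk_connected : connected [set: disk].
Proof.
rewrite disk_image; apply: connected_continuous_connected; last exact: to_disk_within.
by apply: segment_convex_connected => a b t Da Db t01; exact: dot_convex.
Qed.

Lemma disk_hausdorff : hausdorff_space disk.
Proof.
rewrite open_hausdorff => p q pq.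
have vpq : disk_val p != disk_val q by apply: contra pq => /eqP /disk_val_inj ->.
have : hausdorff_space 'rV[R]_n by exact: norm_hausdorff.
rewrite open_hausdorff => /(_ _ _ vpq)[[U W] /= [/set_mem Up /set_mem Wq] [oU oW /eqP UW]].
exists (disk_val @^-1` U, disk_val @^-1` W) => /=.
  by split; apply/mem_set.
split.
- by apply: open_comp => // x _; exact: disk_val_continuous.
- by apply: open_comp => // x _; exact: disk_val_continuous.
- by apply/eqP/seteqP; split=> // x [Ux Wx]; have : (U `&` W) (disk_val x) by []; rewrite UW.
Qed.

Let sg (b : bool) : R := (-1) ^+ b.

Let sgsg b : sg b * sg b = 1.
Proof. by rewrite /sg; case: b; rewrite ?expr1 ?expr0 ?mulrNN mulr1. Qed.

Let e : 'rV[R]_n := inward.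

(* The denominator of the inverse of the Cayley transform; it vanishes only at the
   pole. *)
Let Q (h : 'rV[R]_n) : R := dot (1 *: h + - e) (1 *: h + - e).

(** Two charts, each of which misses one pole of the disk; their ranges are the
    whole half-space. *)
Definition disk_chart (b : bool) : chart R n disk :=
  Chart [set p | Q ((sg b / r) *: disk_val p) != 0] halfspace
    (fun p => cayley_inv ((sg b / r) *: disk_val p))
    (fun y => to_disk ((sg b * r) *: cayley y)).

(** The charts that miss the pole [r *: inward] and its opposite. *)
Definition disk_atlas : set (chart R n disk) := [set disk_chart b | b in setT].

Let r_unit : r != 0. Proof. by rewrite gt_eqF. Qed.

Let scale_cancel b (x : 'rV[R]_n) : (sg b / r) *: ((sg b * r) *: x) = x.
Proof. by rewrite scalerA mulrACA sgsg mul1r mulVf// scale1r. Qed.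

Let scale_cancel' b (x : 'rV[R]_n) : (sg b * r) *: ((sg b / r) *: x) = x.
Proof. by rewrite scalerA mulrACA sgsg mul1r mulfV// scale1r. Qed.

Let dot_scale b (x : 'rV[R]_n) : dot ((sg b * r) *: x) ((sg b * r) *: x) = r ^+ 2 * dot x x.
Proof. by rewrite dotZl dotZr mulrA mulrACA sgsg mul1r expr2. Qed.

Lemma halfspace_cayley_le1 (y : 'rV[R]_n) : halfspace y -> dot (cayley y) (cayley y) <= 1.
Proof.
move=> Hy; have y0 := halfspace_cayley_dom n0 Hy.
rewrite (dot_cayley n0 y0) lerBlDr lerDl divr_ge0//; last exact: dot_ge0.
by rewrite mulr_ge0.
Qed.

Let in_disk b (y : 'rV[R]_n) : halfspace y -> dot ((sg b * r) *: cayley y) ((sg b * r) *: cayley y) <= r ^+ 2.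
Proof.
move=> Hy; rewrite dot_scale ler_piMr ?sqr_ge0//.
exact: halfspace_cayley_le1.
Qed.

Lemma disk_chart_val b y : halfspace y ->
  disk_val (cinv (disk_chart b) y) = (sg b * r) *: cayley y.
Proof. by move=> Hy; rewrite to_diskK//; exact: in_disk. Qed.

Let oQ b : open [set x : 'rV[R]_n | Q ((sg b / r) *: x) != 0].
Proof.
have oT : open [set: 'rV[R]_n] by exact: openT.
have C : Ck_on 0 setT (fun x : 'rV[R]_n => Q ((sg b / r) *: x + 0)).
  exact: (Ck_on_dotself oT (Ck_on_affine 1 (- e) oT (Ck_on_affine (sg b / r) 0 oT (Ck_on_id 0 oT)))).
have := open_neq0_on oT C; congr open.
by apply/seteqP; split=> x /=; rewrite addr0; [case|].
Qed.

Lemma disk_is_chart b : is_chart (disk_chart b).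
Proof.
split=> /=.
- apply: (@open_comp _ _ disk_val [set x | Q ((sg b / r) *: x) != 0]); last exact: oQ.
  by move=> x _; exact: disk_val_continuous.
- by exists setT; [exact: openT|rewrite setTI].
- move=> p hp; split; last first.
    by rewrite (cayley_invK hp) scale_cancel' disk_valK.
  rewrite /halfspace /= (dot_cayley_inv n0 hp) divr_ge0 ?dot_ge0// subr_ge0.
  rewrite -(ler_pM2l (x := r ^+ 2)) ?exprn_gt0// -(dot_scale b) scale_cancel' mulr1.
  exact: disk_valP.
- move=> y Hy; rewrite disk_chart_val// scale_cancel; split.
    exact/cayley_neq/halfspace_cayley_dom.
  exact/cayleyK/halfspace_cayley_dom.
- split.
    apply/subspace_continuousP => p hp; apply: cvg_within_filter.
    apply: (@continuous_comp _ _ _ disk_val (fun x => cayley_inv ((sg b / r) *: x))).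
      exact: disk_val_continuous.
    have C1 := Ck_on_affine 1 (- e) (@oQ b) (Ck_on_affine (sg b / r) 0 (@oQ b) (Ck_on_id 0 (@oQ b))).
    have q0 y : Q ((sg b / r) *: y) != 0 -> Q ((sg b / r) *: y + 0) != 0 by rewrite addr0.
    have C2 := Ck_on_inversion (@oQ b) q0 C1.
    have C := Ck_on_affine (-1) (- e) (@oQ b) C2.
    have C' := Ck_on_ext (g := fun x => cayley_inv ((sg b / r) *: x)) (@oQ b) _ C.
    apply: (Ck_on_cont (C' _) hp) => x _.
    by rewrite addr0.
  apply: (@to_disk_continuous _ halfspace (fun y => (sg b * r) *: cayley y)).
    by move=> y; exact: in_disk.
  apply/subspace_continuousP => y Hy; apply: cvg_within_filter.
  have C := Ck_on_affine (sg b * r) 0 (@open_cayley_dom R n) (Ck_on_cayley 0).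
  have C' := Ck_on_ext (g := fun y : 'rV[R]_n => (sg b * r) *: cayley y) (@open_cayley_dom R n) _ C.
  apply: (Ck_on_cont (C' _) (halfspace_cayley_dom n0 Hy)) => x _.
  by rewrite addr0.
Qed.

Lemma disk_smooth_atlas : smooth_atlas disk_atlas.
Proof.
split.
- exact: disk_hausdorff.
- by move=> _ [b _ <-]; exact: disk_is_chart.
- move=> p; have [h|h] := eqVneq (Q ((sg false / r) *: disk_val p)) 0; last first.
    by exists (disk_chart false); first by exists false.
  exists (disk_chart true); first by exists true.
  rewrite /= ; apply/eqP => h'.
  have v1 : 1 *: ((sg false / r) *: disk_val p) + - e = 0 by exact: dot_eq0.
  have v2 : 1 *: ((sg true / r) *: disk_val p) + - e = 0 by exact: dot_eq0.
  have ee : e = 0.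
    have : (1 *: ((sg false / r) *: disk_val p) + - e) + (1 *: ((sg true / r) *: disk_val p) + - e) = 0.
      by rewrite v1 v2 addr0.
    rewrite /sg expr0 expr1 !scale1r mulN1r mul1r scaleNr addrACA subrr add0r -opprD => /eqP.
    by rewrite oppr_eq0 -mulr2n -scaler_nat scaler_eq0 pnatr_eq0 /= => /eqP.
  have : dot e e = 1 := dot_inward_inward n0.
  rewrite ee /dot big1 => [/eqP|i _]; last by rewrite mxE mul0r.
  by rewrite eq_sym oner_eq0.
- move=> _ _ [b _ <-] [b' _ <-] y [Hy /= hy].
  pose k := (sg b' / r) * (sg b * r).
  have kE z : k *: cayley z + 0 = (sg b' / r) *: ((sg b * r) *: cayley z) by rewrite addr0 scalerA.
  have oD := @open_cayley_dom R n.
  have Ck_h m := Ck_on_affine k 0 oD (Ck_on_cayley m).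
  pose V := [set z | cayley_dom z /\ Q (k *: cayley z + 0) != 0].
  have oV : open V := open_neq0_on oD (Ck_on_dotself oD (Ck_on_affine 1 (- e) oD (Ck_h 0%N))).
  exists (fun z => cayley_inv (k *: cayley z + 0)); exists V; split=> //.
  - split; first exact: halfspace_cayley_dom.
    by rewrite kE -disk_chart_val.
  - move=> m; apply: (Ck_on_affine _ _ oV); apply: (Ck_on_inversion oV).
      by move=> z [].
    apply: (Ck_on_affine _ _ oV); apply: Ck_onS (Ck_h m).
    by move=> z [].
  - move=> z _ [Hz _]; rewrite kE /=; congr cayley_inv; congr (_ *: _).
    exact: esym (disk_chart_val b Hz).
Qed.

(** The inclusion of the disk in the hyperplane [z = 0]. *)
Definition disk_map (p : disk) : ambient R n := (disk_val p, 0).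

Lemma disk_smooth_within b : smooth_within halfspace (disk_map \o cinv (disk_chart b)).
Proof.
move=> y Hy; have oD := @open_cayley_dom R n.
exists (fun z => ((sg b * r) *: cayley z + 0, 0)); exists cayley_dom; split=> //.
- exact: halfspace_cayley_dom.
- move=> m; apply: Ck_on_pair => //; last exact: Ck_on_cst.
  exact: (Ck_on_affine _ _ oD (Ck_on_cayley m)).
- by move=> z _ Hz; rewrite addr0 /= /disk_map disk_chart_val.
Qed.

(** Local representatives of the inclusion are only prescribed on the half-space,
    but this determines their derivatives. *)
Lemma disk_rep_derive b y (g : 'rV[R]_n -> ambient R n) v : halfspace y ->
  local_rep disk_map (disk_chart b) y g ->
  'D_v g y = ((sg b * r) *: dcayley y v, 0).
Proof.
move=> Hy [V [oV Vy Sg gE]].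
have y0 := halfspace_cayley_dom n0 Hy.
have oD := @open_cayley_dom R n.
have dg u : derivable g y u by have [] := Ck_on_is_derive u (Sg 1%N) Vy.
have nV : \forall x \near y, V x by exact: open_nbhs_nbhs.
apply: ambientP => [i|].
  have dgi u := is_derive_linear (linear_hcoord i) (@continuous_hcoord _ _ i) (derivableP (dg u)).
  have dci u := is_deriveM (is_derive_cst (sg b * r) y u) (is_derive_cayley u i y0).
  have dpsi u := is_deriveB (dgi u) (dci u).
  set psi := (_ - _) in dpsi.
  have psi0 : \forall x \near y, halfspace x -> psi x = 0.
    apply: filterS nV => x Vx Hx; rewrite /psi -[LHS]/(hcoord i (g x) - (sg b * r) * cayley x 0 i).
    by rewrite gE// /hcoord /= disk_chart_val// mxE subrr.
  have : 'D_v psi y = 0.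
    by apply: halfspace_derive_eq0 Hy psi0; move=> u; have [] := dpsi u.
  have [_ ->] := dpsi v; rewrite scaler0 addr0 => /eqP; rewrite subr_eq0 => /eqP h.
  by apply: etrans h _; rewrite /hcoord /= [RHS]mxE.
apply: etrans (esym (derive_linear linear_vcoord continuous_vcoord (dg v))) _.
have z0 : \forall x \near y, halfspace x -> (vcoord \o g) x = 0.
  by apply: filterS nV => x Vx Hx; rewrite /= /vcoord gE.
apply: halfspace_derive_eq0 Hy z0 => u.
by have [] := Ck_on_is_derive u (Ck_on_vcoord oV (Sg 1%N)) Vy.
Qed.

Lemma disk_minimal : minimal_immersion disk_atlas disk_map.
Proof.
have scal b : sg b * r != 0.
  by rewrite mulf_neq0//; have := sgsg b; case: eqVneq => // ->; rewrite mul0r => /esym/eqP; rewrite oner_eq0.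
split.
  split; first by move=> _ [b _ <-]; exact: disk_smooth_within.
  move=> _ y g [b _ <-] Hy lg v; rewrite (disk_rep_derive v Hy lg) => -[] /eqP.
  rewrite scaler_eq0 (negbTE (scal b)) /= => /eqP.
  exact/dcayley_inj/halfspace_cayley_dom.
move=> _ y g [b _ <-] Hy lg nu [_ hnu]; rewrite /mean_curvature.
have y0 := halfspace_cayley_dom n0 Hy.
have nu1 : nu.1 = 0.
  have [w wE] := dcayley_surj nu.1 y0; apply: dot_eq0; have := hnu w.
  rewrite (disk_rep_derive w Hy lg) wE /adot /= mul0r addr0 dotZl => /eqP.
  by rewrite mulf_eq0 (negbTE (scal b)) /= => /eqP.
have [V [oV Vy Sg gE]] := lg.
have nV : \forall x \near y, V x by exact: open_nbhs_nbhs.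
suff -> : second_form g y nu = 0 by rewrite mulmx0 mxtrace0.
apply/matrixP => i j; rewrite [LHS]mxE [RHS]mxE /adot nu1.
have -> : dot ('D_(evec i) (fun w => 'D_(evec j) g w) y).1 0 = 0.
  by rewrite /dot big1// => k _; rewrite [X in _ * X]mxE mulr0.
suff -> : ('D_(evec i) (fun w => 'D_(evec j) g w) y).2 = 0 by rewrite mul0r addr0.
have Cj := Ck_on_derive (evec j) (Sg 2%N).
have dgj : derivable ('D_(evec j) g) y (evec i) by have [] := Ck_on_is_derive (evec i) Cj Vy.
apply: etrans (esym (derive_linear linear_vcoord continuous_vcoord dgj)) _.
have z0 : \forall x \near y, halfspace x -> (vcoord \o 'D_(evec j) g) x = 0.
  apply: filterS nV => x Vx Hx; rewrite /= /vcoord (@disk_rep_derive b x g (evec j) Hx)//.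
  by exists V; split.
apply: halfspace_derive_eq0 Hy z0 => u.
by have [] := Ck_on_is_derive u (Ck_on_vcoord oV Cj) Vy.
Qed.

Variables (I : set R) (omega : R -> R).
Hypothesis cat : catenoid_profile n I omega.
Hypothesis rE : r = omega 0.

Let enorm_sqr (x : 'rV[R]_n) : dot x x = r ^+ 2 -> enorm x = r.
Proof. by move=> h; rewrite /enorm h sqrtr_sqr gtr0_norm. Qed.

Lemma disk_free_boundary : free_boundary I omega disk_atlas disk_map.
Proof.
split.
  move=> _ [p [_ [[b _ <-] /= hp hp0]] <-]; split; first exact: (profile_I0 cat).
  rewrite /= -rE; apply: enorm_sqr; move: hp0; rewrite (dot_cayley_inv n0 hp) => /eqP.
  rewrite mulf_eq0 invr_eq0 (negbTE hp) orbF subr_eq0 => /eqP h.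
  by rewrite -(scale_cancel' b (disk_val p)) dot_scale -h mulr1.
exists false; rewrite /= expr0 => _ y g [b _ <-] Hy y0 lg.
have yd := halfspace_cayley_dom n0 Hy.
set p := disk_map _; rewrite scale1r.
have c2 : dot (cayley y) (cayley y) = 1 by rewrite (dot_cayley n0 yd) y0 mulr0 mul0r subr0.
have p1 : p.1 = (sg b * r) *: cayley y by rewrite /p /= disk_chart_val.
have p2 : p.2 = 0 by [].
have pE : enorm p.1 = omega p.2 by rewrite p2 -rE; apply: enorm_sqr; rewrite p1 dot_scale c2 mulr1.
have Ip : I p.2 by exact: (profile_I0 cat).
have w0 : derive1 omega p.2 = 0 := profile_derive1_0 cat.
have scal : sg b * r != 0.
  by rewrite mulf_neq0//; have := sgsg b; case: eqVneq => // ->; rewrite mul0r => /esym/eqP; rewrite oner_eq0.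
have aE q : adot q (revolution_normal omega p) =
    (Num.sqrt (1 + derive1 omega p.2 ^+ 2))^-1 * ((omega p.2)^-1 * dot q.1 p.1).
  by rewrite (adot_revolution_normal q Ip pE) {2}w0 mul0r subr0.
split=> [nu [_ hnu]|].
  have nu1 : nu.1 = 0.
    have [w wE] := dcayley_surj nu.1 yd; apply: dot_eq0; have := hnu w.
    rewrite (disk_rep_derive w Hy lg) wE /adot /= mul0r addr0 dotZl => /eqP.
    by rewrite mulf_eq0 (negbTE scal) /= => /eqP.
  by rewrite aE nu1 /dot big1 ?mulr0// => i _; rewrite mxE mul0r.
rewrite aE (disk_rep_derive _ Hy lg) pmulr_rlt0 ?normal_factor_gt0//.
rewrite pmulr_rlt0 ?invr_gt0 ?(profile_gt0 cat Ip)// p1 [(_, _).1]/=.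
rewrite dotZl dotZr (dcayley_inward n0 yd y0) mulrA mulrACA sgsg mul1r.
rewrite mulrN oppr_lt0 mulr_gt0 ?mulr_gt0// invr_gt0.
by rewrite lt_def yd dot_ge0.
Qed.

Lemma disk_free_boundary_minimal :
  [/\ free_boundary_minimal_hypersurface I omega disk_atlas disk_map,
      bounded_set (range disk_map), injective disk_map & range disk_map = flat_disk omega].
Proof.
split.
- split.
  + exact: disk_smooth_atlas.
  + by split; [exact: disk_compact|exact: disk_connected].
  + exists (cinv (disk_chart false) 0); exists (disk_chart false).
    have H0 : halfspace (0 : 'rV[R]_n).
      by rewrite /halfspace /= /dot big1// => i _; rewrite mxE mul0r.
    have [_ _ _ rK _] := disk_is_chart false; have [d0 e0] := rK 0 H0.
    split=> //; first by exists false.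
    by rewrite e0 /dot big1// => i _; rewrite mxE mul0r.
  + exact: disk_minimal.
  + exact: disk_free_boundary.
- exists r; split; first exact: num_real.
  move=> t rt _ [p _ <-]; apply: le_trans (ltW rt).
  by rewrite /Num.Def.normr /= ge_max disk_norm_le normr0 ltW.
- by move=> p q [] /disk_val_inj.
- apply/seteqP; split=> [_ [p _ <-]|[x z] [/= -> hx]].
    split=> //=; rewrite -rE /enorm -[leRHS]gtr0_norm// -sqrtr_sqr ler_sqrt ?sqr_ge0//.
    exact: disk_valP.
  exists (to_disk x) => //; rewrite /disk_map to_diskK//.
  by rewrite -[leLHS]sqr_sqrtr ?dot_ge0// -/(enorm x) rE ler_sqr ?nnegrE ?sqrtr_ge0// -rE ltW.
Qed.

End Disk.

Theorem corollary3p3 (R : realType) (n : nat) (n_ge2 : (2 <= n)%N)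
    (I : set R) (omega : R -> R) (cat : catenoid_profile n I omega) :
  (forall (M : topologicalType) (A : set (chart R n M))
      (F : M -> 'rV[R]_n * R),
    free_boundary_minimal_hypersurface I omega A F ->
    bounded_set (range F) ->
    injective F /\ range F = flat_disk omega) /\
  (exists (M : topologicalType) (A : set (chart R n M))
      (F : M -> 'rV[R]_n * R),
    [/\ free_boundary_minimal_hypersurface I omega A F,
        bounded_set (range F),
        injective F & range F = flat_disk omega]).
Proof.
split=> [M A F hF _|]; first exact: hypersurface_is_disk n_ge2 cat hF.
have n0 : (0 < n)%N by exact: leq_trans n_ge2.
have r0 : 0 < omega 0 := profile_gt0 cat (profile_I0 cat).
exists (disk (n := n) (omega 0)), (@disk_atlas R n (omega 0)), (@disk_map R n (omega 0)).
exact: disk_free_boundary_minimal.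
Qed.
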